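(* Let $\mathcal X,\mathcal Y$ be real separable Hilbert spaces, $1\le p<\infty$, $B>0$, $\sigma>0$, $m\in\mathbb N$, let $\mu$ be a probability measure on $\mathcal X$ satisfying conditions (i), (ii), (iii-L), (iii-U) of the context with $\lambda_1\le1$, and suppose the noise is Hilbert-valued Gaussian noise with covariance operator $\Upsilon$. Let $k\in\mathbb N_0$, $0<\alpha\le1$ and $\mathcal F=\mathcal F^{k,\alpha}_B$. Then there are constants $c=c_\Upsilon>0$ (depending on $\Upsilon$), $c_{k,\alpha}>0$ (depending on $k,\alpha$) and $c_p>0$ (depending on $p$) such that $$\mathcal M_m(\mathcal F;L^p_\mu)\ \gtrsim\ \frac{B}{(c_{k,\alpha})^d\Lambda_{k,\alpha,d}}(\iota c_p)^{d/p}\left(\min\left\{1,\ \frac a8,\ \left(\frac{B^2m}{c\,a^d\sigma^2(c_{k,\alpha})^{2d}\Lambda_{k,\alpha,d}^2}\right)^{-\frac{1}{2(k+\alpha)+d}}\right\}\right)^{k+\alpha}$$ for all $d\in\mathbb N$ (with $d\le\dim\mathcal X$), with a universal constant in $\gtrsim$, where $$\Lambda_{k,\alpha,d}=(k+2)\left(\sum_{i=1}^d(\lambda_i)^{-\frac{\alpha}{2-\alpha}}\right)^{1-\frac\alpha2}\left(\sum_{j=1}^d 1/\lambda_j\right)^{\frac k2}$$ and $\mathcal M_m(\mathcal F;L^p_\mu)$ is either the fixed-design or the random-design minimax risk.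
   Context: Conditions on $\mu$ (a Borel probability measure on $\mathcal X$; $\mathcal X$ may be finite- or infinite-dimensional): (i) $\mu$ has mean zero and $\int_{\mathcal X}\|X\|_{\mathcal X}^2\,d\mu(X)<\infty$. (ii) Let $\lambda_1\ge\lambda_2\ge\cdots>0$ and $\{\phi_i\}_i\subset\mathcal X$ be the eigenvalues and an orthonormal basis of eigenvectors of the covariance operator of $\mu$. The real random variables $\xi_i=\langle X,\phi_i\rangle_{\mathcal X}/\sqrt{\lambda_i}$, $X\sim\mu$, are independent. (iii-L) Each $\xi_i$ has a density $\nu_i$ with respect to Lebesgue measure, and there are constants $a,b>0$ (independent of $i$) with $\nu_i(x)\ge b$ for all $|x|\le a$ and all $i$. Put $\iota=2ab\le1$. (This is the condition required for lower bounds.) (iii-U) With $p'=\max\{p,2\}$, $\sup_i(\mathbb E|\xi_i|^{p'})^{1/p'}<\infty$. (This is the condition required for upper bounds.) Observations: $Y_i=F(X_i)+\sigma E_i$, $i=1,\dots,m$. Hilbert-valued Gaussian noise: $E_1,\dots,E_m$ are i.i.d. mean-zero Gaussian random elements of $\mathcal Y$ with covariance operator $\Upsilon$, $\mathrm{Tr}(\Upsilon)=1$. Class: $\mathcal L^j(\mathcal X;\mathcal Y)$ is the space of continuous $j$-linear maps from $\mathcal X$ to $\mathcal Y$ with the operator norm ($\mathcal L^0=\mathcal Y$), and $D^jF(X)\in\mathcal L^j(\mathcal X;\mathcal Y)$ is the $j$th Fréchet derivative ($D^0F=F$). $C^{k,\alpha}(\mathcal X;\mathcal Y)$ is the space of $k$-times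 differentiable $F:\mathcal X\to\mathcal Y$ whose $k$th derivative is $\alpha$-Hölder continuous, with norm $\|F\|_{C^{k,\alpha}}=\sum_{j=0}^k\sup_{X\in\mathcal X}\|D^jF(X)\|_{\mathcal L^j(\mathcal X;\mathcal Y)}+[D^kF]_\alpha$, where $[D^kF]_\alpha=\sup_{X\ne X'}\|D^kF(X)-D^kF(X')\|_{\mathcal L^k(\mathcal X;\mathcal Y)}/\|X-X'\|_{\mathcal X}^\alpha$. $\mathcal F^{k,\alpha}_B=\{F\in C^{k,\alpha}(\mathcal X;\mathcal Y):\|F\|_{C^{k,\alpha}}\le B\}$. Norm: $\|F\|_{L^p_\mu(\mathcal X;\mathcal Y)}=(\int_{\mathcal X}\|F(X)\|_{\mathcal Y}^p\,d\mu(X))^{1/p}$. Minimax risks: an estimator $\widehat F$ is a mapping from the data to $L^p_\mu(\mathcal X;\mathcal Y)$. Fixed design: $\mathcal M_m(\mathcal F;L^p_\mu)=\inf_{\mathcal D}\inf_{\widehat F}\sup_{F\in\mathcal F}\mathbb E\|F-\widehat F\|_{L^p_\mu(\mathcal X;\mathcal Y)}$, with infimum over designs $\mathcal D=\{X_1,\dots,X_m\}\subset\mathcal X$ and expectation over the $E_i$. Random design: $\mathcal M_m(\mathcal F;L^p_\mu)=\inf_\nu\inf_{\widehat F}\sup_{F\in\mathcal F}\mathbb E\|F-\widehat F\|_{L^p_\mu(\mathcal X;\mathcal Y)}$, with infimum over probability measures $\nu$ on $\mathcal X$, $X_1,\dots,X_m$ i.i.d. from $\nu$ independent of the $E_i$,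 and expectation over the $X_i$ and $E_i$. *)

(* Defs.v *)
From HB Require Import structures.
From mathcomp Require Import all_boot all_order all_algebra.
From mathcomp Require Import sesquilinear.
From mathcomp Require Import all_classical all_reals all_analysis.
From mathcomp Require Import measurable_realfun.

Set Implicit Arguments.
Unset Strict Implicit.
Unset Printing Implicit Defensive.

Import Order.TTheory GRing.Theory Num.Theory.
Import numFieldNormedType.Exports.

Local Open Scope classical_set_scope.
Local Open Scope ring_scope.

HB.mixin Record CompleteNormedModule_isHilbert (R : realType) X
    of CompleteNormedModule R X := {
  inner : {dot X for idfun} ;
  inner_normE : forall x : X, inner x x = `|x| ^+ 2
}.

#[short(type="hilbertType")]
HB.structure Definition Hilbert (R : realType) :=
  {X of CompleteNormedModule_isHilbert R X & CompleteNormedModule R X}.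

Definition separable (T : topologicalType) : Prop :=
  exists A : set T, countable A /\ dense A.

(** The completeness axiom is maximality of the orthonormal family. *)
Definition orthonormal_basis (R : realType) (X : hilbertType R) (I : Type)
    (D : set I) (e : I -> X) : Prop :=
  [/\ forall i, D i -> `|e i| = 1,
      forall i j, D i -> D j -> i <> j -> inner (e i) (e j) = 0 &
      forall x, (forall i, D i -> inner x (e i) = 0) -> x = 0].

(** For positive [Z], such as a covariance operator, the sum does not depend on
    the orthonormal basis [S]. *)
Definition has_trace (R : realType) (X : hilbertType R) (Z : X -> X)
    (t : \bar R) : Prop :=
  exists2 S : set X, orthonormal_basis S id &
    \esum_(e in S) (inner (Z e) e)%:E = t.

Notation borel T := (g_sigma_algebraType (@open T)).

Section random_elements.
Context (R : realType) (X : hilbertType R).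
Implicit Types (P : probability (borel X) R).
Local Open Scope ereal_scope.

(** Mean and covariance operator are taken in the weak sense, which agrees with
    Bochner integration as soon as the second moment is finite. *)
Definition mean_zero P : Prop :=
  forall v : X, \int[P]_x (inner (x : X) v)%:E = 0.

Definition finite_second_moment P : Prop :=
  \int[P]_x (`|x : X| ^+ 2)%:E < +oo.

Definition is_covariance P (C : X -> X) : Prop :=
  forall u v : X,
    \int[P]_x (inner (x : X) u * inner (x : X) v)%:E = (inner (C u) v)%:E.

(** [normal_prob m 0] is not the point mass at [m] in the library. *)
Definition gaussian1 (m s : R) (A : set R) : \bar R :=
  if s == 0%R then \d_m A else normal_prob m s A.

Definition is_gaussian P : Prop :=
  forall v : X, exists m s : R, (0 <= s)%R /\
    forall A : set R, measurable A ->
      P [set x | A (inner (x : X) v)] = gaussian1 m s A.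

Definition independent_family (P : probability (borel X) R) (I : eqType)
    (D : set I) (xi : I -> X -> R) : Prop :=
  forall (J : seq I) (A : I -> set R), uniq J -> (forall i, i \in J -> D i) ->
    (forall i, measurable (A i)) ->
    P [set x | forall i, i \in J -> A i (xi i x)] =
    \prod_(i <- J) P [set x | A i (xi i x)].

End random_elements.

Section input_measure.
Context (R : realType) (X : hilbertType R).
Variables (mu : probability (borel X) R).

(** The basis is indexed, from 0, by an initial segment [D] of [nat], whose
    cardinality is the dimension of [X]; thus [d <= dim X] reads
    [`I_d `<=` D]. *)
Definition covariance_eigenbasis (D : set nat) (lam : nat -> R)
    (phi : nat -> X) : Prop :=
  [/\ forall i j, (i <= j)%N -> D j -> D i,
      forall i, D i -> 0 < lam i,
      forall i j, D i -> D j -> (i <= j)%N -> lam j <= lam i,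
      orthonormal_basis D phi &
      exists2 C : X -> X, is_covariance mu C &
        forall i, D i -> C (phi i) = lam i *: phi i].

Definition coordinate (lam : nat -> R) (phi : nat -> X) (i : nat) (x : X) : R :=
  inner x (phi i) / Num.sqrt (lam i).

Definition densities_bounded_below (D : set nat) (xi : nat -> X -> R)
    (a b : R) : Prop :=
  exists nu : nat -> R -> R, forall i, D i ->
    [/\ measurable_fun setT (nu i),
        forall t, 0 <= nu i t,
        forall A : set R, measurable A ->
          mu [set x | A (xi i x)] = (\int[lebesgue_measure]_(t in A) (nu i t)%:E)%E &
        forall t, `|t| <= a -> b <= nu i t].

Definition moments_bounded (D : set nat) (xi : nat -> X -> R) (q : R) : Prop :=
  (ereal_sup [set Lnorm mu q%:E (EFin \o xi i) | i in D] < +oo)%E.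

End input_measure.

(** Elements of [L^j(X; Y)] are functions of a family of [j] arguments. *)

Section multilinear.
Context (R : realType) (X Y : normedModType R).

Definition continuous_multilinear (j : nat) (M : ('I_j -> X) -> Y) : Prop :=
  (forall (v : 'I_j -> X) (i : 'I_j),
     linear (fun u : X => M [eta v with i |-> u])) /\
  continuous (M : {ptws 'I_j -> X} -> Y).

Definition opnorm (j : nat) (M : ('I_j -> X) -> Y) : \bar R :=
  ereal_sup [set `|M v|%:E | v in [set v | forall i, `|v i| <= 1]].

Definition fcons (T : Type) (j : nat) (h : T) (v : 'I_j -> T) : 'I_j.+1 -> T :=
  fun i => oapp v h (unlift ord0 i).

(** Under the identification of [L(X; L^j(X; Y))] with [L^{j+1}(X; Y)]. *)
Definition is_frechet (j : nat) (G : X -> ('I_j -> X) -> Y)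
    (G' : X -> ('I_j.+1 -> X) -> Y) : Prop :=
  forall (x : X) (eps : R), 0 < eps ->
    \forall h \near (0 : X),
      (opnorm (fun v => G (x + h) v - G x v - G' x (fcons h v))%R
         <= (eps * `|h|)%:E)%E.

Definition is_derivatives (F : X -> Y) (k : nat)
    (DF : forall j, X -> ('I_j -> X) -> Y) : Prop :=
  [/\ forall x v, DF 0%N x v = F x,
      forall j x, (j <= k)%N -> continuous_multilinear (DF j x) &
      forall j, (j < k)%N -> is_frechet (DF j) (DF j.+1)].

(** The maximum with 0 only matters when [X] is the null space. *)
Definition holder_seminorm (alpha : R) (j : nat)
    (G : X -> ('I_j -> X) -> Y) : \bar R :=
  maxe 0%E (ereal_sup
    [set (opnorm (fun v => G xx.1 v - G xx.2 v)%R
            * (`|xx.1 - xx.2| `^ (- alpha))%:E)%E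
       | xx in [set xx : X * X | xx.1 != xx.2]]).

Definition holder_norm (k : nat) (alpha : R)
    (DF : forall j, X -> ('I_j -> X) -> Y) : \bar R :=
  (\sum_(j < k.+1) ereal_sup (range (fun x => opnorm (DF j x)))
     + holder_seminorm alpha (DF k))%E.

Definition holder_ball (k : nat) (alpha B : R) : set (X -> Y) :=
  [set F | exists DF, is_derivatives F k DF /\
     (holder_norm k alpha DF <= B%:E)%E].

End multilinear.

Section iid.
Context d (T : measurableType d) (R : realType).

Definition cons_pair (n : nat) (z : T * n.-tuple T) : n.+1.-tuple T :=
  [tuple of z.1 :: z.2].

Lemma measurable_cons_pair n : measurable_fun setT (@cons_pair n).
Proof. by apply: measurable_cons. Qed.

HB.instance Definition _ n :=
  isMeasurableFun.Build _ _ _ _ (@cons_pair n) (@measurable_cons_pair n).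

Fixpoint iid_law (P : probability T R) (n : nat) : probability (n.-tuple T) R :=
  match n with
  | 0%N => \d_([tuple] : 0.-tuple T)
  | n'.+1 => distribution (P \x iid_law P n')%E (@cons_pair n')
  end.

End iid.

Section minimax.
Context (R : realType) (X Y : hilbertType R).
Variables (mu : probability (borel X) R) (p : R).

Definition Lpnorm (G : X -> Y) : \bar R :=
  Lnorm mu p%:E (fun x => `|G x|%:E).

Definition Lp : set (X -> Y) :=
  [set G | measurable_fun [set: borel X] (G : borel X -> borel Y) /\
     (Lpnorm G < +oo)%E].

(** Measurability, needed for the risk to make sense, is that of a map into the
    separable metric space [L^p]: all distances to fixed elements are
    measurable. *)
Definition estimator d (T : measurableType d) : set (T -> X -> Y) :=
  [set Fhat : T -> X -> Y | (forall t, Lp (Fhat t)) /\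
     forall G, Lp G ->
       measurable_fun [set: T] (fun t => Lpnorm (fun x => G x - Fhat t x))].

Variables (gam : probability (borel Y) R) (sigma : R) (m : nat).

Definition observations (F : X -> Y) (xs : m.-tuple (borel X))
    (es : m.-tuple (borel Y)) : m.-tuple (borel Y) :=
  [tuple (F (tnth xs i) + sigma *: (tnth es i : Y) : borel Y) | i < m].

Local Open Scope ereal_scope.

Definition fixed_risk (xs : m.-tuple (borel X))
    (Fhat : m.-tuple (borel Y) -> X -> Y) (F : X -> Y) : \bar R :=
  \int[iid_law gam m]_es
    Lpnorm (fun x => (F x - Fhat (observations F xs es) x)%R).

Definition minimax_fixed (Fs : set (X -> Y)) : \bar R :=
  ereal_inf [set ereal_inf [set ereal_sup [set fixed_risk xs Fhat F | F in Fs]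
                           | Fhat in @estimator _ (m.-tuple (borel Y))]
            | xs in [set: m.-tuple (borel X)]].

Definition random_risk (nu : probability (borel X) R)
    (Fhat : m.-tuple (borel X) * m.-tuple (borel Y) -> X -> Y)
    (F : X -> Y) : \bar R :=
  \int[iid_law nu m \x iid_law gam m]_z
    Lpnorm (fun x => (F x - Fhat (z.1, observations F z.1 z.2) x)%R).

Definition minimax_random (Fs : set (X -> Y)) : \bar R :=
  ereal_inf [set ereal_inf [set ereal_sup [set random_risk nu Fhat F | F in Fs]
              | Fhat in @estimator _ (m.-tuple (borel X) * m.-tuple (borel Y))%type]
            | nu in [set: probability (borel X) R]].

End minimax.

Section rate.
Context (R : realType).

Definition Lambda (lam : nat -> R) (k : nat) (alpha : R) (d : nat) : R :=
  (k + 2)%:R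
  * (\sum_(i < d) lam i `^ (- (alpha / (2 - alpha)))) `^ (1 - alpha / 2)
  * (\sum_(j < d) (lam j)^-1) `^ (k%:R / 2).

Definition lower_rate (ckalpha cp c : R) (lam : nat -> R) (k : nat)
    (alpha p B sigma a b : R) (m d : nat) : R :=
  let L := Lambda lam k alpha d in
  let iota := 2 * a * b in
  B / (ckalpha ^+ d * L) * (iota * cp) `^ (d%:R / p)
  * (Num.min 1 (Num.min (a / 8)
       ((B ^+ 2 * m%:R
           / (c * a ^+ d * sigma ^+ 2 * ckalpha ^+ (2 * d) * L ^+ 2))
        `^ (- (2 * (k%:R + alpha) + d%:R)^-1)))) `^ (k%:R + alpha).

End rate.

(* Main.v *)
Require Import Defs.
From HB Require Import structures.
From mathcomp Require Import all_boot all_order all_algebra.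
From mathcomp Require Import all_classical all_reals all_analysis.
From mathcomp Require Import measurable_realfun ring lra.
From mathcomp Require Import sesquilinear.
Set Implicit Arguments.
Unset Strict Implicit.
Unset Printing Implicit Defensive.
Import Order.TTheory GRing.Theory Num.Theory.
Import numFieldNormedType.Exports.
Local Open Scope classical_set_scope.
Local Open Scope ring_scope.

(** Assouad's method. The box [|xi_i| <= a], [i < d], is cut into [n ^ d] cells of
    width [delta]; [psi_z] is a plateau bump in the first [d] coordinates carried by
    the cell [z], and [F_tau = h * \sum_z (-1) ^ tau_z * psi_z * w], where
    [w = Upsilon e] is a unit Cameron-Martin vector of the noise. At each point at
    most one bump is active, and the inequalities of Bessel and Hölder bound the
    derivatives of the coordinate map by the two sums in [Lambda], so that
    [h = B * delta ^ (k + alpha) / (ck ^ d * Lambda)] puts every [F_tau] in the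
    Hölder ball. Flipping one sign translates the noise along [w]; by the
    Cameron-Martin formula and a second moment bound on the likelihood ratio, on
    average over the signs a fixed proportion of them is misjudged by any estimator
    once [delta] is as in the rate. Each misjudged sign costs the [mu]-mass of a
    cell, at least [(b * delta / 2) ^ d] by independence and the density bound. *)

(** * Inner products *)

(** The main obstacle is that [is_gaussian] speaks of one-dimensional marginals only, while flipping
    a sign translates the noise in the whole space. The cosines of the marginals determine the law,
    which shows that the noise is distributed as [Phi (y, z)], where the independent standard normal
    [z] carries the whole [e]-component. A translation along [w] then acts on [z] alone, and the
    formula on the line suffices. Only this direction of the noise matters, so
    [c = (16 <Ups e, e>)^-1] depends on [Ups] alone; a nonzero trace supplies [e]. Wherever the
    design points lie, each observation informs on at most one sign. The bound therefore holds for
    every design and can be integrated against any law of the design, so that fixed and random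
    designs share one proof. Origin of the constants: [1 / 8] is the proportion of misjudged signs;
    [cp = 1 / 4] because the middle halves of the intervals of width [delta] cover at least a
    quarter of [[-a, a]]; [ck] is 4 times a bound on the derivatives of the one-dimensional
    profile. *)

Section inner_product.
Context (R : realType) (X : hilbertType R).
Implicit Types u v w x y : X.

Lemma inner_sym u v : inner u v = inner v u.
Proof. by rewrite (hermC inner) /= expr0 mul1r. Qed.

Lemma innerDl u v w : inner (u + v) w = inner u w + inner v w.
Proof. by rewrite linearDl. Qed.

Lemma innerZl (t : R) u w : inner (t *: u) w = t * inner u w.
Proof. by rewrite linearZl_LR. Qed.

Lemma innerDr u v w : inner w (u + v) = inner w u + inner w v.
Proof. by rewrite !(inner_sym w) innerDl. Qed.

Lemma innerZr (t : R) u w : inner w (t *: u) = t * inner w u.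
Proof. by rewrite !(inner_sym w) innerZl. Qed.

Lemma inner0l w : inner 0 w = 0.
Proof. by rewrite -(scale0r (0 : X)) innerZl mul0r. Qed.

Lemma inner0r w : inner w 0 = 0.
Proof. by rewrite inner_sym inner0l. Qed.

Lemma innerNl u w : inner (- u) w = - inner u w.
Proof. by rewrite -scaleN1r innerZl mulN1r. Qed.

Lemma innerNr u w : inner w (- u) = - inner w u.
Proof. by rewrite inner_sym innerNl inner_sym. Qed.

Lemma innerBl u v w : inner (u - v) w = inner u w - inner v w.
Proof. by rewrite innerDl innerNl. Qed.

Lemma innerBr u v w : inner w (u - v) = inner w u - inner w v.
Proof. by rewrite innerDr innerNr. Qed.

Lemma inner_suml (I : Type) (r : seq I) (P : pred I) (f : I -> X) w :
  inner (\sum_(i <- r | P i) f i) w = \sum_(i <- r | P i) inner (f i) w.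
Proof.
elim/big_rec2: _ => [|i y1 y2 _ <-]; first exact: inner0l.
exact: innerDl.
Qed.

Lemma Cauchy_Schwarz u v : `|inner u v| <= `|u| * `|v|.
Proof.
have [->|v0] := eqVneq v 0; first by rewrite inner0r !normr0 mulr0.
have nv : 0 < `|v| by rewrite normr_gt0.
have : 0 <= inner (u - (inner u v / `|v| ^+ 2) *: v) (u - (inner u v / `|v| ^+ 2) *: v).
  by rewrite inner_normE sqr_ge0.
rewrite !(innerBl, innerBr, innerZl, innerZr) (inner_sym v u) !inner_normE => H.
rewrite -(ler_pXn2r (n := 2)) ?nnegrE ?mulr_ge0 // real_normK ?num_real // exprMn.
have nv2 : 0 < `|v| ^+ 2 by rewrite exprn_gt0.
rewrite -ler_pdivrMr // -subr_ge0; apply: le_trans H _.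
by rewrite le_eqVlt; apply/orP; left; apply/eqP; field; rewrite gt_eqF.
Qed.

Lemma continuous_inner v : continuous (fun x => inner x v).
Proof.
move=> x; apply/(@cvgrPdist_le _ R^o) => e e0.
near=> y; rewrite -innerBl; apply: le_trans (Cauchy_Schwarz _ _) _.
apply: (@le_trans _ _ (`|x - y| * (`|v| + 1))).
  by rewrite ler_wpM2l // lerDl.
rewrite -ler_pdivlMr ?ltr_wpDl //.
near: y; apply: cvgr_dist_le; first exact: cvg_id.
by rewrite divr_gt0 // ltr_wpDl.
Unshelve. all: by end_near. Qed.

Lemma bessel (n : nat) (e : nat -> X) (v : X) :
  (forall i, (i < n)%N -> `|e i| = 1) ->
  (forall i j, (i < n)%N -> (j < n)%N -> i <> j -> inner (e i) (e j) = 0) ->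
  \sum_(i < n) inner v (e i) ^+ 2 <= `|v| ^+ 2.
Proof.
move=> e1 e0.
pose w := \sum_(i < n) inner v (e i) *: e i.
have wv : inner w v = \sum_(i < n) inner v (e i) ^+ 2.
  rewrite inner_suml; apply: eq_bigr => i _.
  by rewrite innerZl inner_sym expr2.
have ww : inner w w = \sum_(i < n) inner v (e i) ^+ 2.
  rewrite {1}/w inner_suml; apply: eq_bigr => i _; rewrite innerZl expr2.
  congr (_ * _); rewrite inner_sym inner_suml (bigD1 i) //= innerZl inner_normE e1 //.
  rewrite expr1n mulr1 big1 ?addr0 // => j ji; rewrite innerZl e0 ?mulr0 //.
  by apply/eqP; rewrite (inj_eq val_inj).
have : 0 <= inner (v - w) (v - w) by rewrite inner_normE sqr_ge0.
rewrite !(innerBl, innerBr) (inner_sym v w) wv ww inner_normE; lra.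
Qed.

End inner_product.

(** * Gaussian measures on the line *)

Section density.
Local Open Scope ereal_scope.
Context d (T : measurableType d) (R : realType).
Variables (m1 m2 : {measure set T -> \bar R}) (g : T -> R).
Hypothesis mg : measurable_fun setT g.
Hypothesis g0 : forall x, (0 <= g x)%R.
Hypothesis m1E : forall A, measurable A -> m1 A = \int[m2]_(x in A) (g x)%:E.

Import HBNNSimple.

Let density_nnsfun (h : {nnsfun T >-> R}) :
  \int[m1]_x (h x)%:E = \int[m2]_x ((h x)%:E * (g x)%:E).
Proof.
under eq_integral do rewrite fimfunE -fsumEFin//.
rewrite ge0_integral_fsum//; last 2 first.
- by move=> r; exact/measurable_EFinP/measurable_funM.
- by move=> n x _; rewrite nnfun_muleindic_ge0.
under [RHS]eq_integral.
  move=> x _; rewrite fimfunE -fsumEFin// ge0_mule_fsuml; last first.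
    by move=> r; rewrite EFinM nnfun_muleindic_ge0.
  over.
rewrite ge0_integral_fsum//; last 2 first.
- move=> r; apply: emeasurable_funM; last exact/measurable_EFinP.
  exact/measurable_EFinP/measurable_funM.
- by move=> n x _; rewrite mule_ge0 ?lee_fin ?g0// -lee_fin EFinM nnfun_muleindic_ge0.
apply: eq_fsbigr => r /[!inE] -[x _ rx].
have r0 : (0 <= r)%R by rewrite -rx.
under eq_integral do rewrite EFinM.
rewrite ge0_integralZl_EFin//; last exact/measurable_EFinP.
under [RHS]eq_integral do rewrite EFinM -muleA.
rewrite ge0_integralZl_EFin//; last 2 first.
- by move=> y _; rewrite -EFinM lee_fin mulr_ge0.
- by apply/measurable_EFinP; apply: measurable_funM.
congr (_ * _); rewrite integral_indic// setIT m1E// integral_mkcond.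
apply: eq_integral => y _; rewrite patchE indicE.
by case: (y \in _); rewrite ?mul1e ?mul0e.
Qed.

Lemma ge0_integral_density (f : T -> \bar R) :
  measurable_fun setT f -> (forall x, 0 <= f x) ->
  \int[m1]_x f x = \int[m2]_x (f x * (g x)%:E).
Proof.
move=> mf f0; pose f_ := nnsfun_approx measurableT mf.
have cf x : (f_ n x)%:E @[n --> \oo] --> f x by exact: cvg_nnsfun_approx.
transitivity (limn (fun n => \int[m1]_x (f_ n x)%:E)).
  rewrite -monotone_convergence//.
  - by apply: eq_integral => y _; apply/esym/cvg_lim => //; exact: cf.
  - by move=> n; exact/measurable_EFinP.
  - by move=> n y _; rewrite lee_fin.
  - by move=> y _ m n mn; rewrite lee_fin; exact/lefP/nd_nnsfun_approx.
under eq_fun do rewrite density_nnsfun.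
rewrite -monotone_convergence//.
- apply: eq_integral => y _; apply/cvg_lim => //.
  apply: cvgeZr => //; exact: cf.
- by move=> n; apply: emeasurable_funM; exact/measurable_EFinP.
- by move=> n y _; rewrite -EFinM lee_fin mulr_ge0.
- move=> y _ m n mn; rewrite lee_wpmul2r ?lee_fin//.
  exact/lefP/nd_nnsfun_approx.
Qed.

End density.

Section gaussian_line.
Context (R : realType).
Notation leb := (@lebesgue_measure R).
Local Open Scope ereal_scope.

Let aff (m s : R) (x : measurableTypeR R) : measurableTypeR R := (m + s * x)%R.

Let maff m s : measurable_fun setT (aff m s).
Proof. by apply: measurable_funD => //; apply: measurable_funM. Qed.

(** Both sides are measures that agree on half-open intervals. *)
Let lebesgue_aff (m s : R) (A : set (measurableTypeR R)) : (0 < s)%R -> measurable A ->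
  leb A = s%:E * leb (aff m s @^-1` A).
Proof.
move=> s0; pose s' := NngNum (ltW s0).
pose L : {measure set (measurableTypeR R) -> \bar R} :=
  mscale s' (measure_function_pushforward__canonical__measure_function_Measure leb (maff m s)).
suff H X : ocitv X -> leb X = L X by move=> /(lebesgue_measure_unique H).
move=> [[a b] _ <-] /=; rewrite /L /mscale /= /pushforward.
rewrite (_ : aff m s @^-1` _ = `]((a - m) / s)%R, ((b - m) / s)%R]%classic); last first.
  apply/seteqP; split => x /=; rewrite /aff !in_itv/=;
  by rewrite ltr_pdivrMr// ler_pdivlMr// ltrBlDl lerBrDl (mulrC s).
rewrite !lebesgue_measure_itv/= !lte_fin ltr_pM2r ?invr_gt0// ltrBlDr subrK.
case: ifPn => _; last by rewrite mule0.
by rewrite -!EFinD -EFinM; congr EFin; field; rewrite gt_eqF.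
Qed.

Lemma ge0_integral_lebesgue_affine (m s : R) (f : R -> \bar R) : (0 < s)%R ->
  measurable_fun setT f -> (forall x, 0 <= f x) ->
  \int[leb]_x f x = s%:E * \int[leb]_x f (m + s * x)%R.
Proof.
move=> s0 mf f0; pose s' := NngNum (ltW s0).
pose L : {measure set (measurableTypeR R) -> \bar R} :=
  mscale s' (measure_function_pushforward__canonical__measure_function_Measure leb (maff m s)).
transitivity (\int[L]_x f x).
  by apply: eq_measure_integral => A mA _; exact: lebesgue_aff.
rewrite ge0_integral_mscale//= ge0_integral_pushforward//.
Qed.

Lemma ge0_integral_normal_pdf (m s : R) (f : R -> \bar R) : 
  measurable_fun setT f -> (forall x, 0 <= f x) ->
  \int[normal_prob m s]_x f x = \int[leb]_x (f x * (normal_pdf m s x)%:E).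
Proof.
move=> mf f0; apply: ge0_integral_density => //.
- exact: measurable_normal_pdf.
- by move=> x; exact: normal_pdf_ge0.
Qed.

Lemma ge0_integral_normal_affine (m s : R) (f : R -> \bar R) : (0 < s)%R ->
  measurable_fun setT f -> (forall x, 0 <= f x) ->
  \int[normal_prob m s]_x f x = \int[normal_prob 0 1]_x f (m + s * x)%R.
Proof.
move=> s0 mf f0.
have mfa : measurable_fun setT (fun x : R => f (m + s * x)%R).
  exact: (measurableT_comp mf (maff m s)).
rewrite !ge0_integral_normal_pdf// (ge0_integral_lebesgue_affine m s0); last 2 first.
- by apply: emeasurable_funM => //; apply/measurable_EFinP; exact: measurable_normal_pdf.
- by move=> x; rewrite mule_ge0// lee_fin normal_pdf_ge0.
rewrite -ge0_integralZl//; last 3 first.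
- apply: emeasurable_funM => //.
  apply/measurable_EFinP.
  exact: (measurableT_comp (measurable_normal_pdf m s) (maff m s)).
- by move=> x _; rewrite mule_ge0// lee_fin normal_pdf_ge0.
- by rewrite lee_fin ltW.
apply: eq_integral => x _; rewrite muleCA -EFinM; congr (_ * _%:E).
rewrite !normal_pdfE ?oner_eq0 ?gt_eqF// /normal_fun/normal_peak.
rewrite mulrA; congr (_ * expR _)%R; last by field; rewrite gt_eqF.
rewrite expr1n mul1r -mulrnAr sqrtrM ?sqr_ge0// sqrtr_sqr gtr0_norm//.
by rewrite invfM mulrA divff ?mul1r// gt_eqF.
Qed.

(** The Cameron-Martin formula on the line, to which the one in [Y] reduces; with [f = 1] it also
    yields the moment generating function. *)
Lemma ge0_integral_normal_shift (t : R) (f : R -> \bar R) :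
  measurable_fun setT f -> (forall x, 0 <= f x) ->
  \int[normal_prob 0 1]_x f (x + t)%R =
  \int[normal_prob 0 1]_x (f x * (expR (t * x - t ^+ 2 / 2))%:E).
Proof.
move=> mf f0.
have mft : measurable_fun setT (fun x : R => f (x + t)%R).
  by apply: measurableT_comp => //; exact: measurable_funD.
rewrite !ge0_integral_normal_pdf//; last 2 first.
- apply: emeasurable_funM => //; apply/measurable_EFinP.
  by apply: measurableT_comp => //; apply: measurable_funB => //; apply: measurable_funM.
- by move=> x; rewrite mule_ge0// lee_fin expR_ge0.
rewrite [RHS](ge0_integral_lebesgue_affine t ltr01); last 2 first.
- apply: emeasurable_funM => //; last by apply/measurable_EFinP; exact: measurable_normal_pdf.
  apply: emeasurable_funM => //; apply/measurable_EFinP.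
  by apply: measurableT_comp => //; apply: measurable_funB => //; apply: measurable_funM.
- by move=> x; rewrite !mule_ge0// lee_fin ?expR_ge0 ?normal_pdf_ge0.
rewrite mul1e; apply: eq_integral => x _; rewrite mul1r (addrC t) -muleA -EFinM.
congr (_ * _%:E); rewrite !normal_pdfE ?oner_eq0// /normal_fun mulrCA -expRD.
by congr (_ * expR _)%R; field.
Qed.

End gaussian_line.

Section differentiation.
Context (R : realType) d (T : measurableType d) (mu : {measure set T -> \bar R}).

Lemma is_derive_under_integral (f f' : R -> T -> R) (G : T -> R) (a u v : R) :
  a \in `]u, v[ ->
  (forall x, x \in `]u, v[ -> mu.-integrable setT (EFin \o f x)) ->
  (forall x y, x \in `]u, v[ -> is_derive x 1 (f ^~ y) (f' x y)) ->
  mu.-integrable setT (EFin \o G) ->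
  (forall x y, x \in `]u, v[ -> `|f' x y| <= G y) ->
  is_derive a 1 (fun x => \int[mu]_y f x y) (\int[mu]_y f' a y).
Proof.
move=> auv intf df intG fG.
have d1 x y : x \in `]u, v[ -> partial1of2 f x y = f' x y.
  by move=> xuv; rewrite /partial1of2 derive1E; apply: derive_val; exact: df.
have G0 y : 0 <= G y by apply: le_trans (fG a y auv); exact: normr_ge0.
have df1 x y : [set` `]u, v[] x -> [set: T] y -> derivable (f ^~ y) x 1.
  by move=> xuv _; apply: ex_derive; exact: df.
have fG1 x y : [set` `]u, v[] x -> [set: T] y -> `|partial1of2 f x y| <= G y.
  by move=> xuv _; rewrite d1//; exact: fG.
have H1 := derivable_under_integral measurableT auv intf df1 G0 intG fG1.
have H2 := differentiation_under_integral measurableT auv intf df1 G0 intG fG1.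
apply: DeriveDef => //; rewrite -derive1E H2.
by apply: eq_Rintegral => y _; exact: d1.
Qed.

End differentiation.

Section real_integrability.
Context (R : realType) d (T : measurableType d) (mu : {measure set T -> \bar R}).
Implicit Types f g : T -> R.

Lemma le_EFin_integrable f g : measurable_fun setT f -> (forall x, `|f x| <= g x) ->
  mu.-integrable setT (EFin \o g) -> mu.-integrable setT (EFin \o f).
Proof.
move=> mf fg; apply: le_integrable => //; first exact/measurable_EFinP.
by move=> x _ /=; rewrite lee_fin (le_trans (fg x))// ler_norm.
Qed.

Lemma EFin_integrableD f g : mu.-integrable setT (EFin \o f) ->
  mu.-integrable setT (EFin \o g) ->
  mu.-integrable setT (EFin \o (fun x => f x + g x)).
Proof.
move=> If Ig; have := integrableD measurableT If Ig.
by apply: eq_integrable => // x _; rewrite /= EFinD.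
Qed.

Lemma EFin_integrableZl (k : R) f : mu.-integrable setT (EFin \o f) ->
  mu.-integrable setT (EFin \o (fun x => k * f x)).
Proof.
move=> If; have := integrableZl measurableT k If.
by apply: eq_integrable => // x _; rewrite /= EFinM.
Qed.

End real_integrability.

Section real_derivatives.
Context (R : realType).
Implicit Types x b t : R.

Lemma is_derive_affine x b t : is_derive t 1 (fun t => t * x + b) x.
Proof.
have -> : (fun t => t * x + b) = (x \*: id) + cst b.
  by apply/funext => y /=; rewrite fctE /= mulrC.
by apply: is_derive_eq; rewrite scaler1 addr0.
Qed.

Lemma is_derive_expR_scale x t :
  is_derive t 1 (fun t => expR (t * x)) (x * expR (t * x)).
Proof.
have h := is_derive_affine x 0 t.
have := is_derive1_comp (is_derive_expR _) h.
rewrite addr0 mulrC; congr is_derive.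
by apply/funext => y /=; rewrite addr0.
Qed.

Lemma is_derive_cos_affine x b t :
  is_derive t 1 (fun t => cos (t * x + b)) (- sin (t * x + b) * x).
Proof. exact: is_derive1_comp (is_derive_cos _) (is_derive_affine x b t). Qed.

Lemma is_derive_sin_affine x b t :
  is_derive t 1 (fun t => sin (t * x + b)) (cos (t * x + b) * x).
Proof. exact: is_derive1_comp (is_derive_sin _) (is_derive_affine x b t). Qed.

Lemma is_derive_gauss (c t : R) :
  is_derive t 1 (fun t => expR (c * t ^+ 2 / 2)) (c * t * expR (c * t ^+ 2 / 2)).
Proof.
have h : is_derive t 1 (fun t : R => c * t ^+ 2 / 2) (c * t).
  rewrite (_ : (fun t : R => _) = (c / 2) \*: (id ^+ 2)); last first.
    by apply/funext => y /=; rewrite !fctE /= /GRing.scale /= mulrAC.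
  apply: is_derive_eq; rewrite /GRing.scale /= expr1 -mulr_natl; field => //.
by rewrite [X in is_derive _ _ _ X]mulrC; exact: is_derive1_comp (is_derive_expR _) h.
Qed.

End real_derivatives.

(** * Moments and Fourier transform of the standard normal law *)

Section gaussian_moments.
Context (R : realType).
Notation N := (normal_prob (0 : R) 1).

Lemma measurable_expR_scale (t : R) : measurable_fun setT (fun x : R => expR (t * x)).
Proof. by apply: measurableT_comp => //; apply: measurable_funM. Qed.

Lemma normal_mgf (t : R) : (\int[N]_x (expR (t * x))%:E = (expR (t ^+ 2 / 2))%:E)%E.
Proof.
have := @ge0_integral_normal_shift R t (cst 1%E) (measurable_cst _) (fun=> lee01).
rewrite integral_cst//= probability_setT mule1 => H.
have E x : (expR (t * x))%:E = ((expR (t ^+ 2 / 2))%:E * (1 * (expR (t * x - t ^+ 2 / 2))%:E))%E.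
  by rewrite mul1e -EFinM -expRD; congr (expR _)%:E; lra.
under eq_integral do rewrite E.
rewrite ge0_integralZl//; last first.
  under eq_fun do rewrite mul1e; apply/measurable_EFinP.
  by apply: measurableT_comp => //; apply: measurable_funB => //; apply: measurable_funM.
by rewrite -H mule1.
Qed.

Lemma normal_expR_integrable (t : R) : N.-integrable setT (EFin \o (fun x => expR (t * x))).
Proof.
apply/integrableP; split; first by apply/measurable_EFinP; exact: measurable_expR_scale.
under eq_integral do rewrite /= ger0_norm ?expR_ge0//.
by rewrite normal_mgf ltry.
Qed.

(* An integrable bound for every function of at most exponential growth. *)
Let G (K x : R) : R := expR (K * x) + expR (- K * x).

Let G_integrable K : N.-integrable setT (EFin \o G K).
Proof. by apply: EFin_integrableD; exact: normal_expR_integrable. Qed.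

Let leG (K L x : R) : 0 <= L <= K -> expR (L * `|x|) <= G K x.
Proof.
move=> /andP[L0 LK]; rewrite /G; have [x0|x0] := leP 0 x.
  by rewrite ger0_norm// ler_wpDr ?expR_ge0// ler_expR ler_wpM2r.
by rewrite ltr0_norm// ler_wpDl ?expR_ge0// ler_expR mulNr -mulrN ler_wpM2r// oppr_ge0 ltW.
Qed.

Lemma exp_growth_integrable (f : R -> R) (L : R) : 0 <= L ->
  measurable_fun setT f -> (forall x, `|f x| <= 2 * expR (L * `|x|)) ->
  N.-integrable setT (EFin \o f).
Proof.
move=> L0 mf fL.
apply: le_EFin_integrable (EFin_integrableZl 2 (G_integrable L)) => // x.
by rewrite (le_trans (fL x))// ler_pM2l// leG// L0 lexx.
Qed.

Let expR_ge1 (x : R) : 0 <= x -> 1 <= expR x.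
Proof. by move=> x0; rewrite -[leLHS]expR0 ler_expR. Qed.

Let ler_normr_expR (x : R) : `|x| <= expR `|x|.
Proof. by apply: le_trans (expR_ge1Dx _); rewrite lerDr. Qed.

(** The moments below are derivatives of Laplace transforms that are known in closed form. *)
Lemma is_derive_normal_laplace (f : R -> R) (a : R) : measurable_fun setT f ->
  (forall x, `|f x| <= 2 * expR `|x|) ->
  is_derive a 1 (fun t => \int[N]_x (f x * expR (t * x)))
    (\int[N]_x (f x * (x * expR (a * x)))).
Proof.
move=> mf fe.
(* On the window of radius 1 around [a] the exponents add up to [|a| + 3]: 1 for [f], 1 for the
   factor [x] and [|a| + 1] for [expR (t * x)]. *)
apply: (@is_derive_under_integral R _ (measurableTypeR R) N
  (fun t x => f x * expR (t * x))
  (fun t x => f x * (x * expR (t * x))) (fun x => 2 * G (`|a| + 3) x) a (a - 1) (a + 1)).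
- by rewrite in_itv/= ltrBlDr ltrDl ltr01.
- move=> t _; apply: (@exp_growth_integrable _ (1 + `|t|)) => //.
  + by apply: measurable_funM => //; exact: measurable_expR_scale.
  + move=> x; rewrite normrM (ger0_norm (expR_ge0 (t * x))) (mulrDl 1 _ `|x|) expRD mul1r mulrA.
    by rewrite ler_pM// ?expR_ge0// ler_expR (le_trans (ler_norm _))// normrM.
- move=> t x _; apply: (is_deriveZ (f x) (is_derive_expR_scale x t)).
- exact: EFin_integrableZl.
- move=> t x; rewrite in_itv/= => /andP[ta at1].
  have tA : `|t| <= `|a| + 1.
    rewrite -lerBlDl (le_trans (lerB_dist _ _))//.
    by rewrite ler_distl; apply/andP; split; apply: ltW; lra.
  rewrite normrM normrM (ger0_norm (expR_ge0 _)).
  apply: (@le_trans _ _ (2 * expR `|x| * (expR `|x| * expR ((`|a| + 1) * `|x|)))).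
    rewrite ler_pM// ?mulr_ge0 ?expR_ge0// ler_pM ?expR_ge0// ler_expR.
    by rewrite (le_trans (ler_norm _))// normrM ler_wpM2r.
  rewrite -mulrA -!expRD ler_pM2l//.
  rewrite (_ : _ + _ = (`|a| + 3) * `|x|); last by ring.
  by rewrite leG// lexx andbT addr_ge0.
Qed.

Let is_derive_uniq (f : R -> R) (a l1 l2 : R) :
  is_derive a 1 f l1 -> is_derive a 1 f l2 -> l1 = l2.
Proof. by move=> H1 H2; rewrite -(@derive_val _ _ _ _ _ _ _ H1) derive_val. Qed.

Let normal_laplace1 (t : R) : \int[N]_x (x * expR (t * x)) = t * expR (t ^+ 2 / 2).
Proof.
have e1 x : `|(cst 1 : R -> R) x| <= 2 * expR `|x|.
  by have := expR_ge1 (normr_ge0 x); rewrite /= normr1; lra.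
have := is_derive_normal_laplace t (measurable_cst _) e1.
under eq_fun do under eq_Rintegral do rewrite mul1r.
under [X in is_derive _ _ _ X]eq_Rintegral do rewrite mul1r.
move=> /is_derive_uniq; apply.
have := is_derive_gauss 1 t; rewrite !mul1r; congr is_derive.
by apply/funext => y; rewrite /Rintegral normal_mgf mul1r.
Qed.

Lemma normal_mean : \int[N]_x x = 0.
Proof.
transitivity (\int[N]_x (x * expR (0 * x))); last by rewrite normal_laplace1 mul0r.
by apply: eq_Rintegral => x _; rewrite mul0r expR0 mulr1.
Qed.

Lemma normal_variance : \int[N]_x (x * x) = 1.
Proof.
have e1 (x : R) : `|x| <= 2 * expR `|x|.
  rewrite (le_trans (ler_normr_expR _))// ler_peMl ?expR_ge0//.
  by rewrite ler1n.
have := is_derive_normal_laplace 0 (@measurable_id _ _ setT) e1.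
under eq_fun do rewrite normal_laplace1.
under [X in is_derive _ _ _ X]eq_Rintegral do rewrite mul0r expR0 mulr1.
move=> /is_derive_uniq; apply.
have := is_deriveM (is_derive_id (0:R) 1) (is_derive_gauss 1 0).
rewrite /GRing.scale /= !(mul0r,mulr0, expr0n, mulr1, expR0, add0r,addr0)/=; congr is_derive.
by apply/funext => y; rewrite !fctE /= mul1r.
Qed.

Let trig_integrable (f : R -> R) (g : R -> R) : (f = cos \/ f = sin) ->
   measurable_fun setT g -> N.-integrable setT (EFin \o (f \o g)).
Proof.
move=> fE mg; apply: (@exp_growth_integrable _ 0) => //.
  by case: fE => ->; apply: measurableT_comp => //; apply: continuous_measurable_fun;
    [exact: continuous_cos|exact: continuous_sin].
move=> x; rewrite mul0r expR0 mulr1 /=.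
apply: (@le_trans _ _ 1); last by rewrite ler1n.
by case: fE => ->; rewrite ler_norml ?cos_geN1 ?cos_le1 ?sin_geN1 ?sin_le1.
Qed.

Let maffine (t b : R) : measurable_fun setT (fun x : R => t * x + b).
Proof. by apply: measurable_funD => //; apply: measurable_funM. Qed.

Let trig_affine_integrable (f : R -> R) (t b : R) : (f = cos \/ f = sin) ->
  N.-integrable setT (EFin \o (fun x => f (t * x + b))).
Proof. by move=> fE; exact: trig_integrable fE (maffine t b). Qed.

Let sin_moment_integrable (t b : R) :
  N.-integrable setT (EFin \o (fun x => sin (t * x + b) * x)).
Proof.
apply: (@exp_growth_integrable _ 1) => //.
  apply: measurable_funM => //.
  exact: measurableT_comp (continuous_measurable_fun (@continuous_sin R)) (maffine t b).
move=> x; rewrite mul1r normrM.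
apply: (@le_trans _ _ (1 * expR `|x|)); last by rewrite ler_wpM2r ?expR_ge0// ler1n.
by rewrite ler_pM// ?ler_normr_expR// ler_norml sin_geN1 sin_le1.
Qed.

Let normal_id_integrable : N.-integrable setT (EFin \o (fun x : R => x)).
Proof.
apply: (@exp_growth_integrable _ 1) => // x.
by rewrite mul1r (le_trans (ler_normr_expR _))// ler_peMl ?expR_ge0// ler1n.
Qed.

(* Stein's identity for [fun x => sin (s * x + b)]. *)
Let normal_sin_moment (s b : R) :
  \int[N]_x (sin (s * x + b) * x) = s * \int[N]_x cos (s * x + b).
Proof.
set y := \int[N]_x cos (s * x + b); pose s0 := \int[N]_x sin (s * x + b).
(* The constant 1 makes [f] nonnegative, as the shift formula requires; it only adds the mean of
   [N], which is 0. *)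
pose f x : R := 1 + sin (s * x + b).
have mf : measurable_fun setT f.
  apply: measurable_funD => //.
  exact: measurableT_comp (continuous_measurable_fun (@continuous_sin R)) (maffine s b).
have f0 x : 0 <= f x by rewrite /f -lerBlDl sub0r sin_geN1.
have f2 x : `|f x| <= 2 * expR `|x|.
  rewrite ger0_norm// (@le_trans _ _ 2)// /f; first by have := sin_le1 (s*x+b); lra.
  by rewrite ler_peMr// expR_ge1.
have := is_derive_normal_laplace 0 mf f2.
rewrite [X in is_derive _ _ _ X](_ : _ = \int[N]_x (sin (s * x + b) * x)); last first.
  transitivity (\int[N]_x (x + sin (s * x + b) * x)).
    by apply: eq_Rintegral => x _; rewrite mul0r expR0 mulr1 /f mulrDl mul1r.
  by rewrite RintegralD// normal_mean add0r.
(* By the shift formula the exponential becomes a translation by [t], and the addition formula of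
   the sine separates [t] from [x]. *)
have -> : (fun t => \int[N]_x (f x * expR (t * x))) =
    (fun t => expR (1 * t ^+ 2 / 2)) * (fun t => 1 + s0 * cos (t * s + 0) + y * sin (t * s + 0)).
  apply/funext => t; rewrite !fctE.
  have -> : \int[N]_x (f x * expR (t * x)) = expR (1 * t ^+ 2 / 2) * \int[N]_x f (x + t).
    have sh := @ge0_integral_normal_shift R t (EFin \o f) ((measurable_EFinP _ _).2 mf) (fun x => f0 x).
    rewrite {2}/Rintegral sh /=.
    have E x : (f x * expR (t * x))%:E = ((expR (1 * t ^+ 2 / 2))%:E * ((f x)%:E * (expR (t * x - t ^+ 2 / 2))%:E))%E.
      rewrite -!EFinM; congr EFin; rewrite mulrCA -expRD; congr (_ * expR _); lra.
    rewrite /Rintegral; under eq_integral do rewrite E.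
    rewrite ge0_integralZl//; last 2 first.
    - apply: emeasurable_funM; apply/measurable_EFinP => //.
      by apply: measurableT_comp => //; apply: measurable_funB => //; apply: measurable_funM.
    - by move=> x _; rewrite -EFinM lee_fin mulr_ge0// expR_ge0.
    rewrite -sh fineM// integrable_fin_num//.
    apply: (@exp_growth_integrable (f \o (+%R^~ t)) 0) => //.
      by apply: measurableT_comp => //; exact: measurable_funD.
    move=> x; rewrite mul0r expR0 mulr1 ger0_norm//= /f.
    by have := sin_le1 (s * (x + t) + b); lra.
  congr (_ * _).
  transitivity (\int[N]_x (1 + (cos (t * s) * sin (s * x + b) + sin (t * s) * cos (s * x + b)))).
    apply: eq_Rintegral => x _; rewrite /f mulrDr addrAC sinD (mulrC s t).
    by congr (_ + (_ + _)); exact: mulrC.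
  have Is := trig_affine_integrable s b (or_intror erefl : sin = cos \/ sin = sin).
  have Ic := trig_affine_integrable s b (or_introl erefl : cos = cos \/ cos = sin).
  have Is' := EFin_integrableZl (cos (t * s)) Is.
  have Ic' := EFin_integrableZl (sin (t * s)) Ic.
  have I1 : N.-integrable setT (EFin \o (fun=> 1 : R)).
    apply: (@exp_growth_integrable _ 0) => // x; rewrite normr1 mul0r expR0 mulr1; lra.
  rewrite RintegralD//; last first.
    exact: EFin_integrableD.
  rewrite RintegralD// !RintegralZl// Rintegral_cst// addr0 -addrA.
  congr (_ + (_ + _)); last 2 first; rewrite 1?mulrC//.
  by rewrite mulr1 [X in fine X]probability_setT.
move=> /is_derive_uniq; apply.
have d2 : is_derive (0 : R) 1 (fun t : R => 1 + s0 * cos (t * s + 0) + y * sin (t * s + 0)) (s * y).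
  have := is_deriveD (is_deriveD (is_derive_cst (1:R) (0:R) 1) (is_deriveZ s0 (is_derive_cos_affine s 0 0)))
    (is_deriveZ y (is_derive_sin_affine s 0 0)).
  by rewrite mul0r addr0 sin0 cos0 oppr0 mul0r mul1r /GRing.scale /= mulr0 !add0r (mulrC y).
have := is_deriveM (is_derive_gauss 1 0) d2.
by rewrite /GRing.scale /= !(mul0r,mulr0, expr0n, mulr1, expR0, add0r,addr0, mul1r)/=.
Qed.

(** By Stein's identity the integral solves y' = - s y in the frequency [s], so its product [g] with
    [expR (s ^+ 2 / 2)] is constant. *)
Lemma normal_cos (t b : R) :
  \int[N]_x cos (t * x + b) = cos b * expR (- t ^+ 2 / 2).
Proof.
pose y s := \int[N]_x cos (s * x + b).
have dy (s : R) : is_derive s 1 y (- (s * y s)).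
  rewrite -normal_sin_moment.
  rewrite [X in is_derive _ _ _ X](_ : _ = \int[N]_x (- sin (s * x + b) * x)); last first.
    rewrite -mulN1r -RintegralZl//.
    by apply: eq_Rintegral => x _; rewrite mulN1r mulNr.
  apply: (@is_derive_under_integral R _ (measurableTypeR R) N (fun s x => cos (s * x + b))
    (fun s x => - sin (s * x + b) * x) (fun x => expR `|x|) s (s - 1) (s + 1)).
  - by rewrite in_itv/= ltrBlDr ltrDl ltr01.
  - by move=> u _; apply: trig_affine_integrable; left.
  - by move=> u x _; exact: is_derive_cos_affine.
  - apply: (@exp_growth_integrable _ 1) => //.
      by apply: measurableT_comp => //; exact: measurable_normr.
    by move=> x; rewrite mul1r ger0_norm ?expR_ge0// ler_peMl ?expR_ge0// ler1n.
  - move=> u x _; rewrite normrM normrN -[leRHS]mul1r.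
    by rewrite ler_pM// ?ler_normr_expR// ler_norml sin_geN1 sin_le1.
pose g s := y s * expR (1 * s ^+ 2 / 2).
have dg (s : R) : is_derive s 1 g 0.
  have := is_deriveM (dy s) (is_derive_gauss 1 s).
  rewrite /GRing.scale /=; congr is_derive; ring.
have := is_derive_0_is_cst t 0 dg.
rewrite /g mul1r expr0n /= mulr0 mul0r expR0 mulr1 => E.
have -> : \int[N]_x cos (t * x + b) = y t * expR (t ^+ 2 / 2) * expR (- t ^+ 2 / 2).
  by rewrite -mulrA -expRD mulNr subrr expR0 mulr1.
rewrite E; congr (_ * _).
rewrite /y; under eq_Rintegral do rewrite mul0r add0r.
by rewrite Rintegral_cst// [X in _ * fine X]probability_setT mulr1.
Qed.

End gaussian_moments.

(** * Characteristic functions and the Cameron-Martin formula *)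

Section hilbert_borel.
Context (R : realType) (Y : hilbertType R).
Implicit Types (u v x y : Y) (a b : R).

Lemma separable_seq : separable Y ->
  exists s : nat -> Y, forall x e, 0 < e -> exists n, `|x - s n| < e.
Proof.
move=> [A [cA dA]].
have /ppcard_leP[f] := cA.
(* The inverse of the injection [f] of [A] into the integers; indices outside the image give 0. *)
exists (fun n => xget 0 [set a | A a /\ f a = n]) => x e e0.
have [a [xa Aa]] : ball x e `&` A !=set0.
  by apply: dA; [exists x; exact: ballxx|exact: ball_open].
exists (f a).
have [A1 fa] : [set a' | A a' /\ f a' = f a] (xget 0 [set a' | A a' /\ f a' = f a]).
  by apply: xgetPex; exists a.
rewrite (_ : xget _ _ = a); first by move: xa; rewrite -ball_normE.
by apply: (@inj _ _ A f) => //; rewrite inE.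
Qed.

Lemma measurable_borel_continuous (f : Y -> R) : continuous f ->
  measurable_fun setT (f : borel Y -> R).
Proof.
move=> cf; apply: (measurability _ (RGenOpens.measurableE R)).
move=> _ [_ [a [b ->]] <-]; rewrite setTI; apply: sub_sigma_algebra.
by apply: open_comp => //; exact: interval_open.
Qed.

Lemma measurable_inner v : measurable_fun setT (fun y : borel Y => inner (y : Y) v).
Proof. by apply: measurable_borel_continuous; exact: continuous_inner. Qed.

(** The pi-system on which two measures will be compared: it generates the Borel sets of a separable
    space. *)
Definition halfspaces (J : seq (Y * R)) : set Y :=
  [set y | forall p, p \in J -> p.2 < inner y p.1].

Lemma halfspaces_nil : halfspaces [::] = setT.
Proof. by rewrite -subTset => y _ p; rewrite in_nil. Qed.

Lemma halfspaces_cons p J :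
  halfspaces (p :: J) = [set y | p.2 < inner y p.1] `&` halfspaces J.
Proof.
apply/seteqP; split => y /=.
  by move=> H; split; [apply: H|move=> q qJ; apply: H]; rewrite inE ?eqxx// qJ orbT.
by move=> [py H] q; rewrite inE => /predU1P[->//|]; exact: H.
Qed.

Lemma measurable_halfspace v a : measurable ([set y | a < inner y v] : set (borel Y)).
Proof.
have := measurable_inner v measurableT (@measurable_itv R `]a, +oo[).
rewrite setTI; congr (measurable _); apply/seteqP; split => y /=;
by rewrite in_itv/= andbT.
Qed.

Lemma measurable_halfspaces J : measurable (halfspaces J : set (borel Y)).
Proof.
elim: J => [|p J IH].
  by rewrite halfspaces_nil.
rewrite halfspaces_cons; apply: measurableI => //; exact: measurable_halfspace.
Qed.

(** Makes a closed ball a countable intersection of half-spaces. If [|w| > r], a vector [s m] close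
    to [w] itself violates the inequality. *)
Lemma norm_le_inner_dense (s : nat -> Y) w (r : R) : 0 <= r ->
  (forall x e, 0 < e -> exists n, `|x - s n| < e) ->
  `|w| <= r <-> forall m, inner w (s m) <= r * `|s m|.
Proof.
move=> r0 ds; split => [yx m|H].
  rewrite (le_trans (ler_norm _))// (le_trans (Cauchy_Schwarz _ _))//.
  by rewrite ler_wpM2r.
rewrite leNgt; apply/negP => rw.
have w0 : 0 < `|w| by exact: le_lt_trans rw.
(* Chosen so that the error [e * (r + |w|)] is half of the gap [|w| ^+ 2 - r * |w|]. *)
pose e := `|w| * (`|w| - r) / (2 * (r + `|w|)).
have D0 : 0 < r + `|w| by rewrite ltr_wpDl.
have e0 : 0 < e by rewrite divr_gt0 ?mulr_gt0// subr_gt0.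
have [m wm] := ds w e e0.
have : inner w w <= r * (`|w| + e) + `|w| * e.
  have -> : inner w w = inner w (s m) + inner w (w - s m) by rewrite -innerDr subrKC.
  apply: lerD.
    rewrite (le_trans (H m))// ler_wpM2l//.
    rewrite -lerBlDl (le_trans (lerB_dist _ _))// distrC; exact: ltW.
  rewrite (le_trans (ler_norm _))// (le_trans (Cauchy_Schwarz _ _))//.
  by rewrite ler_wpM2l// ltW.
rewrite inner_normE leNgt => /negP; apply.
have -> : r * (`|w| + e) + `|w| * e = r * `|w| + `|w| * (`|w| - r) / 2.
  by rewrite /e; field; rewrite gt_eqF.
rewrite -subr_gt0; have -> : `|w| ^+ 2 - (r * `|w| + `|w| * (`|w| - r) / 2) = `|w| * (`|w| - r) / 2 by field.
by rewrite divr_gt0// mulr_gt0// subr_gt0.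
Qed.

(** An open set is the union of the closed balls [B n k] that it contains, and these are countably
    many. *)
Lemma measurable_borel_halfspaces : separable Y ->
  @measurable _ (borel Y) = <<s range halfspaces >>.
Proof.
move=> /separable_seq[s ds]; apply/seteqP; split; last first.
  apply: smallest_sub; first exact: sigma_algebra_measurable.
  by move=> _ [J _ <-]; exact: measurable_halfspaces.
apply: smallest_sub; first exact: smallest_sigma_algebra.
move=> U oU.
pose T0 := g_sigma_algebraType (range halfspaces).
pose B n k := [set y : Y | `|y - s n| <= k.+1%:R^-1].
have BE n k : B n k = \bigcap_m ~` [set y : Y | k.+1%:R^-1 * `|s m| + inner (s n) (s m) < inner y (s m)].
  apply/seteqP; split => y; rewrite /B /= (norm_le_inner_dense _ _ ds) ?invr_ge0//.
    by move=> H m _; apply/negP; rewrite -leNgt -lerBlDr -innerBl.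
  by move=> H m; have /negP := H m Logic.I; rewrite -leNgt -lerBlDr -innerBl.
have mB n k : @measurable _ T0 (B n k).
  rewrite BE; apply: bigcapT_measurable => m; apply: measurableC.
  apply: sub_sigma_algebra.
  exists [:: (s m, k.+1%:R^-1 * `|s m| + inner (s n) (s m))] => //.
  by rewrite halfspaces_cons halfspaces_nil setIT.
have -> : U = \bigcup_n \bigcup_k (if `[< B n k `<=` U >] then B n k else set0).
  apply/seteqP; split => [y Uy|y [n _ [k _]]]; last by case: ifPn => // /asboolP; apply.
  have /nbhs_ballP[e /= e0 eU] := open_nbhs_nbhs (conj oU Uy).
  have [k ke] : exists k, k.+1%:R^-1 < e / 2.
    exists (Num.truncn (e / 2)^-1); rewrite invf_plt ?posrE ?divr_gt0//.
    by rewrite truncnS_gt.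
  have [n yn] := ds y k.+1%:R^-1 (ltac:(by rewrite invr_gt0)).
  exists n => //; exists k => //; rewrite ifT; last first.
    apply/asboolP => z; rewrite /B /= => zn; apply: eU; rewrite -ball_normE/=.
    rewrite (le_lt_trans (ler_distD (s n) _ _))// [ltRHS]splitr.
    by rewrite ltrD// ?(lt_trans yn)// distrC (le_lt_trans zn).
  by rewrite /B /= ltW.
apply: (@bigcupT_measurable _ T0) => n; apply: bigcupT_measurable => k.
by case: ifP.
Qed.

Lemma halfspaces_cat J K : halfspaces (J ++ K) = halfspaces J `&` halfspaces K.
Proof.
by elim: J => [|p J IH]; [rewrite halfspaces_nil setTI|rewrite cat_cons !halfspaces_cons IH setIA].
Qed.

(** Pettis' theorem: in a separable space weak measurability suffices. Every map into [Y] below is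
    handled through its inner products. *)
Lemma measurable_weakP d (T : measurableType d) (f : T -> borel Y) : separable Y ->
  (forall v, measurable_fun setT (fun t => inner (f t : Y) v)) -> measurable_fun setT f.
Proof.
move=> sY mf; apply: (measurability _ (measurable_borel_halfspaces sY)).
move=> _ [_ [J _ <-] <-]; rewrite setTI; elim: J => [|[v a] J IH].
  by rewrite halfspaces_nil preimage_setT.
rewrite halfspaces_cons preimage_setI; apply: measurableI => //.
have := mf v measurableT _ (@measurable_itv R `]a, +oo[).
rewrite setTI; congr (measurable _); apply/seteqP; split => y /=;
by rewrite in_itv/= andbT.
Qed.

Lemma eq_measure_halfspaces (m1 m2 : {measure set (borel Y) -> \bar R}) : separable Y ->
  (forall J, m1 (halfspaces J) = m2 (halfspaces J)) -> (m1 setT < +oo)%E ->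
  forall A, measurable A -> m1 A = m2 A.
Proof.
move=> sY H m1oo A mA.
have SI : setI_closed (range halfspaces : set (set (borel Y))).
  by move=> _ _ [J _ <-] [K _ <-]; exists (J ++ K) => //; rewrite halfspaces_cat.
apply: (@measure_unique _ R (borel Y) _ (fun=> setT) (measurable_borel_halfspaces sY) SI) => //.
- by move=> _; exists [::] => //; rewrite halfspaces_nil.
- by rewrite bigcup_const//; exists 0%N.
- by move=> _ [J _ <-].
Qed.

End hilbert_borel.

Section bounded_limits.
Context (R : realType) d (T : measurableType d).
Implicit Types P Q : probability T R.

Lemma bounded_EFin_integrable P (f : T -> R) (C : R) : measurable_fun setT f ->
  (forall x, `|f x| <= C) -> P.-integrable setT (EFin \o f).
Proof.
move=> mf fC; apply: (le_EFin_integrable mf fC).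
apply/integrableP; split; first exact/measurable_EFinP.
by rewrite /= integral_cst//= probability_setT mule1 ltry.
Qed.

Lemma cvg_bounded_Rintegral P (f_ : nat -> T -> R) (f : T -> R) (C : R) :
  (forall n, measurable_fun setT (f_ n)) -> (forall n x, `|f_ n x| <= C) ->
  (forall x, f_ ^~ x @ \oo --> f x) ->
  \int[P]_x f_ n x @[n --> \oo] --> \int[P]_x f x.
Proof.
move=> mf fC cf.
have mf' : measurable_fun setT f by apply: measurable_fun_cvg => //.
have fC' x : `|f x| <= C.
  have /cvg_norm cn := cf x.
  rewrite -(cvg_lim _ cn)//; apply: limr_le; first by apply/cvg_ex; exists `|f x|.
  by apply: nearW => n.
have If n := bounded_EFin_integrable P (mf n) (fC n).
have If' := bounded_EFin_integrable P mf' fC'.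
have [|||_ _ H] := @dominated_convergence _ _ _ P setT measurableT
  (fun n => EFin \o f_ n) (EFin \o f) (cst C%:E)
  (fun n => (measurable_EFinP _ _).2 (mf n)) ((measurable_EFinP _ _).2 mf').
- by apply: aeW => x _; apply: cvg_EFin; [exact: nearW|exact: cf].
- exact: (@bounded_EFin_integrable P (cst C) `|C|).
- by apply: aeW => x n _; rewrite lee_fin.
- by apply: fine_cvg; rewrite fineK// integrable_fin_num.
Qed.

End bounded_limits.

(** * A threshold as a limit of polynomials *)

Section power_threshold.
Context (R : realType).
Implicit Types u r : R.

Lemma Bernoulli_ineq (x : R) n : -1 <= x -> 1 + n%:R * x <= (1 + x) ^+ n.
Proof.
move=> x1; elim: n => [|n IH]; first by rewrite mul0r addr0 expr0.
rewrite exprS; apply: (@le_trans _ _ ((1 + x) * (1 + n%:R * x))).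
  rewrite -natr1; have : 0 <= n%:R * x ^+ 2 by rewrite mulr_ge0// sqr_ge0.
  lra.
by rewrite ler_wpM2l// -lerBlDl sub0r.
Qed.

Lemma cvg_natr_expr r : 0 <= r < 1 -> n%:R * r ^+ n @[n --> \oo] --> (0 : R).
Proof.
move=> /andP[]; rewrite le_eqVlt => /predU1P[<- _|r0 r1].
  apply/cvgrPdist_le => e e0; near=> n; rewrite expr0n gt_eqF; last by near: n; exists 1%N.
  by rewrite mulr0 subr0 normr0 ltW.
(* Bernoulli's inequality for the square root of [1 / r] shows that [r ^- n] grows at least like
   [(n * h) ^+ 2], which beats the factor [n]. *)
pose h := (Num.sqrt r)^-1 - 1.
have sr : 0 < Num.sqrt r by rewrite sqrtr_gt0.
have h0 : 0 < h by rewrite subr_gt0 invf_gt1// -[ltRHS]sqrtr1 ltr_sqrt.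
apply/cvgrPdist_le => e e0; near=> n; rewrite sub0r normrN ger0_norm; last first.
  by rewrite mulr_ge0// exprn_ge0// ltW.
have n0 : 0 < n%:R :> R by rewrite ltr0n; near: n; exists 1%N.
have H : (n%:R * h) ^+ 2 <= (r ^+ n)^-1.
  have -> : (r ^+ n)^-1 = ((1 + h) ^+ n) ^+ 2.
    rewrite /h subrKC -exprM mulnC exprM exprVn -exprVn.
    by rewrite exprVn sqr_sqrtr ?exprVn// ltW.
  clearbody h; have h1 : 0 <= 1 + h by lra.
  apply: lerXn2r; rewrite ?nnegrE ?mulr_ge0 ?exprn_ge0 ?(ltW h0)//.
  apply: le_trans (Bernoulli_ineq _ _); last by lra.
  by rewrite lerDr.
have : r ^+ n <= ((n%:R * h) ^+ 2)^-1.
  by rewrite -[leLHS]invrK lef_pV2 ?posrE ?invr_gt0 ?exprn_gt0// mulr_gt0.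
move=> /(ler_wpM2l (ltW n0)) /le_trans; apply.
rewrite exprMn invfM mulrA expr2 invfM mulrA divff ?gt_eqF// mul1r.
rewrite -invfM invf_ple ?posrE ?mulr_gt0 ?exprn_gt0//.
rewrite -ler_pdivrMr ?exprn_gt0//.
near: n; exact: nbhs_infty_ger.
Unshelve. all: by end_near. Qed.

(* The exponent [n * 2 ^ n] makes the limit at the threshold [u = 1 / 2] equal to 0. *)
Lemma cvg_threshold u : 0 <= u <= 1 ->
  (1 - u ^+ n) ^+ (n * 2 ^ n) @[n --> \oo] --> ((u < 1 / 2)%R%:R : R).
Proof.
move=> /andP[u0 u1].
have un0 n : 0 <= 1 - u ^+ n by rewrite subr_ge0 exprn_ile1.
have [u2|u2] := ltP.
  apply: (@squeeze_cvgr _ _ _ _ (fun n => 1 - n%:R * (2 * u) ^+ n) (cst 1)).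
  - near=> n; apply/andP; split; last by rewrite exprn_ile1// gerBl exprn_ge0.
    rewrite (le_trans _ (Bernoulli_ineq _ _)) ?lerN2 ?exprn_ile1//.
    by rewrite natrM natrX exprMn mulrN mulrA.
  - rewrite -[X in _ --> X]subr0; apply: cvgB; first exact: cvg_cst.
    by apply: cvg_natr_expr; apply/andP; split; [rewrite mulr_ge0|lra].
  - exact: cvg_cst.
apply: (@squeeze_cvgr _ _ _ _ (cst 0) (fun n => n.+1%:R^-1)).
- near=> n; apply/andP; split; first exact: exprn_ge0.
  have h : 2^-1 ^+ n <= u ^+ n by apply: lerXn2r; rewrite ?nnegrE//; lra.
  set x : R := 2^-1 ^+ n.
  have x0 : 0 < x by rewrite exprn_gt0.
  have x1 : x <= 1 by rewrite exprn_ile1//; lra.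
  apply: (@le_trans _ _ ((1 - x) ^+ (n * 2 ^ n))).
    by apply: lerXn2r; rewrite ?nnegrE; [exact: un0|rewrite subr_ge0|exact: lerB].
  (* Since [1 - x <= 1 / (1 + x)], Bernoulli's inequality applies to the denominator; the exponent
     is [n / x], so it is at least [1 + n]. *)
  apply: (@le_trans _ _ ((1 + x) ^- (n * 2 ^ n))).
    have x0' := ltW x0.
    rewrite -exprVn; apply: lerXn2r; rewrite ?nnegrE ?subr_ge0// ?invr_ge0 ?addr_ge0//.
    rewrite -[leRHS]mul1r ler_pdivlMr ?addr_gt0//.
    have := sqr_ge0 x; lra.
  rewrite lef_pV2 ?posrE ?exprn_gt0 ?addr_gt0//.
  rewrite (le_trans _ (Bernoulli_ineq _ _))//; last lra.
  rewrite natrM natrX /x exprVn -mulrA divff ?mulr1 ?gt_eqF ?exprn_gt0//.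
  by rewrite -natr1 addrC.
- exact: cvg_cst.
- apply/cvgrPdist_le => e e0; near=> n; rewrite sub0r normrN ger0_norm//.
  rewrite invf_ple ?posrE// -natr1 ler_wpDr//; near: n; exact: nbhs_infty_ger.
Unshelve. all: by end_near. Qed.

End power_threshold.

(** * Cosines of the marginals determine a Borel probability *)

Section trigonometric_polynomials.
Context (R : realType) (Y : hilbertType R).
Implicit Types (u v : Y) (f g : Y -> R).

(** Only linear operations are built in, so that equality of integrals follows by induction;
    products come from the product-to-sum formula. *)
Inductive trigpoly : (Y -> R) -> Prop :=
| TrigCos v b : trigpoly (fun y => cos (inner y v + b))
| TrigAdd f g : trigpoly f -> trigpoly g -> trigpoly (fun y => f y + g y)
| TrigScale c f : trigpoly f -> trigpoly (fun y => c * f y).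

Lemma trigpoly_ext f g : trigpoly f -> f =1 g -> trigpoly g.
Proof. by move=> tf /funext <-. Qed.

Lemma trigpoly_mul f g : trigpoly f -> trigpoly g -> trigpoly (fun y => f y * g y).
Proof.
move=> tf tg; elim: tf => {f} [v b|f1 f2 _ H1 _ H2|c f _ H].
- elim: tg => {g} [w c|g1 g2 _ H1 _ H2|c g _ H].
  + apply: (@trigpoly_ext (fun y => 2^-1 * (cos (inner y (v + w) + (b + c)) + cos (inner y (v - w) + (b - c))))).
      by apply: TrigScale; apply: TrigAdd; exact: TrigCos.
    move=> y; rewrite !innerDr innerNr.
    have -> : inner y v + inner y w + (b + c) = (inner y v + b) + (inner y w + c) by ring.
    have -> : inner y v - inner y w + (b - c) = (inner y v + b) - (inner y w + c) by ring.
    rewrite (cosD (inner y v + b) (inner y w + c)) (cosD (inner y v + b) (- _)).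
    by rewrite cosN sinN; field.
  + by apply: trigpoly_ext (TrigAdd H1 H2) _ => y; rewrite mulrDr.
  + by apply: trigpoly_ext (TrigScale c H) _ => y; rewrite mulrCA.
- by apply: trigpoly_ext (TrigAdd H1 H2) _ => y; rewrite mulrDl.
- by apply: trigpoly_ext (TrigScale c H) _ => y; rewrite mulrA.
Qed.

Lemma trigpoly_cst c : trigpoly (fun=> c).
Proof.
apply: trigpoly_ext (TrigScale c (TrigCos 0 0)) _ => y.
by rewrite inner0r addr0 cos0 mulr1.
Qed.

Lemma trigpoly_pow f n : trigpoly f -> trigpoly (fun y => f y ^+ n).
Proof.
move=> tf; elim: n => [|n IH]; first exact: trigpoly_cst.
by apply: trigpoly_ext (trigpoly_mul tf IH) _ => y; rewrite exprS.
Qed.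

Lemma trigpoly_sin v b : trigpoly (fun y => sin (inner y v + b)).
Proof.
apply: trigpoly_ext (TrigCos v (b - pi / 2)) _ => y.
by rewrite addrA cosD cosN sinN cos_pihalf sin_pihalf mulr0 add0r mulrN mulr1 opprK.
Qed.

Lemma measurable_trigpoly f : trigpoly f -> measurable_fun setT (f : borel Y -> R).
Proof.
elim=> {f} [v b|f g _ mf _ mg|c f _ mf].
- apply: measurableT_comp; first by apply: continuous_measurable_fun; exact: continuous_cos.
  by apply: measurable_funD => //; exact: measurable_inner.
- exact: measurable_funD.
- exact: measurable_funM.
Qed.

Lemma bounded_trigpoly f : trigpoly f -> exists C, forall y, `|f y| <= C.
Proof.
elim=> {f} [v b|f g _ [C fC] _ [D gD]|c f _ [C fC]].
- by exists 1 => y; rewrite ler_norml cos_geN1 cos_le1.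
- by exists (C + D) => y; rewrite (le_trans (ler_normD _ _))// lerD.
- by exists (`|c| * C) => y; rewrite normrM ler_wpM2l.
Qed.

Variables (P Q : probability (borel Y) R).
Hypothesis PQcos : forall v b,
  \int[P]_y cos (inner (y : Y) v + b) = \int[Q]_y cos (inner (y : Y) v + b).

Lemma eq_Rintegral_trigpoly f : trigpoly f -> \int[P]_y f y = \int[Q]_y f y.
Proof.
have I (S : probability (borel Y) R) g : trigpoly g -> S.-integrable setT (EFin \o g).
  move=> tg; have [C gC] := bounded_trigpoly tg.
  exact: bounded_EFin_integrable (measurable_trigpoly tg) gC.
elim=> {f} [v b|f g tf ef tg eg|c f tf ef]; first exact: PQcos.
- by rewrite !RintegralD ?ef ?eg//; exact: I.
- by rewrite !RintegralZl ?ef//; exact: I.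
Qed.

Let eq_limit (f_ : nat -> Y -> R) (f : Y -> R) (C : R) :
  (forall n, measurable_fun setT (f_ n : borel Y -> R)) ->
  (forall n x, `|f_ n x| <= C) ->
  (forall x, f_ ^~ x @ \oo --> f x) ->
  (forall n, \int[P]_x f_ n x = \int[Q]_x f_ n x) ->
  \int[P]_x f x = \int[Q]_x f x.
Proof.
move=> mf fC cf PQ.
have cP := cvg_bounded_Rintegral (P := P) mf fC cf.
have cQ := cvg_bounded_Rintegral (P := Q) mf fC cf.
by rewrite -(cvg_lim _ cP)// -(cvg_lim _ cQ)//; congr (limn _); apply/funext.
Qed.

(* [sin ((a - <y, v>) / (k + 1))] is negative for large [k] iff [a < <y, v>]. *)
Let wave v a k (y : Y) : R := (1 + sin (k.+1%:R^-1 * (a - inner y v))) / 2.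

Let wave01 v a k y : 0 <= wave v a k y <= 1.
Proof.
rewrite /wave; have := sin_geN1 (k.+1%:R^-1 * (a - inner y v)).
by have := sin_le1 (k.+1%:R^-1 * (a - inner y v)); lra.
Qed.

Let trigpoly_wave v a k : trigpoly (wave v a k).
Proof.
apply: (@trigpoly_ext (fun y => 2^-1 + 2^-1 * sin (inner y (- k.+1%:R^-1 *: v) + k.+1%:R^-1 * a))).
  by apply: TrigAdd; [exact: trigpoly_cst|apply: TrigScale; exact: trigpoly_sin].
move=> y; rewrite /wave innerZr mulrDl mul1r [in RHS]mulrC.
by congr (_ + _ * sin _); rewrite mulrBr mulNr addrC.
Qed.

Let cvg_wave v a y :
  ((wave v a k y < 1 / 2)%R%:R : R) @[k --> \oo] --> ((a < inner y v)%R%:R : R).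
Proof.
apply: cvg_near_cst; near=> k; congr (_%:R); congr nat_of_bool.
(* For such [k] the argument of the sine lies in []-2, 2[], where the sine has the sign of its
   argument. *)
have k2 : `|a - inner y v| < k.+1%:R * 2.
  rewrite -natr1; apply: (@lt_le_trans _ _ (`|a - inner y v| + 1)); first by rewrite ltrDl.
  have : `|a - inner y v| <= k%:R by near: k; exact: nbhs_infty_ger.
  have : 0 <= k%:R :> R by []; lra.
have k0 : 0 < k.+1%:R^-1 :> R by rewrite invr_gt0.
have E : (wave v a k y < 1 / 2) = (sin (k.+1%:R^-1 * (a - inner y v)) < 0).
  rewrite /wave; apply/idP/idP; lra.
rewrite E; have [ay|ay|->] := ltrgtP a (inner y v).
- rewrite -oppr_gt0 -sinN sin2_gt0//; apply/andP; split.
    by rewrite -mulrN mulr_gt0// opprB subr_gt0.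
  rewrite -mulrN mulrC ltr_pdivrMr// mulrC; apply: le_lt_trans k2.
  by rewrite -normrN ler_norm.
- apply/negbTE; rewrite -leNgt ltW// sin2_gt0//; apply/andP; split.
    by rewrite mulr_gt0// subr_gt0.
  rewrite mulrC ltr_pdivrMr// mulrC; apply: le_lt_trans k2; exact: ler_norm.
- by rewrite subrr mulr0 sin0 ltxx.
Unshelve. all: by end_near. Qed.

(** Half-spaces are peeled off one at a time: the indicator of one is the limit, in [n] and then in
    [k], of the trigonometric polynomials [q k n]. The factor [f] is general because the induction
    hypothesis is applied to [f * q k n]. *)
Let eq_Rintegral_halfspaces J f : trigpoly f ->
  \int[P]_y (f y * \1_(halfspaces J) y) = \int[Q]_y (f y * \1_(halfspaces J) y).
Proof.
elim: J f => [|[v a] J IH] f tf.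
  under eq_Rintegral do rewrite halfspaces_nil indicT mulr1.
  under [RHS]eq_Rintegral do rewrite halfspaces_nil indicT mulr1.
  exact: eq_Rintegral_trigpoly.
have [C fC] := bounded_trigpoly tf.
have mJ : measurable_fun setT (\1_(halfspaces J) : borel Y -> R).
  by apply: measurable_indic; exact: measurable_halfspaces.
have indic1 (A : set Y) y : `|\1_A y : R| <= 1 by rewrite indicE; case: (_ \in _); rewrite ?normr1 ?normr0.
have bnd (q : Y -> R) y : 0 <= q y <= 1 -> `|f y * q y * \1_(halfspaces J) y| <= C.
  move=> /andP[q0 q1]; rewrite -[leRHS]mulr1 -[leRHS]mulr1 !normrM.
  by rewrite !ler_pM ?mulr_ge0 ?normr_ge0// ger0_norm.
pose q k n y := (1 - wave v a k y ^+ n) ^+ (n * 2 ^ n).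
have q01 k n y : 0 <= q k n y <= 1.
  have /andP[w0 w1] := wave01 v a k y.
  have w1n : wave v a k y ^+ n <= 1 by rewrite exprn_ile1.
  rewrite /q exprn_ge0 ?exprn_ile1 ?subr_ge0//.
  by rewrite gerBl exprn_ge0.
have tq k n : trigpoly (fun y => f y * q k n y).
  apply: trigpoly_mul => //; apply: trigpoly_pow.
  apply: trigpoly_ext (TrigAdd (trigpoly_cst 1)
    (TrigScale (-1) (trigpoly_pow n (trigpoly_wave v a k)))) _ => y.
  by rewrite mulN1r.
have mtJ g : trigpoly g -> measurable_fun setT ((fun y => g y * \1_(halfspaces J) y) : borel Y -> R).
  by move=> tg; apply: measurable_funM => //; exact: measurable_trigpoly.
pose h k y : R := f y * (wave v a k y < 1 / 2)%R%:R * \1_(halfspaces J) y.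
have qh k y : f y * q k n y * \1_(halfspaces J) y @[n --> \oo] --> h k y.
  apply: cvgM; last exact: cvg_cst.
  by apply: cvgM; [exact: cvg_cst|exact: cvg_threshold].
have mh k : measurable_fun setT (h k : borel Y -> R).
  apply: (@measurable_fun_cvg _ (borel Y) R setT (fun n y => f y * q k n y * \1_(halfspaces J) y) (h k)).
    by move=> n; exact: mtJ.
  by move=> y _; exact: qh.
have eqh k : \int[P]_y h k y = \int[Q]_y h k y.
  apply: (eq_limit (f_ := fun n y => f y * q k n y * \1_(halfspaces J) y) (C := C)).
  - by move=> n; exact: mtJ.
  - by move=> n y; apply: bnd.
  - exact: qh.
  - by move=> n; apply: IH.
apply: (eq_limit (f_ := h) (C := C)) => //.
- by move=> k y; apply: (bnd (fun y => (wave v a k y < 1 / 2)%R%:R)); case: (_ < _); rewrite ?lexx ler01.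
- move=> y; rewrite halfspaces_cons indicI /= mulrA.
  apply: cvgM; last exact: cvg_cst.
  apply: cvgM; first exact: cvg_cst.
  rewrite indicE (_ : (y \in _) = (a < inner y v)); first exact: cvg_wave.
  by apply/idP/idP => [|ay]; rewrite inE.
Qed.

(** The free phase [b] lets real cosines stand for both the real and the imaginary part of the
    characteristic function. *)
Lemma char_fun_unique : separable Y -> forall A, measurable A -> P A = Q A.
Proof.
have P1 : (P setT < +oo)%E by rewrite probability_setT ltry.
move=> sY; apply: eq_measure_halfspaces => //.
move=> J; have := eq_Rintegral_halfspaces J (trigpoly_cst 1).
have E (S : probability (borel Y) R) :
    \int[S]_y (1 * \1_(halfspaces J) y) = fine (S (halfspaces J)).
  rewrite /Rintegral; congr fine.
  under eq_integral do rewrite mul1r.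
  by rewrite integral_indic ?setIT//; exact: measurable_halfspaces.
rewrite !E => H; rewrite -[LHS]fineK ?fin_num_measure//; last exact: measurable_halfspaces.
by rewrite H fineK// fin_num_measure//; exact: measurable_halfspaces.
Qed.

End trigonometric_polynomials.

(** * One-dimensional marginals of a Gaussian measure *)

Section gaussian_marginals.
Context (R : realType) (Y : hilbertType R).
Variables (gam : probability (borel Y) R) (Ups : Y -> Y).
Hypothesis gaussian_gam : is_gaussian gam.
Hypothesis mean_gam : mean_zero gam.
Hypothesis cov_gam : is_covariance gam Ups.
Notation N := (normal_prob (0 : R) 1).
Implicit Types (u v e : Y).

(** [Ups] is given as a mere map: its symmetry and linearity are read off the integral that it
    represents. *)
Lemma covariance_sym u v : inner (Ups u) v = inner (Ups v) u.
Proof.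
apply: EFin_inj; rewrite -!cov_gam.
by apply: eq_integral => x _; rewrite mulrC.
Qed.

Lemma covarianceDl u v x : inner (Ups (u + v)) x = inner (Ups u) x + inner (Ups v) x.
Proof. by rewrite covariance_sym innerDr !(covariance_sym x). Qed.

Lemma covarianceZ (t : R) u : Ups (t *: u) = t *: Ups u.
Proof.
apply/eqP; rewrite -subr_eq0 -normr_eq0 -sqrf_eq0 -inner_normE.
by rewrite innerBl innerZl covariance_sym innerZr (covariance_sym _ u) subrr.
Qed.

(** Writing the marginal as the image of [N] under [m + s * z] covers the Dirac case [s = 0] as
    well. *)
Let gaussian_ge0 v m s : 0 <= s ->
  (forall A, measurable A -> gam [set x | A (inner (x : Y) v)] = gaussian1 m s A) ->
  forall f : R -> \bar R, measurable_fun setT f -> (forall x, (0 <= f x)%E) ->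
  (\int[gam]_y f (inner (y : Y) v) = \int[N]_z f (m + s * z)%R)%E.
Proof.
move=> s0 law f mf f0.
have mv : measurable_fun setT ((fun y : borel Y => inner (y : Y) v) : _ -> measurableTypeR R).
  exact: measurable_inner.
pose L : {measure set (measurableTypeR R) -> \bar R} :=
  measure_function_pushforward__canonical__measure_function_Measure gam mv.
have <- : (\int[L]_x f x = \int[gam]_y f (inner (y : Y) v))%E.
  by rewrite /L (ge0_integral_pushforward mv).
have [s00|sneq0] := eqVneq s 0.
  transitivity (\int[\d_(m : measurableTypeR R)]_x f x)%E.
    apply: eq_measure_integral => A mA _.
    by have := law A mA; rewrite /gaussian1 s00 eqxx.
  rewrite integral_dirac// diracT mul1e.
  transitivity (\int[N]_z (cst (f m) z))%E.
    by rewrite integral_cst//= [X in (_ * X)%E]probability_setT mule1.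
  by apply: eq_integral => z _; rewrite s00 mul0r addr0.
rewrite -ge0_integral_normal_affine// ?lt_neqAle ?(eq_sym 0) ?sneq0//.
apply: eq_measure_integral => A mA _.
by have := law A mA; rewrite /gaussian1 (negbTE sneq0).
Qed.

Let gaussian_integral v m s : 0 <= s ->
  (forall A, measurable A -> gam [set x | A (inner (x : Y) v)] = gaussian1 m s A) ->
  forall f : R -> \bar R, measurable_fun setT f ->
  (\int[gam]_y f (inner (y : Y) v) = \int[N]_z f (m + s * z)%R)%E.
Proof.
move=> s0 law f mf; rewrite integralE [RHS]integralE.
congr (_ - _)%E.
  transitivity (\int[N]_z f^\+ (m + s * z)%R)%E; last by apply: eq_integral => x _; rewrite !funeposE.
  rewrite -(gaussian_ge0 s0 law (measurable_funepos mf) (fun x => funepos_ge0 _ _)).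
  by apply: eq_integral => x _; rewrite !funeposE.
transitivity (\int[N]_z f^\- (m + s * z)%R)%E; last by apply: eq_integral => x _; rewrite !funenegE.
rewrite -(gaussian_ge0 s0 law (measurable_funeneg mf) (fun x => funeneg_ge0 _ _)).
by apply: eq_integral => x _; rewrite !funenegE.
Qed.

(** [is_gaussian] only asserts that some [m] and [s] exist; integrating the coordinate and its
    square identifies [m = 0] and [s ^+ 2 = <Ups v, v>]. *)
Lemma gaussian_cos v b :
  \int[gam]_y cos (inner (y : Y) v + b) = cos b * expR (- inner (Ups v) v / 2).
Proof.
have [m [s [s0 law]]] := gaussian_gam v.
have Iid : N.-integrable setT (EFin \o (fun z : R => z)).
  apply: (@exp_growth_integrable R _ 1) => // x.
  rewrite mul1r (le_trans (_ : _ <= expR `|x|))// ?ler_peMl ?expR_ge0 ?ler1n//.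
  by apply: le_trans (expR_ge1Dx _); rewrite lerDr.
have I1 : N.-integrable setT (EFin \o (fun=> m)).
  exact: (@bounded_EFin_integrable _ _ _ N (cst m) `|m|).
have Isq : N.-integrable setT (EFin \o (fun z : R => z * z)).
  apply: (@exp_growth_integrable R _ 2) => // [|x]; first exact: measurable_funM.
  rewrite normrM (_ : expR _ = expR `|x| * expR `|x|); last by rewrite -expRD mulr_natl mulr2n.
  have xe : `|x| <= expR `|x| by apply: le_trans (expR_ge1Dx _); rewrite lerDr.
  apply: (@le_trans _ _ (expR `|x| * expR `|x|)); first by rewrite ler_pM.
  by rewrite ler_peMl ?mulr_ge0 ?expR_ge0// ler1n.
have m0 : m = 0.
  have /(congr1 fine) : (\int[N]_z (m + s * z)%:E = 0)%E.
    by rewrite -(gaussian_integral s0 law (f := EFin)) ?mean_gam//; exact/measurable_EFinP.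
  rewrite -/(Rintegral _ _ _) RintegralD//; last exact: EFin_integrableZl.
  rewrite RintegralZl// normal_mean mulr0 addr0 Rintegral_cst//.
  by rewrite [X in _ * fine X]probability_setT mulr1.
have ss : s ^+ 2 = inner (Ups v) v.
  have /(congr1 fine) := cov_gam v v.
  rewrite (gaussian_integral s0 law (f := fun x => (x * x)%:E)); last first.
    by apply/measurable_EFinP; exact: measurable_funM.
  have E z : ((m + s * z) * (m + s * z))%:E = (s ^+ 2 * (z * z))%:E by rewrite m0; congr EFin; ring.
  under eq_integral do rewrite E.
  by rewrite -/(Rintegral _ _ _) RintegralZl// normal_variance mulr1.
have mc : measurable_fun setT (fun x : R => (cos (x + b))%:E).
  apply/measurable_EFinP; apply: (measurableT_comp (f := cos)).
    by apply: continuous_measurable_fun; exact: continuous_cos.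
  exact: measurable_funD.
rewrite -ss -normal_cos /Rintegral; congr fine.
rewrite (gaussian_integral s0 law mc).
by apply: eq_integral => z _; rewrite m0 add0r.
Qed.

End gaussian_marginals.

(** * The Cameron-Martin formula along one direction *)

Section cameron_martin.
Context (R : realType) (Y : hilbertType R).
Variables (gam : probability (borel Y) R) (Ups : Y -> Y).
Hypothesis sepY : separable Y.
Hypothesis gaussian_gam : is_gaussian gam.
Hypothesis mean_gam : mean_zero gam.
Hypothesis cov_gam : is_covariance gam Ups.
Variable (e : Y).
Let w := Ups e.
Let s2 := inner w e.
Hypothesis s2_gt0 : 0 < s2.
Let s := Num.sqrt s2.
Notation N := (normal_prob (0 : R) 1).

Let s_gt0 : 0 < s. Proof. by rewrite sqrtr_gt0. Qed.
Let ssE : s * s = s2. Proof. by rewrite -expr2 sqr_sqrtr// ltW. Qed.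

(* The law of [gam] is rebuilt from its projection along [w], whose [e]-component
   is erased, and from an independent standard normal variable. *)
Let Phi (yz : borel Y * measurableTypeR R) : borel Y :=
  ((yz.1 : Y) + (yz.2 / s - inner (yz.1 : Y) e / s2) *: w : Y).

Let inner_Phi y z v : inner (Phi (y, z) : Y) v =
  inner (y : Y) (v - (inner w v / s2) *: e) + inner w v / s * z.
Proof. by rewrite /Phi innerDl innerZl innerBr innerZr /=; ring. Qed.

Let mPhi : measurable_fun setT Phi.
Proof.
apply: measurable_weakP => // v.
rewrite (_ : (fun t => _) = (fun t : borel Y * measurableTypeR R =>
  inner (t.1 : Y) (v - (inner w v / s2) *: e) + inner w v / s * t.2)); last first.
  by apply/funext => -[y z]; exact: inner_Phi.
apply: measurable_funD.
  by apply: (measurableT_comp (measurable_inner _)) => //; exact: measurable_fst.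
by apply: measurable_funM => //; exact: measurable_snd.
Qed.

Let PP := (gam \x N)%E.
Let XPhi : {mfun (borel Y * measurableTypeR R)%type >-> borel Y} :=
  HB.pack_for {mfun (borel Y * measurableTypeR R)%type >-> borel Y} (Phi : (borel Y * measurableTypeR R)%type -> borel Y)
   (isMeasurableFun.Build _ _ _ _ Phi mPhi).

Lemma measurable_cos_inner v b : measurable_fun setT (fun y : borel Y => cos (inner (y : Y) v + b)).
Proof. exact: measurable_trigpoly (TrigCos v b). Qed.

(** Both laws have the same cosines, because the variances add up:
    [<Ups v, v> = <Ups v', v'> + beta ^+ 2], where [v'] is [v] with its correlation with [e]
    removed. *)
Let law_Phi : forall A, measurable A -> gam A = distribution PP XPhi A.
Proof.
apply: char_fun_unique => // v b.
rewrite (gaussian_cos gaussian_gam mean_gam cov_gam).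
have mc : measurable_fun setT (fun y : borel Y => (cos (inner (y : Y) v + b))%:E).
  by apply/measurable_EFinP; exact: measurable_cos_inner.
set v' := v - (inner w v / s2) *: e; pose beta := inner w v / s.
have mcP : measurable_fun setT (fun p : borel Y * measurableTypeR R => cos (inner (XPhi p : Y) v + b)).
  exact: (measurableT_comp (measurable_cos_inner v b) mPhi).
have cos1 (x : R) : `|cos x| <= 1 by rewrite ler_norml cos_geN1 cos_le1.
have Icos : PP.-integrable setT (EFin \o (fun p => cos (inner (XPhi p : Y) v + b))).
  exact: (@bounded_EFin_integrable _ _ _ PP _ 1).
rewrite /Rintegral integral_distribution//=.
rewrite -(integral12_prod_meas1 Icos) /fubini_F.
have E y : (\int[N]_z (cos (inner (Phi (y, z) : Y) v + b))%:E =
    (expR (- beta ^+ 2 / 2) * cos (inner (y : Y) v' + b))%:E)%E.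
  rewrite mulrC -normal_cos /Rintegral fineK.
    apply: eq_integral => z _; rewrite inner_Phi -/v' -/beta.
    by congr (cos _)%:E; ring.
  apply: integrable_fin_num => //.
  apply: (@bounded_EFin_integrable _ _ _ N _ 1) => //.
  apply: measurableT_comp; first by apply: continuous_measurable_fun; exact: continuous_cos.
  by apply: measurable_funD => //; apply: measurable_funM.
under eq_integral do rewrite /= E.
rewrite -/(Rintegral _ _ _) RintegralZl//; last first.
  by apply: (@bounded_EFin_integrable _ _ _ gam _ 1) => //; exact: measurable_cos_inner.
rewrite (gaussian_cos gaussian_gam mean_gam cov_gam) mulrCA -expRD.
congr (_ * expR _).
have S2 : s2 != 0 by rewrite gt_eqF.
have -> : beta ^+ 2 = (inner w v) ^+ 2 / s2.
  by rewrite /beta expr_div_n expr2 (expr2 s) ssE -expr2.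
have -> : inner (Ups v') v' = inner (Ups v) v - (inner w v) ^+ 2 / s2.
  rewrite (covariance_sym cov_gam).
  have -> : inner (Ups v') v' = inner (Ups v) v' - (inner w v / s2) * inner w v'.
    rewrite /v' -scaleNr (covarianceDl cov_gam) (covarianceZ cov_gam) innerZl -/w.
    by rewrite mulNr.
  rewrite /v' !innerBr !innerZr -/s2 (covariance_sym cov_gam v e) -/w.
  by field.
by field.
Qed.

(** Through [Phi], a translation by [t *: w] adds [t * s] to the normal coordinate [z], so for each
    [y] the formula on the line applies. *)
Lemma cameron_martin (t : R) (f : borel Y -> \bar R) :
  measurable_fun setT f -> (forall y, (0 <= f y)%E) ->
  (\int[gam]_y f ((y : Y) + t *: w)%R =
   \int[gam]_y (f y * (expR (t * inner (y : Y) e - t ^+ 2 * s2 / 2))%:E))%E.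
Proof.
move=> mf f0.
have S2 : s2 != 0 by rewrite gt_eqF.
have S1 : s != 0 by rewrite gt_eqF.
have mL : measurable_fun setT (fun y : borel Y => (expR (t * inner (y : Y) e - t ^+ 2 * s2 / 2))%:E).
  apply/measurable_EFinP; apply: measurableT_comp => //.
  by apply: measurable_funB => //; apply: measurable_funM => //; exact: measurable_inner.
have mfL : measurable_fun setT (fun y : borel Y => (f y * (expR (t * inner (y : Y) e - t ^+ 2 * s2 / 2))%:E)%E).
  exact: emeasurable_funM.
have msh : measurable_fun setT (fun y : borel Y => ((y : Y) + t *: w : borel Y)).
  apply: measurable_weakP => // v; under eq_fun do rewrite innerDl.
  by apply: measurable_funD => //; exact: measurable_inner.
have mfs : measurable_fun setT (fun y : borel Y => f ((y : Y) + t *: w)%R).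
  exact: measurableT_comp mf msh.
have tr (g : borel Y -> \bar R) : measurable_fun setT g -> (forall y, (0 <= g y)%E) ->
    (\int[gam]_y g y = \int[gam]_y \int[N]_z g (Phi (y, z)))%E.
  move=> mg g0; transitivity (\int[distribution PP XPhi]_y g y)%E.
    by apply: eq_measure_integral => A mA _; exact: law_Phi.
  rewrite ge0_integral_distribution//.
  rewrite fubini_tonelli1//; first exact: (measurableT_comp mg mPhi).
  by move=> x; exact: g0.
apply: (etrans (tr _ mfs (fun y => f0 _))); apply: esym.
have fL0 y : (0 <= f y * (expR (t * inner (y : Y) e - t ^+ 2 * s2 / 2))%:E)%E.
  by rewrite mule_ge0// lee_fin expR_ge0.
apply: (etrans (tr _ mfL fL0)); apply: esym.
apply: eq_integral => y _.
have mPy : measurable_fun setT (fun z : R => f (Phi (y, z))).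
  have mp : measurable_fun setT (fun z : measurableTypeR R => (y, z)) by exact: measurable_pair1.
  exact: (measurableT_comp mf (measurableT_comp mPhi mp)).
have E1 z : (Phi (y, z) : Y) + t *: w = Phi (y, z + t * s)%R.
  rewrite /Phi /= -addrA -scalerDl; congr (_ + _ *: _).
  by rewrite mulrDl mulfK//; ring.
have E2 z : t * inner (Phi (y, z) : Y) e - t ^+ 2 * s2 / 2 = (t * s) * z - (t * s) ^+ 2 / 2.
  rewrite inner_Phi -/s2 innerBr innerZr divff// mul1r subrr add0r -ssE exprMn.
  by rewrite mulfK// -expr2; ring.
under eq_integral do rewrite E1.
apply: (etrans (ge0_integral_normal_shift (t * s) mPy (fun=> f0 _))).
by apply: eq_integral => z _; rewrite E2.
Qed.

End cameron_martin.

(** * Testing and Assouad's lemma *)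

Section iid_shift.
Context (R : realType) (Y : hilbertType R).
Variables (gam : probability (borel Y) R) (Ups : Y -> Y).
Hypothesis sepY : separable Y.
Hypothesis gaussian_gam : is_gaussian gam.
Hypothesis mean_gam : mean_zero gam.
Hypothesis cov_gam : is_covariance gam Ups.
Variable (e : Y).
Let w := Ups e.
Let s2 := inner w e.
Hypothesis s2_gt0 : 0 < s2.
Implicit Types (theta : nat -> R).

(** [theta] is indexed by [nat], not by positions in the tuple, so that an induction on [n] can pass
    to [theta \o S]. *)
Definition shift_tuple n theta (u : Y) (es : n.-tuple (borel Y)) : n.-tuple (borel Y) :=
  [tuple ((tnth es i : Y) + theta i *: u : borel Y) | i < n].

Definition likelihood n theta (es : n.-tuple (borel Y)) : R :=
  expR (\sum_(i < n) (theta i * inner (tnth es i : Y) e - theta i ^+ 2 * s2 / 2)).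

Lemma measurable_shift_tuple n theta u : measurable_fun setT (@shift_tuple n theta u).
Proof.
apply/measurable_fun_tnthP => i; apply: measurable_weakP => // v.
rewrite (_ : (fun t => _) = (fun t : n.-tuple (borel Y) => inner (tnth t i : Y) v + theta i * inner u v)).
  apply: measurable_funD => //.
  by apply: (measurableT_comp (measurable_inner v)); exact: measurable_tnth.
by apply/funext => t; rewrite /= tnth_mktuple innerDl innerZl.
Qed.

Lemma measurable_likelihood n theta : measurable_fun setT (@likelihood n theta).
Proof.
apply: measurableT_comp => //; apply: measurable_sum => i.
apply: measurable_funB => //; apply: measurable_funM => //.
by apply: (measurableT_comp (measurable_inner e)); exact: measurable_tnth.
Qed.

Lemma integral_iid_lawS n (f : n.+1.-tuple (borel Y) -> \bar R) :
  measurable_fun setT f -> (forall x, (0 <= f x)%E) ->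
  (\int[iid_law gam n.+1]_t f t =
   \int[gam]_y \int[iid_law gam n]_t f (cons_pair (y, t)))%E.
Proof.
move=> mf f0.
transitivity (\int[(gam \x iid_law gam n)%E]_z f (cons_pair z))%E.
  have H := @ge0_integral_pushforward _ _ _ _ R (@cons_pair _ (borel Y) n)
    (@measurable_cons_pair _ _ n) (gam \x iid_law gam n)%E setT f measurableT mf (in1W f0).
  by rewrite preimage_setT in H; exact: H.
rewrite fubini_tonelli1//.
by apply: measurableT_comp => //; exact: measurable_cons_pair.
Qed.

Lemma shift_tuple_cons n theta u y (t : n.-tuple (borel Y)) :
  shift_tuple theta u (cons_pair (y, t)) =
  cons_pair ((y : Y) + theta 0%N *: u : borel Y, shift_tuple (theta \o S) u t).
Proof.
apply: eq_from_tnth => i; rewrite tnth_mktuple.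
case: (unliftP ord0 i) => [j|] ->; last by rewrite !tnth0.
by rewrite !tnthS tnth_mktuple.
Qed.

Lemma likelihood_cons n theta y (t : n.-tuple (borel Y)) :
  likelihood theta (cons_pair (y, t)) =
  expR (theta 0%N * inner (y : Y) e - theta 0%N ^+ 2 * s2 / 2) *
  likelihood (theta \o S) t.
Proof.
rewrite /likelihood big_ord_recl expRD tnth0; congr (_ * expR _).
by apply: eq_bigr => i _; rewrite tnthS.
Qed.

(** The induction hypothesis translates the tail, and the Cameron-Martin formula the first entry,
    applied to the integral [g] over the tail. *)
Lemma iid_shift n theta (f : n.-tuple (borel Y) -> \bar R) :
  measurable_fun setT f -> (forall x, (0 <= f x)%E) ->
  (\int[iid_law gam n]_t f (shift_tuple theta w t) =
   \int[iid_law gam n]_t (f t * (likelihood theta t)%:E))%E.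
Proof.
elim: n theta f => [|n IH] theta f mf f0.
  rewrite /iid_law !integral_dirac//=; last 2 first.
  - by apply: emeasurable_funM => //; apply/measurable_EFinP; exact: measurable_likelihood.
  - by apply: measurableT_comp => //; exact: measurable_shift_tuple.
  by rewrite /likelihood big_ord0 expR0 mule1 (tuple0 (shift_tuple _ _ _)).
have mL : measurable_fun setT (fun t => (f t * (likelihood theta t)%:E)%E).
  by apply: emeasurable_funM => //; apply/measurable_EFinP; exact: measurable_likelihood.
have mS : measurable_fun setT (fun t => f (shift_tuple theta w t)).
  by apply: measurableT_comp => //; exact: measurable_shift_tuple.
have L0 m th (t : m.-tuple (borel Y)) : (0 <= (likelihood th t)%:E)%E.
  by rewrite lee_fin expR_ge0.
have fL0 t : (0 <= f t * (likelihood theta t)%:E)%E by rewrite mule_ge0.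
apply: (etrans (integral_iid_lawS mS (fun=> f0 _))); apply: esym.
apply: (etrans (integral_iid_lawS mL fL0)); apply: esym.
have mfc y : measurable_fun setT (fun t => f (@cons_pair _ (borel Y) n (y, t))).
  apply: measurableT_comp => //; apply: (measurableT_comp (@measurable_cons_pair _ _ n)).
  exact: measurable_pair1.
have mg2 : measurable_fun setT (fun z : borel Y * n.-tuple (borel Y) =>
    (f (cons_pair z) * (likelihood (theta \o S) z.2)%:E)%E).
  apply: emeasurable_funM; first by apply: measurableT_comp => //; exact: measurable_cons_pair.
  apply/measurable_EFinP; apply: (measurableT_comp (measurable_likelihood _)).
  exact: measurable_snd.
pose g y := (\int[iid_law gam n]_t (f (cons_pair (y, t)) * (likelihood (theta \o S) t)%:E))%E.
have g0 y : (0 <= g y)%E by apply: integral_ge0 => t _; rewrite mule_ge0.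
have mg : measurable_fun setT (g : borel Y -> \bar R).
  apply: (measurable_fun_fubini_tonelli_F (m2 := iid_law gam n) _ mg2).
  by move=> x; rewrite mule_ge0.
transitivity (\int[gam]_y g ((y : Y) + theta 0%N *: w)%R)%E.
  apply: eq_integral => y _.
  under eq_integral do rewrite shift_tuple_cons.
  exact: IH.
apply: (etrans (cameron_martin sepY gaussian_gam mean_gam cov_gam s2_gt0 _ mg g0)).
apply: eq_integral => y _; rewrite muleC -ge0_integralZl ?lee_fin ?expR_ge0//; last 2 first.
- exact: (measurableT_comp mg2 (measurable_pair1 y)).
- by move=> t _; rewrite mule_ge0.
by apply: eq_integral => t _; rewrite likelihood_cons EFinM muleCA.
Qed.

Lemma integral_likelihood n theta :
  (\int[iid_law gam n]_t (likelihood theta t)%:E = 1)%E.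
Proof.
have := iid_shift theta (measurable_cst (1%E : \bar R)) (fun _ : n.-tuple (borel Y) => lee01).
rewrite /= integral_cst//= probability_setT mule1 => H; rewrite [RHS]H.
by apply: eq_integral => t _; rewrite mul1e.
Qed.

(* The affinity bound [min 1 L >= L - L ^ 2 / 4] with [E L = 1] and
   [E L ^ 2 = expR (s2 * \sum_i theta i ^ 2)]. *)
Lemma two_point n theta (A : set (n.-tuple (borel Y))) : measurable A ->
  (1 <= iid_law gam n A + iid_law gam n (shift_tuple theta w @^-1` (~` A))
        + (expR (s2 * \sum_(i < n) theta i ^+ 2) / 4)%:E)%E.
Proof.
move=> mA; set Q := iid_law gam n.
have mL := measurable_likelihood theta (n := n).
have mL' : measurable_fun setT (EFin \o @likelihood n theta) by exact/measurable_EFinP.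
have mA' : measurable (~` A) by exact: measurableC.
have m1 (B : set (n.-tuple (borel Y))) : measurable B -> measurable_fun setT (fun t => (\1_B t : R)%:E).
  by move=> mB; apply/measurable_EFinP; exact: measurable_indic.
have m1A : measurable_fun setT (fun t => ((\1_(~` A) t : R)%:E * (likelihood theta t)%:E)%E).
  by apply: emeasurable_funM => //; exact: m1.
have -> : Q (shift_tuple theta w @^-1` (~` A)) =
    (\int[Q]_t ((\1_(~` A) t : R)%:E * (likelihood theta t)%:E))%E.
  rewrite -iid_shift//; last exact: m1.
  rewrite -[X in Q X]setIT -integral_indic//; last first.
    by rewrite -[X in measurable X]setTI; exact: measurable_shift_tuple.
have -> : Q A = (\int[Q]_t (\1_A t : R)%:E)%E by rewrite integral_indic// setIT.
have -> : (expR (s2 * \sum_(i < n) theta i ^+ 2) / 4)%:E =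
    (\int[Q]_t (likelihood theta t ^+ 2 / 4)%:E)%E.
  (* The square of a likelihood is a constant times the likelihood of the doubled shifts, which
     integrates to 1. *)
  have E (t : n.-tuple (borel Y)) : (likelihood theta t ^+ 2 / 4)%:E =
      ((expR (s2 * \sum_(i < n) theta i ^+ 2) / 4)%:E * (likelihood (fun i => theta i *+ 2) t)%:E)%E.
    rewrite -EFinM [in RHS]mulrAC; congr (_ / 4)%:E.
    rewrite /likelihood expr2 -!expRD; congr expR.
    rewrite -big_split /= mulr_sumr -big_split /=.
    by apply: eq_bigr => i _; rewrite mulr2n; field.
  under eq_integral do rewrite E.
  rewrite ge0_integralZl ?integral_likelihood ?mule1//.
    by apply/measurable_EFinP; exact: measurable_likelihood.
  by move=> t _; rewrite lee_fin expR_ge0.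
have m1A' := m1 A mA.
have g1 t : [set: n.-tuple (borel Y)] t -> (0 <= (\1_(~` A) t : R)%:E * (likelihood theta t)%:E)%E.
  by move=> _; rewrite mule_ge0// lee_fin expR_ge0.
have g2 t : [set: n.-tuple (borel Y)] t ->
    (0 <= (\1_A t : R)%:E + (\1_(~` A) t : R)%:E * (likelihood theta t)%:E)%E.
  by move=> ?; rewrite adde_ge0// g1.
have mL2 : measurable_fun setT (fun t => (@likelihood n theta t ^+ 2 / 4)%:E).
  by apply/measurable_EFinP; apply: measurable_funM => //; exact: measurable_funX.
have mD : measurable_fun setT (fun t => ((\1_A t : R)%:E + (\1_(~` A) t : R)%:E * (likelihood theta t)%:E)%E).
  exact: emeasurable_funD.
have g3 t : [set: n.-tuple (borel Y)] t -> (0 <= (@likelihood n theta t ^+ 2 / 4)%:E)%E.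
  by move=> _; rewrite lee_fin divr_ge0// sqr_ge0.
rewrite -(integral_likelihood n theta) -/Q -ge0_integralD// -ge0_integralD//.
apply: ge0_le_integral => //.
- by move=> t _; rewrite lee_fin expR_ge0.
- exact: emeasurable_funD.
- move=> t _; rewrite -!EFinM -!EFinD lee_fin !indicE in_setC.
  set l := likelihood theta t.
  have l0 : 0 <= l by exact: expR_ge0.
  (* This square says that [l <= 1 + l ^+ 2 / 4], the case of a point of [A]. *)
  have := sqr_ge0 (l / 2 - 1).
  by case: (t \in A) => /=; nra.
Qed.

End iid_shift.

Section Lp_norm.
Context (R : realType) (X Y : hilbertType R).
Variables (mu : probability (borel X) R) (p : R).
Hypothesis p1 : 1 <= p.
Hypothesis sepY : separable Y.

Let p0 : 0 < p. Proof. exact: lt_le_trans p1. Qed.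

Lemma le_Lnorm (f g : borel X -> R) : measurable_fun setT f -> measurable_fun setT g ->
  (forall x, 0 <= f x <= g x) ->
  (Lnorm mu p%:E (EFin \o f) <= Lnorm mu p%:E (EFin \o g))%E.
Proof.
move=> mf mg fg; rewrite unlock.
have pw (h : borel X -> R) : measurable_fun setT h ->
    measurable_fun setT (fun x => (`|(h x)%:E| `^ p)%E).
  move=> mh; apply/measurable_EFinP.
  apply: (measurableT_comp (measurable_powR p)).
  by apply: measurableT_comp => //; exact: measurable_normr.
have g0 x : 0 <= g x by have /andP[f0 /(le_trans f0)] := fg x.
have p0' := ltW p0; apply: gt0_ler_poweR; first by rewrite invr_ge0.
- by rewrite in_itv/= leey andbT; apply: integral_ge0 => x _; rewrite lee_fin powR_ge0.
- by rewrite in_itv/= leey andbT; apply: integral_ge0 => x _; rewrite lee_fin powR_ge0.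
apply: ge0_le_integral => //.
- by move=> x _; exact: poweR_ge0.
- exact: pw.
- exact: pw.
- move=> x _; have /andP[f0 fg'] := fg x.
  rewrite /= lee_fin (ger0_norm f0) (ger0_norm (g0 x)).
  by apply: ge0_ler_powR; rewrite ?nnegrE// ltW.
Qed.

Lemma measurable_normr_sub (G H : X -> Y) :
  measurable_fun setT (G : borel X -> borel Y) -> measurable_fun setT (H : borel X -> borel Y) ->
  measurable_fun setT ((fun x => `|G x - H x|) : borel X -> R).
Proof.
move=> mG mH; apply: (measurableT_comp (f := fun y : borel Y => `|y : Y|)).
  by apply: measurable_borel_continuous; exact: norm_continuous.
apply: measurable_weakP => // v; under eq_fun do rewrite innerBl.
by apply: measurable_funB; apply: (measurableT_comp (measurable_inner v)).
Qed.

Lemma Lpnorm_triangle (G1 G2 H : X -> Y) :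
  measurable_fun setT (G1 : borel X -> borel Y) ->
  measurable_fun setT (G2 : borel X -> borel Y) ->
  measurable_fun setT (H : borel X -> borel Y) ->
  (Lpnorm mu p (fun x => (G1 x - G2 x)%R) <=
   Lpnorm mu p (fun x => (G1 x - H x)%R) + Lpnorm mu p (fun x => (G2 x - H x)%R))%E.
Proof.
move=> m1 m2 mH.
have n1 := measurable_normr_sub m1 mH.
have n2 := measurable_normr_sub m2 mH.
have n12 := measurable_normr_sub m1 m2.
have nD : measurable_fun setT ((fun x => `|G1 x - H x| + `|G2 x - H x|) : borel X -> R).
  exact: measurable_funD.
apply: le_trans (minkowski_EFin mu n1 n2 p1).
apply: (le_Lnorm n12 nD) => x; rewrite normr_ge0 /= (le_trans (ler_distD (H x) _ _))//.
by rewrite (distrC (H x)).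
Qed.

Lemma bounded_Lp (G : X -> Y) (C : R) :
  measurable_fun setT (G : borel X -> borel Y) -> (forall x, `|G x| <= C) -> Lp mu p G.
Proof.
move=> mG GC; split => //.
have mn : measurable_fun setT ((fun x => `|G x|) : borel X -> R).
  apply: (measurableT_comp (f := fun y : borel Y => `|y : Y|)) => //.
  by apply: measurable_borel_continuous; exact: norm_continuous.
apply: (@le_lt_trans _ _ (Lnorm mu p%:E (EFin \o cst C))).
  by apply: le_Lnorm => // x; rewrite normr_ge0 GC.
rewrite unlock; apply: poweR_lty.
rewrite (_ : (\int[mu]_x _)%E = (\int[mu]_x cst (`|C| `^ p)%:E x)%E)//.
by rewrite integral_cst// [X in (_ * X)%E]probability_setT mule1 ltry.
Qed.

End Lp_norm.

(** * The minimum distance decoder *)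

Section finite_selection.
Context d (T : measurableType d) (I J : finType).

(** A finite union, over the patterns of truth values, of finite intersections. *)
Lemma measurable_finite_bool (b : I -> T -> bool) (g : {ffun I -> bool} -> J) (j : J) :
  (forall i, measurable_fun setT (b i)) -> measurable [set t | g [ffun i => b i t] = j].
Proof.
move=> mb.
have -> : [set t | g [ffun i => b i t] = j] =
    \bigcup_(f in [set f | g f = j]) \bigcap_(i in [set: I]) (b i @^-1` [set f i]).
  apply/seteqP; split => [t /= gj|t [f /= gj H]].
    by exists [ffun i => b i t] => //= i _ /=; rewrite ffunE.
  by rewrite -gj; congr g; apply/ffunP => i; rewrite ffunE; exact: H.
apply: fin_bigcup_measurable; first exact: finite_finset.
move=> f _; apply: fin_bigcap_measurable; first exact: finite_finset.
by move=> i _; rewrite -[X in measurable X]setTI; exact: mb.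
Qed.

End finite_selection.

Section selector.
Context (R : realType) d (T : measurableType d) (I : finType) (i0 : I).
Variable D : I -> T -> \bar R.
Hypothesis mD : forall i, measurable_fun setT (D i).

(* The minimum distance decoder, [D i t] being the distance from the estimate to vertex [i]. *)
Definition selector (t : T) : I :=
  odflt i0 [pick i | [forall j, (D i t <= D j t)%E]].

Lemma selector_min t i : (D (selector t) t <= D i t)%E.
Proof.
rewrite /selector; case: pickP => [j /forallP//|none].
pose m := [arg min_(j < i0) D j t]%O.
have : [forall j, (D m t <= D j t)%E].
  apply/forallP => j; rewrite /m; case: Order.TotalTheory.arg_minP => // k _; exact.
by rewrite none.
Qed.

Lemma measurable_selector i : measurable [set t | selector t = i].
Proof.
pose b (ij : I * I) t := (D ij.1 t <= D ij.2 t)%E.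
have := @measurable_finite_bool _ T _ I b
  (fun f => odflt i0 [pick i | [forall j, f (i, j)]]) i.
rewrite (_ : [set t | _] = [set t | selector t = i]); first by apply => -[j k]; exact: measurable_fun_lee.
apply/seteqP; split => t /= <-; rewrite /selector; congr odflt; apply: eq_pick => j /=;
by apply: eq_forallb => k; rewrite ffunE.
Qed.

End selector.

(** * The hypercube argument *)

Section assouad.
Context (R : realType) (X Y : hilbertType R).
Variables (mu : probability (borel X) R) (p : R).
Variables (gam : probability (borel Y) R) (Ups : Y -> Y) (e : Y).
Variables (sigma : R) (m : nat) (Z : finType).
Variables (psi : Z -> X -> R) (Q : Z -> set X) (h W : R).
Hypothesis p1 : 1 <= p.
Hypothesis sepY : separable Y.
Hypothesis gaussian_gam : is_gaussian gam.
Hypothesis mean_gam : mean_zero gam.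
Hypothesis cov_gam : is_covariance gam Ups.
Let w := Ups e.
Let s2 := inner w e.
Hypothesis s2_gt0 : 0 < s2.
Hypothesis w1 : `|w| = 1.
Hypothesis sigma_gt0 : 0 < sigma.
Hypothesis Z_gt0 : (0 < #|Z|)%N.
Hypothesis mpsi : forall z, measurable_fun setT (psi z : borel X -> R).
Hypothesis psi1 : forall z x, `|psi z x| <= 1.
Hypothesis psi_sqr : forall x, \sum_z psi z x ^+ 2 <= 1.
Hypothesis mQ : forall z, measurable (Q z : set (borel X)).
Hypothesis psiQ : forall z z' x, Q z x -> psi z' x = (z' == z)%:R.
Hypothesis muQ : forall z, ((W / #|Z|%:R)%:E <= mu (Q z))%E.
Hypothesis h_gt0 : 0 < h.
Hypothesis W_ge0 : 0 <= W.
(** This calibration keeps the average of [kappa] over the cells below [1 / 4]. *)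
Hypothesis h_small : 16 * s2 * m%:R * h ^+ 2 <= sigma ^+ 2 * #|Z|%:R.

Local Notation signs := {ffun Z -> bool}.
Local Notation N := (#|Z|%:R : R).
Implicit Types (tau : signs) (z : Z).

Definition hypercube_coef tau (x : X) : R := \sum_z h * (-1) ^+ tau z * psi z x.
Definition hypercube_fun tau (x : X) : Y := hypercube_coef tau x *: w.
Local Notation F := hypercube_fun.

Let N_gt0 : 0 < N. Proof. by rewrite ltr0n. Qed.

Lemma measurable_hypercube_coef tau : measurable_fun setT (hypercube_coef tau : borel X -> R).
Proof. by apply: measurable_sum => z; apply: measurable_funM => //; exact: measurable_funM. Qed.

Lemma measurable_hypercube_fun tau : measurable_fun setT (F tau : borel X -> borel Y).
Proof.
apply: measurable_weakP => // v; under eq_fun do rewrite innerZl.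
by apply: measurable_funM => //; exact: measurable_hypercube_coef.
Qed.

Lemma hypercube_fun_Lp tau : Lp mu p (F tau).
Proof.
apply: (@bounded_Lp _ _ _ _ _ p1 _ (\sum_(z : Z) h)); first exact: measurable_hypercube_fun.
move=> x; rewrite normrZ w1 mulr1 (le_trans (ler_norm_sum _ _ _))//.
apply: ler_sum => z _; rewrite !normrM normr_sign mulr1 gtr0_norm//.
by rewrite ler_piMr// ltW.
Qed.

(** On each cell [Q z] where the signs differ the two functions are exactly [2 * h] apart, and these
    cells are disjoint by [psiQ]. *)
Lemma hypercube_separation tau tau' :
  ((2 * h * W `^ p^-1 * (#|[pred z | tau z != tau' z]|%:R / N))%:E <=
   Lpnorm mu p (fun x => (F tau x - F tau' x)%R))%E.
Proof.
have p0 : 0 < p by exact: lt_le_trans p1.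
set D := [pred z | tau z != tau' z]; set k : R := #|D|%:R.
have kN : k / N <= 1 by rewrite ler_pdivrMr// mul1r ler_nat max_card.
have k0 : 0 <= k / N by rewrite divr_ge0// ltW.
rewrite /Lpnorm Lnorm.unlock.
pose dF (x : borel X) : R := `|F tau x - F tau' x|.
have mF : measurable_fun setT dF := measurable_normr_sub sepY (measurable_hypercube_fun tau) (measurable_hypercube_fun tau').
have mFp : measurable_fun setT (fun x : borel X => (`|(dF x)%:E| `^ p)%E).
  apply/measurable_EFinP; apply: (measurableT_comp (measurable_powR p)).
  by apply: measurableT_comp => //; exact: measurable_normr.
have low : ((((2 * h) `^ p * (W * (k / N))))%:E <=
    \int[mu]_x (`|(dF x)%:E| `^ p))%E.
  apply: (@le_trans _ _ (\int[mu]_x (\sum_(z in D) ((2 * h) `^ p)%:E * (\1_(Q z) x : R)%:E)))%E; last first.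
    apply: ge0_le_integral => //.
    - by move=> x _; apply: sume_ge0 => z _; rewrite mule_ge0// lee_fin ?powR_ge0.
    - under eq_fun do rewrite -big_enum/=; apply: emeasurable_sum => z; apply: emeasurable_funM => //.
      by apply/measurable_EFinP; exact: measurable_indic.
    - move=> x _; have [[z zD Qz]|none] := pselect (exists2 z, z \in D & Q z x); last first.
        rewrite big1 ?lee_fin ?powR_ge0// => z zD; rewrite indicE memNset ?mule0// => Qz.
        by apply: none; exists z.
      have Fz t : hypercube_coef t x = h * (-1) ^+ t z.
        rewrite /hypercube_coef (bigD1 z)//= (psiQ z Qz) eqxx mulr1 big1 ?addr0// => z' zz'.
        by rewrite (psiQ z' Qz) (negbTE zz') mulr0.
      rewrite (bigD1 z)//= big1 ?adde0 => [|z' /andP[_ zz']]; last first.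
        rewrite indicE memNset ?mule0// => Qz'.
        have := psiQ z Qz; rewrite eqxx (psiQ z Qz') eq_sym (negbTE zz') => /eqP.
        by rewrite eq_sym oner_eq0.
      rewrite indicE mem_set// mule1 lee_fin normr_id /dF /hypercube_fun -scalerBl normrZ w1 mulr1 !Fz.
      apply: ge0_ler_powR; rewrite ?nnegrE ?mulr_ge0 ?(ltW h_gt0) ?(ltW p0)//.
      have: tau z != tau' z by []; rewrite -mulrBr normrM gtr0_norm// mulrC ler_pM2l//.
      by case: (tau z); case: (tau' z) => // _; rewrite ?expr0 ?expr1 ler_normr; apply/orP; lra.
  under eq_integral do rewrite -big_enum/=.
  rewrite ge0_integral_sum//; last 2 first.
  - move=> z; apply: emeasurable_funM => //.
    by apply/measurable_EFinP; exact: measurable_indic.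
  - by move=> z x _; rewrite mule_ge0// lee_fin ?powR_ge0.
  have -> : ((2 * h) `^ p * (W * (k / N)))%:E = (\sum_(z in D) ((2 * h) `^ p * (W / N))%:E)%E.
    rewrite sumEFin sumr_const -mulr_natl; congr EFin; rewrite /k; ring.
  rewrite [leRHS]big_enum/=; apply: lee_sum => z _.
  rewrite ge0_integralZl//; last 2 first.
  - by apply/measurable_EFinP; exact: measurable_indic.
  - by rewrite lee_fin powR_ge0.
  rewrite integral_indic// setIT EFinM; apply: lee_wpmul2l; last exact: muQ.
  by rewrite lee_fin powR_ge0.
apply: le_trans (gt0_ler_poweR _ _ _ low); last 3 first.
- by rewrite invr_ge0 ltW.
- by rewrite in_itv/= leey andbT lee_fin !mulr_ge0 ?powR_ge0// divr_ge0// ltW.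
- by rewrite in_itv/= leey andbT; apply: integral_ge0 => x _; rewrite lee_fin powR_ge0.
have h2 : 0 <= 2 * h by rewrite mulr_ge0// ltW.
rewrite poweR_EFin lee_fin (powRM _ (powR_ge0 _ _) (mulr_ge0 W_ge0 k0)) (powRM _ W_ge0 k0).
rewrite -powRrM divff ?gt_eqF// powRr1// mulrA ler_wpM2l//.
  by rewrite mulr_ge0 ?powR_ge0.
(* As [k / N <= 1] and [p >= 1], dropping the exponent [p^-1] only lowers the value and makes the
   bound linear in the Hamming distance. *)
move: k0; rewrite le_eqVlt => /predU1P[<-|k0]; first by rewrite powR_ge0.
have := @ger_powR _ (k / N) _ p^-1 1 _.
by rewrite k0 kN (powRr1 (ltW k0)); apply; rewrite ?invf_le1.
Qed.

Local Notation T := (m.-tuple (borel X) * m.-tuple (borel Y))%type.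
Local Notation obs tau := (@observations R X Y sigma m (F tau)).

Lemma measurable_observations tau :
  measurable_fun setT (fun t : T => obs tau t.1 t.2).
Proof.
apply/measurable_fun_tnthP => i; apply: measurable_weakP => // v.
rewrite (_ : (fun t => _) = (fun t : T => hypercube_coef tau (tnth t.1 i) * inner w v
    + sigma * inner (tnth t.2 i : Y) v)); last first.
  by apply/funext => t; rewrite /= tnth_mktuple innerDl !innerZl.
apply: measurable_funD; apply: measurable_funM => //.
  apply: (measurableT_comp (measurable_hypercube_coef tau)).
  by apply: (measurableT_comp (measurable_tnth i)); exact: measurable_fst.
apply: (measurableT_comp (measurable_inner v)).
by apply: (measurableT_comp (measurable_tnth i)); exact: measurable_snd.
Qed.

Definition flip z tau : signs := [ffun z' => if z' == z then ~~ tau z' else tau z'].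

Lemma flipK z : involutive (flip z).
Proof. by move=> tau; apply/ffunP => z'; rewrite !ffunE; case: eqP => //; rewrite negbK. Qed.

Lemma hypercube_flip z tau x :
  F (flip z tau) x = F tau x + (- (2 * h * (-1) ^+ tau z * psi z x)) *: w.
Proof.
rewrite /hypercube_fun -scalerDl; congr (_ *: _); rewrite /hypercube_coef.
rewrite (bigD1 z)//= [in RHS](bigD1 z)//= ffunE eqxx.
rewrite (eq_bigr (fun i => h * (-1) ^+ tau i * psi i x)); last first.
  by move=> i /negbTE iz; rewrite ffunE iz.
by case: (tau z); rewrite /= ?expr0 ?expr1; ring.
Qed.

(** [expR] of it is the second moment of the likelihood ratio between [tau] and [flip z tau];
    squaring removes the dependence on [tau]. *)
Let kappa (xs : m.-tuple (borel X)) z : R :=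
  s2 * \sum_(i < m) (2 * h * psi z (tnth xs i) / sigma) ^+ 2.

Let kappa_ge0 xs z : 0 <= kappa xs z.
Proof. by rewrite mulr_ge0 ?(ltW s2_gt0)// sumr_ge0// => i _; rewrite sqr_ge0. Qed.

(** By [psi_sqr] each design point contributes to the whole sum over [z] no more than to a single
    cell, wherever it lies. *)
Let sum_kappa xs : \sum_z kappa xs z <= N / 4.
Proof.
rewrite /kappa -mulr_sumr exchange_big /=.
apply: (@le_trans _ _ (s2 * (m%:R * (4 * h ^+ 2 / sigma ^+ 2)))).
  have -> : m%:R * (4 * h ^+ 2 / sigma ^+ 2) = \sum_(i < m) (4 * h ^+ 2 / sigma ^+ 2).
    by rewrite sumr_const card_ord -[RHS]mulr_natl.
  rewrite ler_wpM2l ?(ltW s2_gt0)//.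
  apply: ler_sum => i _.
  rewrite (eq_bigr (fun z => 4 * h ^+ 2 / sigma ^+ 2 * psi z (tnth xs i) ^+ 2)); last first.
    by move=> z _; field; rewrite gt_eqF.
  rewrite -mulr_sumr; apply: ler_piMr; last exact: psi_sqr.
  by apply: divr_ge0; [apply: mulr_ge0 => //; exact: sqr_ge0|exact: sqr_ge0].
have : s2 * (m%:R * (4 * h ^+ 2 / sigma ^+ 2)) = (16 * s2 * m%:R * h ^+ 2) / (4 * sigma ^+ 2).
  by field; rewrite gt_eqF.
move=> ->; rewrite ler_pdivrMr ?mulr_gt0 ?exprn_gt0//.
by rewrite (le_trans h_small)// le_eqVlt; apply/orP; left; apply/eqP; field.
Qed.

Section decoder.
Variable sel : T -> signs.
Hypothesis msel : forall tau, measurable [set t | sel t = tau].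

Let err tau z : set T := [set t | sel (t.1, obs tau t.1 t.2) z != tau z].

Let merr tau z : measurable (err tau z).
Proof.
have -> : err tau z = (fun t : T => (t.1, obs tau t.1 t.2)) @^-1`
    (\bigcup_(s in [set s : signs | s z != tau z]) [set t | sel t = s]).
  apply/seteqP; split => t /=; first by move=> H; exists (sel (t.1, obs tau t.1 t.2)).
  by case=> s /= sz ss; rewrite /err /= ss.
rewrite -[X in measurable X]setTI; apply: measurable_fun_pair => //=.
- exact: measurable_observations.
- by apply: fin_bigcup_measurable; [exact: finite_finset|move=> s _; exact: msel].
Qed.

Local Notation IY := (iid_law gam m).

Let prob_err tau z (xs : m.-tuple (borel X)) : R := fine (IY (xsection (err tau z) xs)).

Let prob_errE tau z xs : (prob_err tau z xs)%:E = IY (xsection (err tau z) xs).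
Proof. by rewrite fineK// fin_num_measure//; exact: measurable_xsection. Qed.

(* Flipping the sign at [z] translates the noise along [w], so [two_point] applies. *)
Let prob_err_flip tau z xs :
  2^-1 <= prob_err tau z xs + prob_err (flip z tau) z xs + kappa xs z.
Proof.
pose theta j : R := - (2 * h * (-1) ^+ tau z * psi z (nth (0 : X) xs j)) / sigma.
have obsE es : obs (flip z tau) xs es = obs tau xs (shift_tuple theta w es).
  apply: eq_from_tnth => i; rewrite !tnth_mktuple hypercube_flip -addrA; congr (_ + _).
  rewrite scalerDr addrC; congr (_ + _); rewrite scalerA; congr (_ *: _).
  by rewrite /theta [RHS]mulrC divfK ?gt_eqF// (tnth_nth (0 : X)).
have H := two_point sepY gaussian_gam mean_gam cov_gam s2_gt0 theta (measurable_xsection xs (merr tau z)).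
rewrite -/w -/s2 in H.
(* The decoder gets the same data from translated noise but the true sign is negated, so errors at
   the flipped vertex are successes at [tau]. *)
have pre : shift_tuple theta w @^-1` (~` xsection (err tau z) xs) = xsection (err (flip z tau) z) xs.
  apply/seteqP; split => es /=; rewrite /xsection /= !inE /err /= ?mem_setE /= obsE ffunE eqxx.
    by move=> /negP; rewrite negbK => /eqP ->; case: (tau z).
  by move=> H1; apply/negP; rewrite negbK; move: H1; case: (sel _ z); case: (tau z).
rewrite pre -!prob_errE -!EFinD lee_fin in H.
have ksum : s2 * \sum_(i < m) theta i ^+ 2 = kappa xs z.
  congr (_ * _); apply: eq_bigr => i _; rewrite /theta (tnth_nth (0 : X)) mulNr sqrrN.
  by rewrite !exprMn sqrr_sign mulr1.
rewrite ksum in H.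
have a0 t : 0 <= prob_err t z xs by rewrite fine_ge0.
(* For [kappa >= 1 / 2] the claim is trivial. Below, [expR kappa <= 1 + 2 * kappa] makes the
   two-point bound linear in [kappa], hence summable over the cells. *)
have [k2|k2] := leP 2^-1 (kappa xs z).
  by rewrite (le_trans k2)// lerDr addr_ge0.
have : expR (kappa xs z) <= 1 + 2 * kappa xs z.
  have k1 : 0 < 1 - kappa xs z by lra.
  have e1 : 1 - kappa xs z <= expR (- kappa xs z) by exact: expR_ge1Dx.
  have : expR (kappa xs z) <= (1 - kappa xs z)^-1.
    by rewrite -[leLHS]invrK lef_pV2 ?posrE ?invr_gt0 ?expR_gt0// -expRN.
  move=> /le_trans; apply; rewrite -[leLHS]mul1r ler_pdivrMr//.
  have := kappa_ge0 xs z; nra.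
by have := kappa_ge0 xs z; lra.
Qed.

(** Pairing each vertex with its flip gives, per vertex, half of [N / 2] from the two-point bounds
    minus [N / 4] from [kappa]. *)
Let sum_prob_err xs :
  #|signs|%:R * N / 8 <= \sum_(tz : signs * Z) prob_err tz.1 tz.2 xs.
Proof.
rewrite -(pair_bigA _ (fun t z => prob_err t z xs))/= exchange_big /=.
set S := \sum_z _.
have -> : S = 2^-1 * \sum_z \sum_(t : signs) (prob_err t z xs + prob_err (flip z t) z xs).
  rewrite /S mulr_sumr; apply: eq_bigr => z _; rewrite big_split /=.
  rewrite [X in _ = _ * (_ + X)](_ : _ = \sum_(t : signs) prob_err t z xs); first by field.
  by rewrite [RHS](reindex_inj (inv_inj (flipK z))).
rewrite exchange_big /=.
have : \sum_(t : signs) (N / 4) <=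
    \sum_(t : signs) \sum_z (prob_err t z xs + prob_err (flip z t) z xs).
  apply: ler_sum => t _.
  have : \sum_(z : Z) 2^-1 <= \sum_z (prob_err t z xs + prob_err (flip z t) z xs + kappa xs z).
    by apply: ler_sum => z _; exact: prob_err_flip.
  rewrite sumr_const big_split /= -mulr_natl => H.
  by have := sum_kappa xs; lra.
by rewrite sumr_const -mulr_natl; lra.
Qed.

Variable rho : probability (m.-tuple (borel X)) R.
Local Notation PP := (rho \x IY)%E.

(** The bound on the average over the vertices holds for each design, hence after integration over
    [rho], and some vertex is at least as bad as the average. *)
Lemma hypercube_bad_vertex :
  exists tau, ((N / 8)%:E <=
    \sum_z PP [set t | sel (t.1, obs tau t.1 t.2) z != tau z])%E.
Proof.
apply: contrapT => /forallNP H.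
have PPE tau z : PP (err tau z) = (\int[rho]_xs (prob_err tau z xs)%:E)%E.
  by apply: eq_integral => xs _; rewrite prob_errE.
have mp tau z : measurable_fun setT (fun xs => (prob_err tau z xs)%:E).
  rewrite (_ : (fun _ => _) = IY \o xsection (err tau z)); last first.
    by apply/funext => xs /=; rewrite prob_errE.
  exact: measurable_fun_xsection.
pose q tau z : R := fine (PP (err tau z)).
have qE tau z : (q tau z)%:E = PP (err tau z).
  rewrite fineK// ge0_fin_numE ?measure_ge0// PPE.
  apply: (@le_lt_trans _ _ (\int[rho]_xs cst 1%E xs)%E); last first.
    by rewrite integral_cst// [X in (_ * X)%E]probability_setT mule1 ltry.
  apply: ge0_le_integral => //.
  - by move=> xs _; rewrite lee_fin fine_ge0.
  - move=> xs _; rewrite prob_errE; apply: probability_le1.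
    exact: measurable_xsection (merr tau z).
have : #|signs|%:R * N / 8 <= \sum_(tz : signs * Z) q tz.1 tz.2.
  rewrite -lee_fin -sumEFin; under eq_bigr do rewrite qE PPE.
  rewrite -ge0_integral_sum//; last by move=> tz xs _; rewrite lee_fin fine_ge0.
  apply: (@le_trans _ _ (\int[rho]_xs cst (#|signs|%:R * N / 8)%:E xs)%E).
    by rewrite integral_cst// [X in (_ * X)%E]probability_setT mule1.
  apply: ge0_le_integral => //.
  - by move=> xs _; rewrite lee_fin divr_ge0// mulr_ge0.
  - by apply: emeasurable_sum => tz; exact: mp.
  - by move=> xs _; rewrite sumEFin lee_fin; exact: sum_prob_err.
rewrite -(pair_bigA _ (fun t z => q t z))/= leNgt => /negP; apply.
have qlt t : \sum_z q t z < N / 8.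
  rewrite ltNge; apply/negP => qt; apply: (H t).
  by under eq_bigr do rewrite -qE; rewrite sumEFin lee_fin.
have -> : #|signs|%:R * N / 8 = \sum_(t : signs) (N / 8).
  by rewrite sumr_const -[RHS]mulr_natl mulrA.
pose t0 : signs := [ffun=> true].
rewrite (bigD1 t0)//= [ltRHS](bigD1 t0)//=; apply: ltr_leD => //.
by apply: ler_sum => t _; exact: ltW.
Qed.

End decoder.

Lemma measurable_hypercube_loss (Fhat : T -> X -> Y) tau : estimator mu p Fhat ->
  measurable_fun setT (fun t : T =>
    Lpnorm mu p (fun x => F tau x - Fhat (t.1, obs tau t.1 t.2) x)).
Proof.
move=> [_ mFhat].
apply: (measurableT_comp (mFhat _ (hypercube_fun_Lp tau))).
by apply: measurable_fun_pair; [exact: measurable_fst|exact: measurable_observations].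
Qed.

(** The decoded vertex is no farther from the estimate than [tau], so the loss is at least half of
    the distance between the two vertices, that is, h W^(1/p) / N per misjudged sign; at the bad
    vertex [N / 8] of them are expected. *)
Lemma assouad (rho : probability (m.-tuple (borel X)) R) (Fhat : T -> X -> Y) :
  estimator mu p Fhat ->
  exists tau, ((h * W `^ p^-1 / 8)%:E <=
    \int[rho \x iid_law gam m]_t
      Lpnorm mu p (fun x => (F tau x - Fhat (t.1, obs tau t.1 t.2) x)%R))%E.
Proof.
move=> Fhat_est; have [Fhat_Lp mFhat] := Fhat_est.
pose D tau t := Lpnorm mu p (fun x => F tau x - Fhat t x).
have mD tau : measurable_fun setT (D tau) := mFhat _ (hypercube_fun_Lp tau).
pose sel := selector [ffun=> true] D.
have msel := measurable_selector [ffun=> true] mD.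
have [tau Htau] := hypercube_bad_vertex msel rho; exists tau.
pose code (t : T) : T := (t.1, obs tau t.1 t.2).
have mcode : measurable_fun setT code.
  by apply: measurable_fun_pair; [exact: measurable_fst|exact: measurable_observations].
pose err z : set T := [set t | sel (code t) z != tau z].
have merr z : measurable (err z).
  have -> : err z = code @^-1`
      (\bigcup_(s in [set s : signs | s z != tau z]) [set t | sel t = s]).
    apply/seteqP; split => t /=; first by move=> H; exists (sel (code t)).
    by case=> s /= sz ss; rewrite /err /= ss.
  rewrite -[X in measurable X]setTI; apply: mcode => //.
  by apply: fin_bigcup_measurable; [exact: finite_finset|move=> s _; exact: msel].
have hW : 0 <= h * W `^ p^-1 / N by rewrite divr_ge0 ?mulr_ge0 ?powR_ge0 ?(ltW h_gt0) ?(ltW N_gt0).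
apply: (@le_trans _ _ (\int[rho \x iid_law gam m]_t
    (\sum_z (h * W `^ p^-1 / N)%:E * (\1_(err z) t : R)%:E))%E).
  have mi z : measurable_fun setT (fun t => (\1_(err z) t : R)%:E).
    by apply/measurable_EFinP; exact: measurable_indic.
  rewrite ge0_integral_sum//; last 2 first.
  - by move=> z; exact: emeasurable_funM.
  - by move=> z t _; rewrite mule_ge0// lee_fin.
  rewrite (eq_bigr (fun z => ((h * W `^ p^-1 / N)%:E * (rho \x iid_law gam m) (err z))%E)); last first.
    by move=> z _; rewrite ge0_integralZl// integral_indic// setIT.
  rewrite -ge0_sume_distrr//; apply: le_trans (lee_wpmul2l _ Htau); last by rewrite lee_fin.
  by rewrite -EFinM lee_fin le_eqVlt; apply/orP; left; apply/eqP; field; rewrite gt_eqF.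
apply: ge0_le_integral => //.
- by move=> t _; apply: sume_ge0 => z _; rewrite mule_ge0// lee_fin.
- by apply: emeasurable_sum => z; apply: emeasurable_funM => //; apply/measurable_EFinP; exact: measurable_indic.
- exact: measurable_hypercube_loss.
move=> t _.
have -> : (\sum_z (h * W `^ p^-1 / N)%:E * (\1_(err z) t : R)%:E)%E =
    (h * W `^ p^-1 * (#|[pred z | tau z != sel (code t) z]|%:R / N))%:E.
  rewrite sumEFin -mulr_sumr -!mulrA [in LHS](mulrC N^-1); congr (_ * (_ * (_ * _)))%:E.
  rewrite -sum1_card natr_sum [RHS]big_mkcond /=; apply: eq_bigr => z _.
  rewrite indicE [in RHS]inE/=; have [H|H] := boolP (tau z != sel (code t) z).
    by rewrite mem_set//= /err /= eq_sym.
  by rewrite memNset//= /err /= eq_sym; exact/negP.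
have /le_trans/(_ (Lpnorm_triangle _ p1 sepY _ _ (Fhat_Lp (code t)).1)) := hypercube_separation tau (sel (code t)).
move=> /(_ (measurable_hypercube_fun _) (measurable_hypercube_fun _)) H.
have : ((2 * h * W `^ p^-1 * (#|[pred z | tau z != sel (code t) z]|%:R / N))%:E <= D tau (code t) + D tau (code t))%E.
  by apply: (le_trans H); apply: leeD => //; exact: selector_min.
rewrite -/(D tau (code t)); have : (0 <= D tau (code t))%E by exact: Lnorm_ge0.
case: (D tau (code t)) => [r|_ _|//]; last by rewrite leey.
by rewrite -EFinD !lee_fin => _; lra.
Qed.

Lemma assouad_random (nu : probability (borel X) R) (Fhat : T -> X -> Y) :
  estimator mu p Fhat ->
  exists tau, ((h * W `^ p^-1 / 8)%:E <= random_risk mu p gam sigma nu Fhat (F tau))%E.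
Proof. exact: assouad. Qed.

(** A fixed design is a random one with the Dirac law [\d_xs]. *)
Lemma assouad_fixed (xs : m.-tuple (borel X)) (Fhat : m.-tuple (borel Y) -> X -> Y) :
  estimator mu p Fhat ->
  exists tau, ((h * W `^ p^-1 / 8)%:E <= fixed_risk mu p gam sigma xs Fhat (F tau))%E.
Proof.
move=> [Fhat_Lp mFhat].
have est : estimator mu p (fun t : T => Fhat t.2).
  split=> [t|G LG]; first exact: Fhat_Lp.
  by apply: (measurableT_comp (mFhat G LG)); exact: measurable_snd.
have [tau H] := assouad \d_xs est; exists tau; apply: (le_trans H).
have mf := measurable_hypercube_loss tau est.
have f0 (t : T) : (0 <= Lpnorm mu p (fun x => (F tau x - Fhat (t.1, obs tau t.1 t.2).2 x)%R))%E.
  exact: Lnorm_ge0.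
have E := @fubini_tonelli1 _ _ _ _ R \d_xs (iid_law gam m) _ mf f0.
rewrite E integral_dirac//; first by rewrite diracT mul1e.
exact: measurable_fun_fubini_tonelli_F.
Qed.

End assouad.

(** * Bumps in the Hölder ball *)

Section plateau_function.
Context (R : realType).
Implicit Types (f : R -> R) (x y s t : R) (n i j : nat).

(** A quadratic remainder spares a separate study of the kink at 0 in [x * Num.max x 0]. *)
Lemma is_derive_quadratic f x l (C : R) :
  (forall y, `|f y - f x - l * (y - x)| <= C * (y - x) ^+ 2) -> is_derive x 1 f l.
Proof.
move=> H.
have C0 : 0 <= C.
  have := H (x + 1); rewrite (addrC x) addrK expr1n !mulr1.
  by apply: le_trans; exact: normr_ge0.
have cv : h^-1 *: (f (h *: (1 : R) + x) - f x) @[h --> 0^'] --> l.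
  apply/cvgrPdist_le => eps eps0; near=> h.
  have h0 : h != 0 by near: h; exact: nbhs_dnbhs_neq.
  have hx : h *: (1 : R) + x - x = h by rewrite addrK /GRing.scale/= mulr1.
  have := H (h *: (1 : R) + x); rewrite hx => Hh.
  have -> : l - h^-1 *: (f (h *: (1 : R) + x) - f x) = - (h^-1 * (f (h *: (1 : R) + x) - f x - l * h)).
    by rewrite -[h^-1 *: _]/(h^-1 * _); field.
  rewrite normrN normrM normfV ler_pdivrMl ?normr_gt0// (le_trans Hh)//.
  rewrite -real_normK ?num_real// expr2 mulrCA ler_wpM2l//.
  have hs : `|h| <= eps / (C + 1).
    near: h; apply: dnbhs0_le.
    by rewrite divr_gt0// ltr_wpDl.
  rewrite (le_trans (ler_wpM2l C0 hs))// mulrCA ger_pMr// ler_pdivrMr ?mul1r ?lerDl//.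
  by rewrite ltr_wpDl.
by apply: DeriveDef; [apply/cvg_ex; exists l|exact: cvg_lim].
Unshelve. all: by end_near. Qed.

Lemma is_derive_comp_affine f x (df c b : R) : is_derive (x * c + b) 1 f df ->
  is_derive x 1 (fun x => f (x * c + b)) (c * df).
Proof.
move=> fx; have h := is_derive_affine c b x.
by have := @is_derive1_comp _ f (fun t => t * c + b) x _ _ fx h; rewrite mulrC; congr is_derive.
Qed.

Definition bdiff f x : R := f x - f (x - 1).

Lemma is_derive_bdiff f f' : (forall x, is_derive x 1 f (f' x)) ->
  forall x, is_derive x 1 (bdiff f) (bdiff f' x).
Proof.
move=> df x; apply: is_deriveB.
have := is_derive_comp_affine (df (x * 1 + (- 1))).
by rewrite mulr1 mul1r; congr is_derive; apply/funext => y; rewrite mulr1.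
Qed.

Lemma is_derive_iter_bdiff i f f' : (forall x, is_derive x 1 f (f' x)) ->
  forall x, is_derive x 1 (iter i bdiff f) (iter i bdiff f' x).
Proof. by elim: i f f' => // i IH f f' df; rewrite !iterSr; exact/IH/is_derive_bdiff. Qed.

(** The truncated power [x_+ ^ (n + 1) / (n + 1)!], whose [(n + 1)]-fold backward difference is an
    integrated cardinal B-spline. *)
Definition trunc_pow n x : R := x ^+ n * Num.max x 0 / n.+1`!%:R.

Lemma is_derive_trunc_pow n x : is_derive x 1 (trunc_pow n.+1) (trunc_pow n x).
Proof.
have d2 : is_derive x 1 (fun x => x * Num.max x 0) (2 * Num.max x 0).
  apply: (@is_derive_quadratic _ _ _ 1) => y; rewrite mul1r.
  have [x0|x0] := leP x 0; have [y0|y0] := leP y 0.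
  - by rewrite !mulr0 mul0r !subr0 normr0 sqr_ge0.
  - rewrite ger0_norm; nra.
  - rewrite ger0_norm; nra.
  - by have := sqr_ge0 (y - x) => ?; rewrite ger0_norm; nra.
have -> : trunc_pow n.+1 = (fun x => ((fun x => x ^+ n) * (fun x => x * Num.max x 0)) x / n.+2`!%:R).
  by apply/funext => y; rewrite /trunc_pow exprSr -!mulrA.
have dn : is_derive x 1 (fun x : R => x ^+ n) (n%:R * x ^+ n.-1).
  have := is_deriveX n (is_derive_id x 1); rewrite /GRing.scale/= mulr1; congr is_derive.
  by apply/funext => y; rewrite exprfctE.
have h := is_deriveZ (n.+2`!%:R^-1) (is_deriveM dn d2).
have := h; congr is_derive.
  by apply/funext => y; rewrite /= /GRing.scale/= [LHS]mulrC.
have -> : n.+2`!%:R = n.+2%:R * n.+1`!%:R :> R by rewrite factS natrM.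
have f0 : n.+1`!%:R != 0 :> R by rewrite pnatr_eq0 -lt0n fact_gt0.
rewrite /GRing.scale /= /trunc_pow.
have -> : x * Num.max x 0 * (n%:R * x ^+ n.-1) = n%:R * x ^+ n * Num.max x 0.
  by case: (n) => [|k]; rewrite ?mul0r ?mulr0//= exprS; ring.
rewrite -natr1 -natr1; have n0 : (0 : R) <= n%:R by [].
by field; rewrite f0 /= gt_eqF//; lra.
Qed.

(* A C^n step from 0 to 1: its derivatives are finite differences of lower steps,
   and by the mean value theorem [step n.+1 x] is a value of [step n]. *)
Definition step n : R -> R := iter n.+1 bdiff (trunc_pow n).

Lemma is_derive_step n x : is_derive x 1 (step n.+1) (bdiff (step n) x).
Proof. by apply: is_derive_iter_bdiff => y; exact: is_derive_trunc_pow. Qed.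

Lemma step_mean n x : exists2 c, x - 1 <= c <= x & step n.+1 x = step n c.
Proof.
pose A := iter n.+1 bdiff (trunc_pow n.+1).
have dA y : is_derive y 1 A (step n y).
  by apply: is_derive_iter_bdiff => z; exact: is_derive_trunc_pow.
have cA : {within `[x - 1, x], continuous A}.
  apply: continuous_subspaceT => y.
  by apply/differentiable_continuous/derivable1_diffP; have [] := dA y.
have x1 : x - 1 <= x by lra.
have [c cx Ac] := MVT_segment x1 (fun y _ => dA y) cA.
exists c; first by move: cx; rewrite in_itv.
by rewrite -[LHS]/(A x - A (x - 1)) Ac subKr mulr1.
Qed.

Lemma step0E x : step 0 x = Num.max x 0 - Num.max (x - 1) 0.
Proof. by rewrite /step /= /bdiff /trunc_pow !expr0 !mul1r !divr1. Qed.

Lemma step_le0 n x : x <= 0 -> step n x = 0.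
Proof.
elim: n x => [|n IH] x x0.
  by rewrite step0E !max_r ?subrr//; lra.
have [c /andP[_ cx] ->] := step_mean n x; apply: IH; exact: le_trans x0.
Qed.

Lemma step_ge n x : n.+1%:R <= x -> step n x = 1.
Proof.
elim: n x => [|n IH] x xn.
  by rewrite step0E !max_l; lra.
have [c /andP[cx _] ->] := step_mean n x; apply: IH.
by move: xn; rewrite -natr1; lra.
Qed.

Lemma step_itv n x : 0 <= step n x <= 1.
Proof.
elim: n x => [|n IH] x; last by have [c _ ->] := step_mean n x; exact: IH.
rewrite step0E; have [x0|x0] := leP x 0; have [x1|x1] := leP (x - 1) 0; lra.
Qed.

(** The [i]-th derivative of [step n] for [i <= n]. As an iterated difference of a function with
    values in [[0, 1]] it is bounded by [2 ^+ i]. *)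
Definition dstep n i : R -> R := iter i bdiff (step (n - i)).

Lemma is_derive_dstep n i x : (i < n)%N -> is_derive x 1 (dstep n i) (dstep n i.+1 x).
Proof.
move=> lin; rewrite /dstep iterSr; apply: is_derive_iter_bdiff => y.
by rewrite -(subnSK lin); exact: is_derive_step.
Qed.

Lemma iter_bdiff_bound i f (M : R) : (forall x, `|f x| <= M) ->
  forall x, `|iter i bdiff f x| <= 2 ^+ i * M.
Proof.
elim: i f M => [|i IH] f M fM x; first by rewrite mul1r.
rewrite iterSr exprSr -mulrA; apply: IH => y.
by rewrite (le_trans (ler_normB _ _))// mulrDl !mul1r lerD.
Qed.

Lemma dstep_bound n i x : `|dstep n i x| <= 2 ^+ i.
Proof.
rewrite -[leRHS]mulr1; apply: iter_bdiff_bound => y.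
by have /andP[s0 s1] := step_itv (n - i) y; rewrite ger0_norm.
Qed.

Lemma dstep_le0 n i x : x <= 0 -> dstep n i x = 0.
Proof.
rewrite /dstep; set f := step _; have : forall y, y <= 0 -> f y = 0 by exact: step_le0.
elim: i f x => [|i IH] f x f0 x0; first exact: f0.
by rewrite iterSr; apply: IH => // y y0; rewrite /bdiff !f0 ?subrr//; lra.
Qed.

Lemma dstep_ge n i x : (i <= n)%N -> n.+1%:R <= x -> dstep n i x = (i == 0)%:R.
Proof.
elim: i n x => [|i IH] n x; first by rewrite /dstep subn0 => _; exact: step_ge.
case: n => // n lin xn.
rewrite -[LHS]/(dstep n i x - dstep n i (x - 1)) !IH ?subrr//;
by move: xn; rewrite -natr1; lra.
Qed.

(** For [j <= n], the [j]-th derivative of a bump on [[0, 1]]. As [step n] rises over a length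
    [n + 1], the factor [4 * n.+1] fits the rise into [[0, 1/4]] and the fall into [[3/4, 1]]. *)
Definition plateau n j s : R := (4 * n.+1%:R) ^+ j *
  (dstep n j (s * (4 * n.+1%:R) + 0) - dstep n j (s * (4 * n.+1%:R) + (- (3 * n.+1%:R)))).

Definition plateau_bound n : R := 2 * (8 * n.+1%:R) ^+ n.

Lemma plateau_bound_ge1 n : 1 <= plateau_bound n.
Proof.
rewrite /plateau_bound (@le_trans _ _ 2) ?ler1n// ler_peMr// exprn_ege1//.
by rewrite -natrM ler1n.
Qed.

Lemma is_derive_plateau n j s : (j < n)%N -> is_derive s 1 (plateau n j) (plateau n j.+1 s).
Proof.
move=> jn; rewrite /plateau exprSr -mulrA mulrBr.
apply: (@is_deriveZ _ _ _ (fun s => dstep n j (s * (4 * n.+1%:R) + 0) - dstep n j (s * (4 * n.+1%:R) + (- (3 * n.+1%:R))))).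
by apply: is_deriveB; apply: is_derive_comp_affine; exact: is_derive_dstep.
Qed.

Lemma norm_plateau n j s : (j <= n)%N -> `|plateau n j s| <= plateau_bound n.
Proof.
move=> jn; rewrite /plateau normrM normrX (@ger0_norm _ (4 * _))//.
apply: (@le_trans _ _ ((4 * n.+1%:R) ^+ j * (2 ^+ j + 2 ^+ j))).
  rewrite ler_wpM2l ?exprn_ge0// (le_trans (ler_normB _ _))// lerD//; exact: dstep_bound.
have -> : (4 * n.+1%:R) ^+ j * (2 ^+ j + 2 ^+ j) = 2 * (8 * n.+1%:R) ^+ j :> R.
  rewrite -mulr2n -[_ *+ 2]mulr_natl mulrCA -exprMn mulrAC; congr (_ * (_ * _) ^+ _); ring.
rewrite /plateau_bound ler_wpM2l// ler_weXn2l// -natrM ler1n//.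
Qed.

Lemma plateau_out n j s : (j <= n)%N -> (s <= 0) || (1 <= s) -> plateau n j s = 0.
Proof.
move=> jn /orP[s0|s1]; rewrite /plateau.
  rewrite !dstep_le0 ?subrr ?mulr0//; have : (0 : R) < n.+1%:R by rewrite ltr0n.
    nra.
  nra.
rewrite !dstep_ge ?subrr ?mulr0//; have : (0 : R) < n.+1%:R by rewrite ltr0n.
  nra.
nra.
Qed.

Lemma plateau_itv n s : 0 <= plateau n 0 s <= 1.
Proof.
rewrite /plateau mul1r; have n0 : (0 : R) < n.+1%:R by rewrite ltr0n.
have /andP[a0 a1] := step_itv n (s * (4 * n.+1%:R) + 0).
have /andP[b0 b1] := step_itv n (s * (4 * n.+1%:R) + - (3 * n.+1%:R)).
rewrite /dstep subn0 /=.
(* Left of the middle the falling step has not begun, right of it the rising one is complete. *)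
have [s2|s2] := leP s (2^-1).
  rewrite [X in _ - X]step_le0 ?subr0 ?a0//; nra.
rewrite [X in X - _]step_ge; first by lra.
nra.
Qed.

Lemma plateau_eq1 n s : 4^-1 <= s <= 3 / 4 -> plateau n 0 s = 1.
Proof.
move=> /andP[s1 s2]; rewrite /plateau mul1r /dstep subn0 /=.
have n0 : (0 : R) < n.+1%:R by rewrite ltr0n.
rewrite step_ge; last by nra.
by rewrite step_le0 ?subr0//; nra.
Qed.

Lemma plateau_lipschitz n j s t : (j < n)%N -> `|plateau n j s - plateau n j t| <= plateau_bound n * `|s - t|.
Proof.
move=> jn; wlog st : s t / s <= t.
  by move=> H; have [/H//|/ltW/H] := leP s t; rewrite distrC (distrC t).
have cb : {within `[s, t], continuous (plateau n j)}.
  apply: continuous_subspaceT => y; apply/differentiable_continuous/derivable1_diffP.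
  by have [] := is_derive_plateau y jn.
have [c _ H] := MVT_segment st (fun y _ => is_derive_plateau y jn) cb.
by rewrite distrC H normrM (distrC s) ler_wpM2r// norm_plateau.
Qed.

(** Lipschitz at distances up to 1, bounded beyond. *)
Lemma plateau_holder n j s t (alpha : R) : 0 < alpha -> alpha <= 1 -> (j < n)%N ->
  `|plateau n j s - plateau n j t| <= 2 * plateau_bound n * `|s - t| `^ alpha.
Proof.
move=> a0 a1 jn; have M0 := plateau_bound_ge1 n.
have M0' : 0 <= plateau_bound n by lra.
have [st|st] := leP `|s - t| 1.
  apply: (le_trans (plateau_lipschitz s t jn)).
  have : `|s - t| <= `|s - t| `^ alpha.
    have := normr_ge0 (s - t); rewrite le_eqVlt => /predU1P[<-|p]; first exact: powR_ge0.
    have := @ger_powR _ `|s - t| _ alpha 1 a1.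
    by rewrite p st powRr1//; apply.
  have := powR_ge0 `|s - t| alpha; nra.
apply: (@le_trans _ _ (2 * plateau_bound n)).
  have := norm_plateau s (ltnW jn); have := norm_plateau t (ltnW jn).
  have := ler_normB (plateau n j s) (plateau n j t); lra.
rewrite ler_peMr ?mulr_ge0//.
have : 1 `^ alpha <= `|s - t| `^ alpha.
  by apply: ge0_ler_powR; rewrite ?nnegrE ?(ltW a0)// ltW.
by rewrite powR1.
Qed.

Lemma continuous_plateau n j : (j < n)%N -> continuous (plateau n j).
Proof.
move=> jn y; apply/differentiable_continuous/derivable1_diffP.
by have [] := is_derive_plateau y jn.
Qed.

End plateau_function.

(** * Derivatives of functions of finitely many linear forms *)

Section differentials.
Context (R : realType) (X : normedModType R).

Lemma is_diff_bigprod (I : eqType) (r : seq I) (f df : I -> X -> R) (x : X) :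
  uniq r -> (forall i, is_diff x (f i) (df i)) ->
  is_diff x (fun y => \prod_(i <- r) f i y)
    (fun h => \sum_(i <- r) df i h * \prod_(l <- r | l != i) f l x).
Proof.
move=> + Df; elim: r => [_|a r IH /= /andP[ar ur]].
  rewrite (_ : (fun y => _) = cst 1); last by apply/funext => y; rewrite big_nil.
  by apply: is_diff_eq; apply/funext => h; rewrite big_nil.
have H := is_diffM (Df a) (IH ur).
rewrite (_ : (fun y => _) = f a * (fun y => \prod_(i <- r) f i y)); last first.
  by apply/funext => y; rewrite big_cons.
apply: is_diff_eq; apply/funext => h; rewrite big_cons big_cons eqxx /= addrC.
rewrite -[LHS]/(\prod_(i <- r) f i x * df a h +
  f a x * \sum_(i <- r) df i h * \prod_(l <- r | l != i) f l x).
rewrite mulr_sumr mulrC; congr (_ * _ + _).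
  rewrite big_seq [RHS]big_seq_cond; apply: eq_bigl => i.
  by case: (boolP (i \in r)) => //= ir; apply/esym; apply: contraNneq ar => <-.
rewrite [LHS]big_seq [RHS]big_seq; apply: eq_bigr => i ir.
rewrite big_cons ifT 1?mulrCA//; by apply: contraNneq ar => ->.
Qed.

Lemma is_diff_bigsum (I : Type) (r : seq I) (f df : I -> X -> R) (x : X) :
  (forall i, is_diff x (f i) (df i)) ->
  is_diff x (fun y => \sum_(i <- r) f i y) (fun h => \sum_(i <- r) df i h).
Proof.
move=> Df; elim: r => [|a r IH].
  rewrite (_ : (fun y => _) = cst 0); last by apply/funext => y; rewrite big_nil.
  by apply: is_diff_eq; apply/funext => h; rewrite big_nil.
rewrite (_ : (fun y => _) = f a + (fun y => \sum_(i <- r) f i y)); last first.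
  by apply/funext => y; rewrite big_cons.
have H := is_diffD (Df a) IH.
by apply: is_diff_eq; apply/funext => h; rewrite big_cons.
Qed.

Lemma is_diff_comp_real (g : R -> R) (dg : R) (u : X -> R) (du : X -> R) (x : X) :
  is_derive (u x) 1 g dg -> is_diff x u du ->
  is_diff x (fun y => g (u y)) (fun h => dg * du h).
Proof.
move=> Dg Du.
have Dg' : is_diff (u x) g (fun t => dg * t).
  have dg' : differentiable g (u x) by apply/derivable1_diffP; case: Dg.
  apply: DiffDef => //; apply/funext => t.
  have -> : t = t *: (1 : R) by rewrite /GRing.scale/= mulr1.
  by rewrite linearZ /= -deriveE// derive_val /GRing.scale /= mulr1 mulrC.
exact: is_diff_comp.
Qed.

Lemma is_diff_affine (l : {linear X -> R}) (c : R) (x : X) : continuous l ->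
  is_diff x (fun y => l y + c) l.
Proof.
move=> cl; have H : is_diff x l l.
  by apply: DiffDef; [exact: linear_differentiable|exact: diff_lin].
have := is_diffD H (is_diff_cst c x).
by move=> K; apply: is_diff_eq; apply/funext => h; rewrite fctE /= addr0.
Qed.

Lemma is_diff_remainder (f df : X -> R) (x : X) (eps : R) : is_diff x f df -> 0 < eps ->
  \forall h \near (0 : X), `|f (x + h) - f x - df h| <= eps * `|h|.
Proof.
move=> [dfx dfE] eps0.
have /eqaddoP/(_ eps eps0) := diff_locally dfx.
apply: filterS => h /=; rewrite dfE !fctE /= (addrC h x).
by rewrite opprD addrA.
Qed.

End differentials.

Section jets.
Context (R : realType) (X : normedModType R) (d : nat).
Variable ell : 'I_d -> {linear X -> R}.
Implicit Types (b : 'I_d -> nat) (g : ('I_d -> nat) -> R).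

Definition incr_at b (i : 'I_d) : 'I_d -> nat := fun l => (b l + (l == i))%N.

(** With [g b] the partial derivative of order [b] of [q : R^d -> R] at
    [(ell i x)_i], this is the [j]-th derivative at [x] of [q \o (ell i)_i]. *)
Fixpoint jet j g {struct j} : ('I_j -> X) -> R :=
  match j with
  | 0%N => fun _ => g (fun=> 0%N)
  | j'.+1 => fun v => \sum_i ell i (v ord0) *
      jet (fun b => g (incr_at b i)) (fun r : 'I_j' => v (lift ord0 r))
  end.

Lemma jetD j g1 g2 v : jet (j := j) (fun b => g1 b + g2 b) v = jet g1 v + jet g2 v.
Proof.
elim: j g1 g2 v => [//|j IH] g1 g2 v /=; rewrite -big_split /=.
by apply: eq_bigr => i _; rewrite IH mulrDr.
Qed.

Lemma jetZ j (c : R) g v : jet (j := j) (fun b => c * g b) v = c * jet g v.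
Proof.
elim: j g v => [//|j IH] g v /=; rewrite mulr_sumr.
by apply: eq_bigr => i _; rewrite IH mulrCA.
Qed.

Lemma jetB j g1 g2 v : jet (j := j) (fun b => g1 b - g2 b) v = jet g1 v - jet g2 v.
Proof.
rewrite -[X in _ = _ + X]mulN1r -jetZ -jetD; congr jet.
by apply/funext => b; rewrite mulN1r.
Qed.

Lemma jet_sum j (I : Type) (r : seq I) (c : I -> R) (g : I -> ('I_d -> nat) -> R) v :
  jet (j := j) (fun b => \sum_(i <- r) c i * g i b) v = \sum_(i <- r) c i * jet (g i) v.
Proof.
elim: r => [|i r IH].
  rewrite big_nil -[RHS](mul0r (jet (fun=> 0) v)) -jetZ; congr jet.
  by apply/funext => b; rewrite big_nil mul0r.
rewrite big_cons -IH -jetZ -jetD; congr jet.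
by apply/funext => b; rewrite big_cons.
Qed.

(** A first argument [h] amounts to replacing the table [g] by its derivative along [h]. This
    reduces Fréchet differentiability of jets to that of the table. *)
Lemma jet_fcons j g h v :
  jet (j := j.+1) g (fcons h v) = jet (fun b => \sum_i ell i h * g (incr_at b i)) v.
Proof.
rewrite jet_sum /=; apply: eq_bigr => i _; rewrite /fcons unlift_none; congr (_ * jet _ _).
by apply/funext => r; rewrite liftK.
Qed.

(** Each argument costs one factor [K], a bound for the l^1 norm of its coordinates. *)
Lemma jet_bound j g v (K c : R) : 0 <= K ->
  (forall r, \sum_i `|ell i (v r)| <= K) ->
  (forall b, (forall l, (b l <= j)%N) -> `|g b| <= c) ->
  `|jet (j := j) g v| <= K ^+ j * c.
Proof.
move=> K0; elim: j g v => [|j IH] g v Kv gc; first by rewrite mul1r; exact: gc.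
have c0 : 0 <= c by apply: le_trans (gc (fun=> 0%N) (fun=> leq0n _)).
rewrite (le_trans (ler_norm_sum _ _ _))//.
apply: (@le_trans _ _ (\sum_i `|ell i (v ord0)| * (K ^+ j * c))).
  apply: ler_sum => i _; rewrite normrM ler_wpM2l//; apply: IH => // b bj.
  apply: gc => l; rewrite /incr_at -addn1 leq_add//; exact: leq_b1.
by rewrite -mulr_suml exprS -mulrA ler_wpM2r// mulr_ge0// exprn_ge0.
Qed.

Lemma jet_linear j g (v : 'I_j -> X) (i : 'I_j) :
  linear (fun u : X => jet g [eta v with i |-> u]).
Proof.
elim: j g v i => [|j IH] g v i c u u' /=; first by case: i.
rewrite scaler_sumr -big_split /=; apply: eq_bigr => l _.
case: (unliftP ord0 i) => [i'|] -> /=.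
  have E (y : X) : (fun r : 'I_j => if lift ord0 r == lift ord0 i' then y else v (lift ord0 r)) =
      [eta (fun r => v (lift ord0 r)) with i' |-> y].
    by apply/funext => r; rewrite /= (inj_eq lift_inj).
  by rewrite !E IH mulrDr; congr (_ + _); rewrite /GRing.scale/= mulrCA.
by rewrite linearP mulrDl /GRing.scale /= mulrA.
Qed.

Lemma jet_continuous (T : topologicalType) j g (V : T -> 'I_j -> X) :
  (forall i, continuous (ell i)) -> (forall r, continuous (V^~ r)) ->
  continuous (fun t => jet g (V t)).
Proof.
move=> cell; elim: j g V => [|j IH] g V cV t /=; first exact: cvg_cst.
apply: cvg_big => [|i _]; first exact: add_continuous.
apply: cvgM.
  by apply: (cvg_comp (V^~ ord0) (ell i) (cV ord0 t)); exact: cell.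
by apply: IH => r; exact: cV.
Qed.

(** The neighbourhood of 0 must not depend on [v]: only finitely many entries of the table occur,
    and [v] enters through [K] alone. Dividing by [K + 1] allows [K = 0]. *)
Lemma jet_littleo j (rem : X -> ('I_d -> nat) -> R) (K : R) : 0 <= K ->
  (forall v : X, `|v| <= 1 -> \sum_i `|ell i v| <= K) ->
  (forall b eps, (forall l, (b l <= j)%N) -> 0 < eps ->
     \forall h \near (0 : X), `|rem h b| <= eps * `|h|) ->
  forall eps, 0 < eps -> \forall h \near (0 : X),
    forall v, (forall r, `|v r| <= 1) -> `|jet (j := j) (rem h) v| <= eps * `|h|.
Proof.
move=> K0 Kell; elim: j rem => [|j IH] rem Hrem eps eps0.
  by have := Hrem (fun=> 0%N) eps (fun=> leqnn _) eps0; apply: filterS => h H v _.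
have K1 : 0 < K + 1 by lra.
have : \forall h \near (0 : X), forall i v, (forall r, `|v r| <= 1) ->
    `|jet (j := j) (fun b => rem h (incr_at b i)) v| <= eps / (K + 1) * `|h|.
  apply: filter_forall => i; apply: (IH (fun h b => rem h (incr_at b i))); last by rewrite divr_gt0.
  move=> b e' bj e0; apply: Hrem => // l.
  by rewrite /incr_at -addn1 leq_add//; exact: leq_b1.
apply: filterS => h H v v1; rewrite (le_trans (ler_norm_sum _ _ _))//.
apply: (@le_trans _ _ (\sum_i `|ell i (v ord0)| * (eps / (K + 1) * `|h|))).
  by apply: ler_sum => i _; rewrite normrM ler_wpM2l//; exact: H.
rewrite -mulr_suml (le_trans (ler_wpM2r _ (Kell _ (v1 ord0))))//.
  by rewrite mulr_ge0// divr_ge0// ltW.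
rewrite mulrA ler_wpM2r// mulrCA ger_pMr// ler_pdivrMr// mul1r; lra.
Qed.

End jets.

Section jet_holder.
Context (R : realType) (X Y : normedModType R) (d : nat).
Variable ell : 'I_d -> {linear X -> R}.
Variables (g : X -> ('I_d -> nat) -> R) (w : Y) (k : nat) (alpha B K A H : R).
Hypothesis cell : forall i, continuous (ell i).
Hypothesis w1 : `|w| = 1.
Hypothesis K0 : 0 <= K.
Hypothesis Kell : forall v : X, `|v| <= 1 -> \sum_i `|ell i v| <= K.
Hypothesis g_diff : forall x b eps, (forall l, (b l < k)%N) -> 0 < eps ->
  \forall h \near (0 : X),
    `|g (x + h) b - g x b - \sum_i ell i h * g x (incr_at b i)| <= eps * `|h|.
Hypothesis g_bound : forall x b, (forall l, (b l <= k)%N) -> `|g x b| <= A.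
Hypothesis g_holder : forall x y b, (forall l, (b l <= k)%N) ->
  `|g x b - g y b| <= H * `|x - y| `^ alpha.
(** The Hölder norm has [k + 2] terms, [k + 1] suprema and the seminorm; each gets an equal share of
    [B]. This is the factor [k + 2] of [Lambda]. *)
Hypothesis KA : forall j, (j <= k)%N -> K ^+ j * A <= B / k.+2%:R.
Hypothesis KH : K ^+ k * H <= B / k.+2%:R.

Let DF j (x : X) (v : 'I_j -> X) : Y := jet ell (g x) v *: w.

Lemma opnorm_le j (M : ('I_j -> X) -> Y) (c : R) :
  (forall v, (forall i, `|v i| <= 1) -> `|M v| <= c) -> (opnorm M <= c%:E)%E.
Proof. by move=> Mc; apply: ub_ereal_sup => _ [v v1 <-]; rewrite lee_fin; exact: Mc. Qed.

Lemma jet_is_derivatives : is_derivatives (fun x => g x (fun=> 0%N) *: w) k DF.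
Proof.
split => // [j x jk|j jk x eps eps0].
  split; last first.
    have gen (T : topologicalType) (V : T -> 'I_j -> X) :
      (forall r, continuous (V^~ r)) -> continuous (fun t => jet ell (g x) (V t) *: w).
    move=> cV t; have cj := @jet_continuous R X d ell T j (g x) V cell cV.
    by apply: cvgZ; [exact: cj|exact: cvg_cst].
  have ev (r : 'I_j) : continuous (fun t : {ptws 'I_j -> X} => t r) by exact: proj_continuous.
  exact: (gen {ptws 'I_j -> X} (fun t => t) ev).
  by move=> v i c u u'; rewrite /DF jet_linear scalerDl scalerA.
have P b e : (forall l, (b l <= j)%N) -> 0 < e -> \forall h \near (0 : X),
    `|g (x + h) b - g x b - \sum_i ell i h * g x (incr_at b i)| <= e * `|h|.
  by move=> bj e0; apply: g_diff => // l; exact: leq_ltn_trans jk.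
have := @jet_littleo _ _ _ ell j
  (fun h b => g (x + h) b - g x b - \sum_i ell i h * g x (incr_at b i)) K K0 Kell P eps eps0.
apply: filterS => h Hh; apply: opnorm_le => v v1; rewrite /DF.
rewrite jet_fcons -scalerBl -scalerBl normrZ w1 mulr1.
by have := Hh v v1; rewrite jetB (jetB _ (g (x + h))).
Qed.

Lemma jet_holder_ball : holder_ball k alpha B (fun x => g x (fun=> 0%N) *: w).
Proof.
exists DF; split; first exact: jet_is_derivatives.
have -> : B = \sum_(j < k.+1) (B / k.+2%:R) + B / k.+2%:R.
  rewrite sumr_const card_ord -[in LHS](@divfK _ k.+2%:R _ B) ?pnatr_eq0//.
  by rewrite -natr1 mulrDr mulr1 mulr_natr.
have jb j x v : (j <= k)%N -> (forall i, `|v i| <= 1) -> `|DF (j := j) x v| <= K ^+ j * A.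
  move=> jk v1; rewrite normrZ w1 mulr1; apply: jet_bound => // [r|b bj]; first exact: Kell.
  by apply: g_bound => l; exact: leq_trans jk.
rewrite EFinD -sumEFin; apply: leeD.
  apply: lee_sum => j _; have jk : (j <= k)%N by rewrite -ltnS.
  apply: ub_ereal_sup => _ [x _ <-]; apply: opnorm_le => v v1.
  by rewrite (le_trans _ (KA jk))//; exact: jb.
have B0 : 0 <= B / k.+2%:R.
  rewrite (le_trans _ (KA (leqnn k)))// mulr_ge0 ?exprn_ge0//.
  exact: le_trans (g_bound 0 (b := fun=> 0%N) (fun=> leq0n _)).
rewrite ge_max lee_fin B0 /=; apply: ub_ereal_sup => _ [[x y] /= xy <-].
have xy0 : 0 < `|x - y| by rewrite normr_gt0 subr_eq0.
apply: (@le_trans _ _ ((K ^+ k * (H * `|x - y| `^ alpha))%:E * (`|x - y| `^ (- alpha))%:E)%E).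
  rewrite lee_wpmul2r ?lee_fin ?powR_ge0//; apply: opnorm_le => v v1.
  rewrite -scalerBl normrZ w1 mulr1 -jetB; apply: jet_bound => // [r|b bk]; first exact: Kell.
  exact: g_holder.
by rewrite -EFinM lee_fin powRN -!mulrA divff ?mulr1// gt_eqF// powR_gt0.
Qed.

End jet_holder.

(** * Sums of products over the cells of the grid *)

Section products.
Context (R : realType).

(* Telescoping along the hybrids [a_0, .., a_(i-1), b_i, .., b_(d-1)]. *)
Lemma norm_prod_sub d (a b : 'I_d -> R) :
  `|\prod_i a i - \prod_i b i| <= \sum_(i < d) \prod_(l < d)
    (if (l < i)%N then `|a l| else if l == i then `|a l - b l| else `|b l|).
Proof.
elim: d a b => [|d IH] a b; first by rewrite !big_ord0 subrr normr0.
rewrite !big_ord_recl /=.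
rewrite [X in _ <= _ + X](eq_bigr (fun i : 'I_d => `|a ord0| * \prod_(l < d)
   (if (l < i)%N then `|a (lift ord0 l)| else if l == i
    then `|a (lift ord0 l) - b (lift ord0 l)| else `|b (lift ord0 l)|))); last first.
  by move=> i _; rewrite big_ord_recl /=; congr (_ * _).
rewrite -mulr_sumr -normr_prod.
have -> : a ord0 * \prod_(i < d) a (lift ord0 i) - b ord0 * \prod_(i < d) b (lift ord0 i) =
    (a ord0 - b ord0) * \prod_(i < d) b (lift ord0 i) +
    a ord0 * (\prod_(i < d) a (lift ord0 i) - \prod_(i < d) b (lift ord0 i)) by ring.
by rewrite (le_trans (ler_normD _ _))// !normrM lerD// ler_wpM2l// IH.
Qed.

(** By distributivity the sum over the grid is a product of one-dimensional sums, so the bound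
    ignores the number of cells. *)
Lemma sum_prod_ffun_le (I J : finType) (c : I -> J -> R) (M : R) :
  (forall i j, 0 <= c i j) -> (forall i, \sum_j c i j <= M) ->
  \sum_(z : {ffun I -> J}) \prod_i c i (z i) <= M ^+ #|I|.
Proof.
move=> c0 cM; rewrite -(bigA_distr_bigA c) -prodr_const.
by apply: ler_prod => i _; rewrite cM sumr_ge0.
Qed.

Lemma sum_norm_prod_sub (d : nat) (J : finType) (a b : 'I_d -> J -> R) (M : R) (theta : 'I_d -> R) :
  (forall i, \sum_j `|a i j| <= M) -> (forall i, \sum_j `|b i j| <= M) ->
  (forall i, \sum_j `|a i j - b i j| <= M * theta i) ->
  \sum_(z : {ffun 'I_d -> J}) `|\prod_i a i (z i) - \prod_i b i (z i)| <=
    M ^+ d * \sum_i theta i.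
Proof.
move=> aM bM abM.
apply: (@le_trans _ _ (\sum_(z : {ffun 'I_d -> J}) \sum_(i < d) \prod_(l < d)
    (if (l < i)%N then `|a l (z l)| else if l == i then `|a l (z l) - b l (z l)| else `|b l (z l)|))).
  by apply: ler_sum => z _; exact: norm_prod_sub.
rewrite exchange_big mulr_sumr /=; apply: ler_sum => i _.
pose c (l : 'I_d) (s : J) := if (l < i)%N then `|a l s| else if l == i then `|a l s - b l s| else `|b l s|.
rewrite -(bigA_distr_bigA c) (bigD1 i)//= /c ltnn eqxx.
have M0 : 0 <= M by rewrite (le_trans _ (aM i))// sumr_ge0.
apply: (@le_trans _ _ ((M * theta i) * \prod_(l < d | l != i) M)).
  apply: ler_pM => //; rewrite ?sumr_ge0//.
    by apply: prodr_ge0 => l _; apply: sumr_ge0 => s _; case: ifP => //; case: ifP.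
  apply: ler_prod => l li; rewrite (negbTE li); case: (l < i)%N.
    by rewrite sumr_ge0//= aM.
  by rewrite sumr_ge0//= bM.
rewrite mulrAC -(bigD1 i (P := xpredT) (F := fun=> M))//= prodr_const card_ord.
by rewrite mulrC.
Qed.

Lemma card_shift_le1 n (u : R) : (#|[pred z : 'I_n | (0 < u - z%:R < 1)%R]| <= 1)%N.
Proof.
apply/card_le1_eqP => z z'; rewrite !inE => /andP[a1 a2] /andP[b1 b2].
have : (z%:R < z'%:R + 1 :> R) by lra.
have : (z'%:R < z%:R + 1 :> R) by lra.
rewrite !natr1 !ltr_nat !ltnS => l1 l2.
by apply/val_inj/eqP; rewrite eqn_leq l1 l2.
Qed.

Lemma sum_supp_le (I : finType) (S : pred I) (F : I -> R) (c : R) :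
  (forall i, ~~ S i -> F i = 0) -> (forall i, F i <= c) -> \sum_i F i <= #|S|%:R * c.
Proof.
move=> FS Fc; rewrite (bigID S) /= [X in _ + X]big1// addr0.
by rewrite mulr_natl -sumr_const; apply: ler_sum => i _.
Qed.

Variable f : R -> R.
Hypothesis f_out : forall s, (s <= 0) || (1 <= s) -> f s = 0.

Let f_in s : ~~ (0 < s < 1) -> f s = 0.
Proof. by rewrite negb_and -!leNgt => /f_out. Qed.

Lemma sum_shift_le n (u M : R) : (forall s, `|f s| <= M) -> \sum_(z < n) `|f (u - z%:R)| <= M.
Proof.
move=> fM; have M0 : 0 <= M by apply: le_trans (fM 0).
apply: (@le_trans _ _ (#|[pred z : 'I_n | (0 < u - z%:R < 1)%R]|%:R * M)).
  by apply: sum_supp_le => // i /= /f_in ->; rewrite normr0.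
by rewrite ler_piMl// lern1 card_shift_le1.
Qed.

(** At most two indices contribute, one for [u] and one for [v]. *)
Lemma sum_shift_sub_le n (u v c : R) : (forall s, `|f (u - s) - f (v - s)| <= c) ->
  \sum_(z < n) `|f (u - z%:R) - f (v - z%:R)| <= 2 * c.
Proof.
move=> fM; have c0 : 0 <= c by apply: le_trans (fM 0).
pose S (u : R) := [pred z : 'I_n | (0 < u - z%:R < 1)%R].
apply: (@le_trans _ _ (#|[predU S u & S v]|%:R * c)).
  apply: sum_supp_le => // i; rewrite /= negb_or => /andP[/f_in -> /f_in ->].
  by rewrite subr0 normr0.
rewrite ler_wpM2r// ler_nat.
apply: leq_trans (leq_add (card_shift_le1 n u) (card_shift_le1 n v)).
by rewrite -(cardUI (S u) (S v)) leq_addr.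
Qed.

End products.

Section bump_grid.
Context (R : realType) (X : normedModType R) (d n k : nat).
Variable ell : 'I_d -> {linear X -> R}.
Variables (t : 'I_d -> R) (c : {ffun 'I_d -> 'I_n} -> R) (h : R).
Hypothesis cell : forall i, continuous (ell i).
Hypothesis h0 : 0 <= h.
Hypothesis c_le : forall z, `|c z| <= h.
(** One order more than [k], so that the derivatives of order [k] are still Lipschitz. *)
Local Notation M := (plateau_bound R k.+1).
Local Notation psi := (@plateau R k.+1).

(** The partial derivative of order [b] of a combination of bumps, as a table in the format of
    [jet]. *)
Definition bump_grid (x : X) (b : 'I_d -> nat) : R :=
  \sum_z c z * \prod_i psi (b i) (ell i x + t i - (z i)%:R).

Let M0 : 0 <= M. Proof. by have := plateau_bound_ge1 R k.+1; lra. Qed.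

Lemma bump_grid_diff x b (eps : R) : (forall l, (b l < k)%N) -> 0 < eps ->
  \forall v \near (0 : X), `|bump_grid (x + v) b - bump_grid x b -
    \sum_i ell i v * bump_grid x (incr_at b i)| <= eps * `|v|.
Proof.
move=> bk eps0; apply: (@is_diff_remainder _ _ (bump_grid^~ b)
  (fun v => \sum_i ell i v * bump_grid x (incr_at b i)) x eps _ eps0).
have Dz z : is_diff x (fun y => c z * \prod_i psi (b i) (ell i y + t i - (z i)%:R))
    (fun v => c z * \sum_i ell i v * \prod_l psi (incr_at b i l) (ell l x + t l - (z l)%:R)).
  have Di i : is_diff x (fun y => psi (b i) (ell i y + t i - (z i)%:R))
      (fun v => psi (b i).+1 (ell i x + t i - (z i)%:R) * ell i v).
    apply: is_diff_comp_real.
      by apply: is_derive_plateau; rewrite ltnS ltnW.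
    have := is_diff_affine (t i - (z i)%:R) x (@cell i).
    by rewrite (_ : (fun y => _) = (fun y => ell i y + t i - (z i)%:R))//; apply/funext => y; rewrite addrA.
  have := is_diffZ (c z) (is_diff_bigprod (index_enum_uniq _) Di).
  move=> H; apply: is_diff_eq; apply/funext => v; congr (_ * _).
  apply: eq_bigr => i _; rewrite [in RHS](bigD1 i)//= /incr_at eqxx addn1.
  rewrite -mulrA mulrCA; congr (_ * (_ * _)).
  by apply: eq_bigr => l /negbTE ->; rewrite addn0.
have := is_diff_bigsum (index_enum _) Dz.
move=> H; apply: is_diff_eq; apply/funext => v.
rewrite /bump_grid; under [RHS]eq_bigr do rewrite mulr_sumr.
rewrite [RHS]exchange_big; apply: eq_bigr => z _ /=; rewrite mulr_sumr.
by apply: eq_bigr => i _; rewrite mulrCA.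
Qed.

Lemma bump_grid_bound x b : (forall l, (b l <= k)%N) -> `|bump_grid x b| <= h * M ^+ d.
Proof.
move=> bk; rewrite (le_trans (ler_norm_sum _ _ _))//.
apply: (@le_trans _ _ (\sum_(z : {ffun 'I_d -> 'I_n})
    h * \prod_i `|psi (b i) (ell i x + t i - (z i)%:R)|)).
  by apply: ler_sum => z _; rewrite normrM normr_prod ler_wpM2r// prodr_ge0.
rewrite -mulr_sumr ler_wpM2l// -[X in M ^+ X]card_ord.
apply: (sum_prod_ffun_le (c := fun (i : 'I_d) (s : 'I_n) => `|psi (b i) (ell i x + t i - s%:R)|)) => // i.
by apply: sum_shift_le => s; [apply: plateau_out|apply: norm_plateau]; exact: leqW (bk i).
Qed.

Lemma bump_grid_holder (alpha S : R) x y b : 0 < alpha -> alpha <= 1 ->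
  (forall l, (b l <= k)%N) -> (\sum_i `|ell i (x - y)| `^ alpha <= S * `|x - y| `^ alpha) ->
  `|bump_grid x b - bump_grid y b| <= h * (M ^+ d * (4 * S)) * `|x - y| `^ alpha.
Proof.
move=> a0 a1 bk HS; rewrite /bump_grid -sumrB (le_trans (ler_norm_sum _ _ _))//.
pose p (x : X) (i : 'I_d) (s : 'I_n) := psi (b i) (ell i x + t i - s%:R).
apply: (@le_trans _ _ (\sum_(z : {ffun 'I_d -> 'I_n})
    h * `|\prod_i p x i (z i) - \prod_i p y i (z i)|)).
  by apply: ler_sum => z _; rewrite -mulrBr normrM ler_wpM2r.
rewrite -mulr_sumr -mulrA ler_wpM2l//.
have pM u i : \sum_j `|p u i j| <= M.
  by apply: sum_shift_le => s; [apply: plateau_out|apply: norm_plateau]; exact: leqW (bk i).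
(* The 4 is 2 for the two active cells times 2 from [plateau_holder]. *)
have pD i : \sum_j `|p x i j - p y i j| <= M * (4 * `|ell i (x - y)| `^ alpha).
  apply: (le_trans (sum_shift_sub_le _ (c := 2 * M * `|ell i (x - y)| `^ alpha) _ _)).
  - by move=> s; apply: plateau_out; exact: leqW (bk i).
  - move=> s; have := plateau_holder (ell i x + t i - s) (ell i y + t i - s) a0 a1 (n := k.+1) (j := b i).
    rewrite ltnS => /(_ (bk i)); congr (_ <= _ * `|_| `^ _); rewrite (linearB (ell i)).
    by move: (ell i x : R) (ell i y : R) => q r; lra.
  by rewrite le_eqVlt; apply/orP; left; apply/eqP; ring.
apply: (le_trans (sum_norm_prod_sub (pM x) (pM y) pD)).
rewrite -!mulrA ler_wpM2l ?exprn_ge0// -mulr_sumr ler_wpM2l//.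
Qed.

Lemma bump_grid_holder_ball (Y : normedModType R) (w : Y) (alpha B K S : R) :
  0 < alpha -> alpha <= 1 -> `|w| = 1 -> 0 <= K ->
  (forall v : X, `|v| <= 1 -> \sum_i `|ell i v| <= K) ->
  (forall v : X, \sum_i `|ell i v| `^ alpha <= S * `|v| `^ alpha) ->
  (forall j, (j <= k)%N -> K ^+ j * (h * M ^+ d) <= B / k.+2%:R) ->
  K ^+ k * (h * (M ^+ d * (4 * S))) <= B / k.+2%:R ->
  holder_ball k alpha B (fun x => bump_grid x (fun=> 0%N) *: w).
Proof.
move=> a0 a1 w1 K0 Kell Sell KA KH.
apply: (jet_holder_ball cell w1 K0 Kell _ _ _ KA KH).
- exact: bump_grid_diff.
- exact: bump_grid_bound.
- by move=> x y b bk; exact: bump_grid_holder.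
Qed.

End bump_grid.

(** * The hypercube of functions *)

Section coordinates.
Context (R : realType).

(** Both sums are normalised to 1 and Young's inequality is applied termwise. *)
Lemma Hoelder_sum (I : finType) (a b : I -> R) (t : R) : 0 < t -> t < 1 ->
  (forall i, 0 <= a i) -> (forall i, 0 <= b i) ->
  \sum_i a i `^ t * b i `^ (1 - t) <= (\sum_i a i) `^ t * (\sum_i b i) `^ (1 - t).
Proof.
move=> t0 t1 a0 b0; have u0 : 0 < 1 - t by lra.
have zero (c : I -> R) (r : R) : r != 0 -> (forall i, 0 <= c i) -> \sum_i c i <= 0 -> forall i, c i `^ r = 0.
  move=> r0 c0 cs i; rewrite (_ : c i = 0) ?powR0//.
  apply/eqP; rewrite eq_le c0 andbT (le_trans _ cs)// (bigD1 i)//= lerDl.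
  by apply: sumr_ge0.
have [A0|A0] := leP (\sum_i a i) 0.
  by rewrite big1 ?mulr_ge0 ?powR_ge0// => i _; rewrite (zero a) ?mul0r ?gt_eqF.
have [B0|B0] := leP (\sum_i b i) 0.
  by rewrite big1 ?mulr_ge0 ?powR_ge0// => i _; rewrite (zero b) ?mulr0 ?gt_eqF.
set A := \sum_i a i in A0 *; set B := \sum_i b i in B0 *.
have term i : a i `^ t * b i `^ (1 - t) <=
    (A `^ t * B `^ (1 - t)) * (t * (a i / A) + (1 - t) * (b i / B)).
  have aA : a i = A * (a i / A) by rewrite mulrC divfK// gt_eqF.
  have bB : b i = B * (b i / B) by rewrite mulrC divfK// gt_eqF.
  have aA0 : 0 <= a i / A by rewrite divr_ge0// ltW.
  have bB0 : 0 <= b i / B by rewrite divr_ge0// ltW.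
  rewrite {1}aA {1}bB (powRM _ (ltW A0) aA0) (powRM _ (ltW B0) bB0) mulrACA.
  rewrite ler_wpM2l ?mulr_ge0 ?powR_ge0//.
  have := @conjugate_powR _ ((a i / A) `^ t) ((b i / B) `^ (1 - t)) t^-1 (1 - t)^-1.
  rewrite !powR_ge0 !invr_gt0 t0 u0 !invrK -!powRrM !divff ?gt_eqF// !powRr1//.
  rewrite (mulrC t) (mulrC (1 - t)); apply => //; lra.
rewrite (le_trans (ler_sum _ (fun i _ => term i)))// -mulr_sumr ler_piMr ?mulr_ge0 ?powR_ge0//.
by rewrite big_split /= -!mulr_sumr -!mulr_suml !divff ?gt_eqF//; lra.
Qed.

Context (X : hilbertType R).

(* With [alpha = 1] this bounds the first derivative of the coordinate map, and in
   general its Hölder increments: the two sums in [Lambda]. *)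
Lemma sum_coordinate_powR d (phi : nat -> X) (lam : nat -> R) (alpha : R) (v : X) :
  0 < alpha -> alpha <= 1 ->
  (forall i, (i < d)%N -> `|phi i| = 1) ->
  (forall i j, (i < d)%N -> (j < d)%N -> i <> j -> inner (phi i) (phi j) = 0) ->
  (forall i, (i < d)%N -> 0 < lam i) ->
  \sum_(i < d) `|coordinate lam phi i v| `^ alpha <=
    `|v| `^ alpha * (\sum_(i < d) lam i `^ (- (alpha / (2 - alpha)))) `^ (1 - alpha / 2).
Proof.
move=> a0 a1 phi1 phi_orth lam0.
(* Hölder's inequality with weights [alpha / 2] and [1 - alpha / 2]: the first factor becomes a sum
   of squares for Bessel, the second restores [lam i] to the power [- alpha / 2]. *)
have -> : \sum_(i < d) `|coordinate lam phi i v| `^ alpha =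
    \sum_(i < d) (inner v (phi i) ^+ 2) `^ (alpha / 2) *
      (lam i `^ (- (alpha / (2 - alpha)))) `^ (1 - alpha / 2).
  apply: eq_bigr => i _; have li := lam0 i (ltn_ord i).
  rewrite /coordinate normrM normfV (ger0_norm (sqrtr_ge0 _)).
  rewrite powRM ?invr_ge0 ?sqrtr_ge0//; congr (_ * _).
    rewrite -real_normK ?num_real// -powR_mulrn// -powRrM; congr (_ `^ _).
    by rewrite mulrC divfK.
  rewrite -powR12_sqrt ?ltW// -powRN -!powRrM; congr (_ `^ _).
  by field; apply/eqP => ?; lra.
apply: (le_trans (@Hoelder_sum _ _ _ (alpha / 2) _ _ _ _)).
- lra.
- lra.
- by move=> i; exact: sqr_ge0.
- by move=> i; exact: powR_ge0.
rewrite ler_wpM2r ?powR_ge0//.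
have -> : `|v| `^ alpha = (`|v| ^+ 2) `^ (alpha / 2).
  by rewrite -powR_mulrn// -powRrM; congr (_ `^ _); rewrite mulrC divfK.
apply: ge0_ler_powR; rewrite ?nnegrE ?sumr_ge0 ?sqr_ge0//; first lra.
- by move=> i _; exact: sqr_ge0.
- exact: bessel.
Qed.

Lemma measurable_coordinate (phi : nat -> X) (lam : nat -> R) i :
  measurable_fun setT (coordinate lam phi i : borel X -> R).
Proof. by apply: measurable_funM => //; exact: measurable_inner. Qed.

Lemma small_box_probability (mu : probability (borel X) R) (D : set nat)
    (xi : nat -> X -> R) (a b r : R) (l : nat -> R) d :
  independent_family mu D xi -> densities_bounded_below mu D xi a b ->
  `I_d `<=` D -> 0 <= b -> 0 <= r -> (forall i, (i < d)%N -> - a <= l i /\ l i + r <= a) ->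
  (((b * r) ^+ d)%:E <=
    mu [set x | forall i, (i < d)%N -> (l i <= xi i x <= l i + r)%R])%E.
Proof.
move=> indep [nu dens] dD b0 r0 la.
have := @indep (iota 0 d) (fun i => `[l i, (l i + r)]%classic) (iota_uniq 0 d).
have -> : [set x | forall i, i \in iota 0 d -> `[l i, (l i + r)]%classic (xi i x)] =
    [set x | forall i, (i < d)%N -> l i <= xi i x <= l i + r].
  apply/seteqP; split => x /= H i; have := H i; rewrite mem_iota add0n /= in_itv/=; exact.
move=> -> //; last by move=> i; rewrite mem_iota => /dD.
have -> : ((b * r) ^+ d)%:E = (\prod_(i <- iota 0 d) (b * r)%:E)%E.
  by rewrite prodEFin big_const_seq count_predT size_iota iter_mulr mulr1.
rewrite big_seq [X in (_ <= X)%E]big_seq.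
suff /andP[] : (0 <= \prod_(i <- iota 0 d | i \in iota 0 d) (b * r)%:E <=
    \prod_(i <- iota 0 d | i \in iota 0 d) mu [set x | `[l i, (l i + r)%R]%classic (xi i x)])%E by [].
apply: (big_ind2 (fun x y : \bar R => (0 <= x <= y)%E)); first by rewrite lexx lee01.
  move=> x1 y1 x2 y2 /andP[x10 xy1] /andP[x20 xy2].
  by rewrite mule_ge0//= lee_pmul.
move=> i; rewrite mem_iota add0n => /= id; rewrite lee_fin mulr_ge0//=.
have [mnu nu0 nuE nub] := dens i (dD i id);
rewrite (nuE `[l i, (l i + r)]%classic)//; have [l1 l2] := la i id.
apply: (@le_trans _ _ (\int[lebesgue_measure]_(t in `[l i, (l i + r)%R]%classic) b%:E)%E).
  rewrite integral_cst//= lebesgue_measure_itv/= lte_fin.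
  case: ltP => [_|lr]; first by rewrite -EFinD addrAC subrr add0r EFinM.
  by rewrite (_ : r = 0) ?mulr0 ?mule0//; lra.
apply: ge0_le_integral => //.
- by apply/measurable_EFinP; exact: measurable_funTS.
- move=> t /=; rewrite in_itv/= => /andP[t1 t2]; rewrite lee_fin; apply: nub.
  by rewrite ler_norml; lra.
Qed.

End coordinates.

Section inner_form.
Context (R : realType) (X : hilbertType R).

Definition inner_form (u v : X) : R := inner v u.

Lemma inner_form_is_linear u : linear (inner_form u : X -> R^o).
Proof. by move=> c v v'; rewrite /inner_form innerDl innerZl. Qed.

HB.instance Definition _ u :=
  GRing.isLinear.Build R X R^o _ (inner_form u) (inner_form_is_linear u).

Lemma continuous_inner_form u : continuous (inner_form u).
Proof. exact: continuous_inner. Qed.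

End inner_form.

(** * Width, number and height of the bumps *)

Section width.
Context (R : realType).
Variables (a B sigma s2 L ck s : R) (d m : nat).
Hypotheses (a0 : 0 < a) (B0 : 0 < B) (sigma0 : 0 < sigma) (s2_gt0 : 0 < s2).
Hypotheses (L0 : 0 < L) (ck0 : 0 < ck) (s0 : 0 < s) (d0 : (0 < d)%N) (m0 : (0 < m)%N).

(* The minimum in [lower_rate], with [c = (16 * s2)^-1]. *)
Definition bump_width : R := Num.min 1 (Num.min (a / 8)
  ((B ^+ 2 * m%:R / ((16 * s2)^-1 * a ^+ d * sigma ^+ 2 * ck ^+ (2 * d) * L ^+ 2))
     `^ (- (2 * s + d%:R)^-1))).
Local Notation delta := bump_width.

Let D := B ^+ 2 * m%:R / ((16 * s2)^-1 * a ^+ d * sigma ^+ 2 * ck ^+ (2 * d) * L ^+ 2).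

Let D0 : 0 < D.
Proof. by rewrite divr_gt0 ?mulr_gt0 ?exprn_gt0 ?invr_gt0 ?mulr_gt0 ?ltr0n. Qed.

Lemma bump_width_gt0 : 0 < delta.
Proof. by rewrite !lt_min ltr01 divr_gt0//= powR_gt0. Qed.

Lemma bump_width_le1 : delta <= 1. Proof. by rewrite ge_min lexx. Qed.

Lemma bump_width_le_a : delta <= a / 8.
Proof. by rewrite !ge_min lexx orbT. Qed.

Lemma bump_width_pow : (delta `^ s) ^+ 2 * delta ^+ d <= D^-1.
Proof.
have de0 := ltW bump_width_gt0.
have -> : (delta `^ s) ^+ 2 * delta ^+ d = delta `^ (2 * s + d%:R).
  by rewrite -!powR_mulrn ?powR_ge0// -powRrM -powRD ?(mulrC s)//; rewrite (gt_eqF bump_width_gt0) implybT.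
have r0 : 0 < 2 * s + d%:R by rewrite addr_gt0 ?mulr_gt0 ?ltr0n.
apply: (@le_trans _ _ ((D `^ (- (2 * s + d%:R)^-1)) `^ (2 * s + d%:R))).
  by apply: ge0_ler_powR; rewrite ?nnegrE ?powR_ge0 ?(ltW r0)// !ge_min lexx !orbT.
by rewrite -powRrM mulNr mulVf ?gt_eqF// powR_inv1// ltW.
Qed.

Definition grid_size : nat := Num.truncn (2 * a / delta).
Local Notation n := grid_size.

(** Rounding down loses less than one width, and [delta <= a / 8]. *)
Lemma grid_size_bounds : a <= n%:R * delta <= 2 * a.
Proof.
have de0 := bump_width_gt0.
have /andP[n1 n2] : n%:R <= 2 * a / delta < n.+1%:R.
  by apply: truncn_itv; rewrite divr_ge0 ?(ltW de0)// mulr_ge0// ltW.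
move: n1 n2; rewrite ler_pdivlMr// ltr_pdivrMr// -natr1 => -> n2; rewrite andbT.
by have := bump_width_le_a; lra.
Qed.

(** Given [n * delta >= a], this reduces to [bump_width_pow], and the factor [(16 * s2)^-1] in [D]
    makes both sides equal. *)
Lemma bump_height_small : 16 * s2 * m%:R * (B / (ck ^+ d * L) * delta `^ s) ^+ 2 <=
  sigma ^+ 2 * (n ^ d)%:R.
Proof.
have de0 := bump_width_gt0.
have q0 : 0 < delta ^+ d by rewrite exprn_gt0.
apply: (@le_trans _ _ (sigma ^+ 2 * (a ^+ d / delta ^+ d))); last first.
  rewrite ler_wpM2l ?sqr_ge0// natrX -exprVn -exprMn; apply: lerXn2r; rewrite ?nnegrE//.
    by rewrite divr_ge0// ltW.
  by rewrite ler_pdivrMr//; have /andP[] := grid_size_bounds.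
have := bump_width_pow; rewrite -ler_pdivlMr// => H.
have G0 : 0 < ck ^+ d * L by rewrite mulr_gt0// exprn_gt0.
rewrite exprMn; apply: (le_trans (ler_wpM2l _ (ler_wpM2l _ H))).
- by rewrite !mulr_ge0// ltW.
- exact: sqr_ge0.
have m0' : 0 < m%:R :> R by rewrite ltr0n.
rewrite /D le_eqVlt; apply/orP; left; apply/eqP.
rewrite (mulnC 2) exprM; field.
by rewrite !gt_eqF ?exprn_gt0.
Qed.

(** From [n * delta >= a] follows [n * (b * (delta / 2)) >= a * b / 2], which is [iota / 4]. *)
Lemma grid_mass (b p : R) : 0 <= b -> 0 < p ->
  (2 * a * b * 4^-1) `^ (d%:R / p) <= ((n ^ d)%:R * (b * (delta / 2)) ^+ d) `^ p^-1.
Proof.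
move=> b0 p0; have de0 := bump_width_gt0.
have x0 : 0 <= 2 * a * b * 4^-1 by rewrite !mulr_ge0// ?ltW// invr_ge0.
rewrite powRrM powR_mulrn//; apply: ge0_ler_powR.
- by rewrite invr_ge0 ltW.
- by rewrite nnegrE exprn_ge0.
- by rewrite nnegrE mulr_ge0// exprn_ge0// mulr_ge0// divr_ge0// ltW.
rewrite natrX -exprMn; apply: lerXn2r; rewrite ?nnegrE//.
  by rewrite mulr_ge0// mulr_ge0// divr_ge0// ltW.
have /andP[an _] := grid_size_bounds.
have -> : n%:R * (b * (delta / 2)) = b / 2 * (n%:R * delta) by ring.
have -> : 2 * a * b * 4^-1 = b / 2 * a by field.
by rewrite ler_wpM2l// divr_ge0.
Qed.

End width.

(** * The bumps and their cells in the input space *)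

Section bump_family.
Context (R : realType) (X : hilbertType R) (mu : probability (borel X) R).
Variables (D : set nat) (lam : nat -> R) (phi : nat -> X) (a b delta : R) (d n k : nat).
Hypothesis eig : covariance_eigenbasis mu D lam phi.
Hypothesis indep : independent_family mu D (coordinate lam phi).
Hypothesis dens : densities_bounded_below mu D (coordinate lam phi) a b.
Hypothesis dD : `I_d `<=` D.
Hypothesis b0 : 0 < b.
Hypothesis delta0 : 0 < delta.
Hypothesis n_le : n%:R * delta <= 2 * a.
Local Notation Z := {ffun 'I_d -> 'I_n}.

Definition scaled_form (i : 'I_d) : {linear X -> R} :=
  inner_form ((Num.sqrt (lam i) * delta)^-1 *: phi i).

Lemma scaled_formE i x : scaled_form i x = coordinate lam phi i x / delta.
Proof. by rewrite /= /inner_form innerZr /coordinate invfM mulrC mulrA. Qed.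

Lemma continuous_scaled_form i : continuous (scaled_form i).
Proof. exact: continuous_inner_form. Qed.

(** In units of [delta], with the origin moved to the corner [- a] of the box, cells are unit cubes
    with integer corners. *)
Definition grid_bump (z : Z) (x : X) : R :=
  \prod_i plateau k.+1 0 (scaled_form i x + a / delta - (z i)%:R).

Lemma grid_bump_itv z x : 0 <= grid_bump z x <= 1.
Proof.
apply: (big_ind (fun y : R => 0 <= y <= 1)) => [|y1 y2 /andP[? ?] /andP[? ?]|i _].
- by rewrite ler01 lexx.
- by rewrite mulr_ge0//= mulr_ile1.
- exact: plateau_itv.
Qed.

Lemma norm_grid_bump z x : `|grid_bump z x| <= 1.
Proof. by have /andP[g0 g1] := grid_bump_itv z x; rewrite ger0_norm. Qed.

Lemma sum_grid_bump_sqr x : \sum_z grid_bump z x ^+ 2 <= 1.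
Proof.
have := @sum_prod_ffun_le R 'I_d 'I_n
  (fun i s => plateau k.+1 0 (scaled_form i x + a / delta - (s : 'I_n)%:R) ^+ 2) 1.
rewrite expr1n; under eq_bigr do rewrite prodrXl; apply => [i j|i]; first exact: sqr_ge0.
pose f s : R := plateau k.+1 0 s ^+ 2.
have := @sum_shift_le R f _ n (scaled_form i x + a / delta) 1.
under eq_bigr do rewrite ger0_norm ?sqr_ge0//; apply => s.
  by move=> s01; rewrite /f plateau_out ?expr0n.
have /andP[p0 p1] := plateau_itv k.+1 s.
by rewrite ger0_norm ?sqr_ge0// expr_le1.
Qed.

Lemma measurable_grid_bump z : measurable_fun setT (grid_bump z : borel X -> R).
Proof.
apply: measurable_borel_continuous => x.
apply: cvg_big => [|i _]; first exact: mul_continuous.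
apply: (continuous_comp (f := fun x => scaled_form i x + a / delta - (z i)%:R)); last first.
  exact: continuous_plateau.
by apply: cvgB; [apply: cvgD; [exact: continuous_scaled_form|exact: cvg_cst]|exact: cvg_cst].
Qed.

(** The lower corner of the middle half of the cell, where the bump equals 1; [insub] with default 0
    extends [z] to all of [nat], the index type of the coordinates. *)
Let corner (z : Z) (i : nat) : R :=
  - a + (oapp (fun i => (z i : nat)) 0%N (insub i))%:R * delta + delta / 4.

Definition grid_cell (z : Z) : set X :=
  [set x | forall i, (i < d)%N ->
     corner z i <= coordinate lam phi i x <= corner z i + delta / 2].

Lemma measurable_grid_cell z : measurable (grid_cell z : set (borel X)).
Proof.
have -> : grid_cell z = \bigcap_(i in `I_d)
    (coordinate lam phi i @^-1` `[corner z i, corner z i + delta / 2]).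
  by apply/seteqP; split => x /= H i id; have := H i id; rewrite /= in_itv.
apply: fin_bigcap_measurable => // i _.
by rewrite -[X in measurable X]setTI; exact: measurable_coordinate.
Qed.

(** In the middle half every rescaled coordinate is in [[1/4, 3/4]]; another [z'] moves some
    coordinate by at least 1, hence out of [[0, 1]]. *)
Lemma grid_cell_bump z z' x : grid_cell z x -> grid_bump z' x = (z' == z)%:R.
Proof.
move=> Qx.
have u i : 4^-1 <= scaled_form i x + a / delta - (z i)%:R <= 3 / 4.
  have := Qx i (ltn_ord i); rewrite /corner valK /= scaled_formE => /andP[q1 q2].
  rewrite -mulrDl lerBrDr lerBlDr ler_pdivlMr// ler_pdivrMr//; apply/andP; split; lra.
have [->|zz] := eqVneq z' z.
  by rewrite /grid_bump big1// => i _; exact: plateau_eq1.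
have /existsP[i zi] : [exists i, z' i != z i].
  by rewrite -negb_forall; apply: contraNN zz => /forallP H; apply/eqP/ffunP => i; exact/eqP.
rewrite /grid_bump (bigD1 i)//= plateau_out ?mul0r//.
have /andP[u1 u2] := u i.
have : (z i < z' i)%N || (z' i < z i)%N by rewrite -neq_ltn eq_sym.
by rewrite -!(ltr_nat R) => /orP[] H; move: H; rewrite !ltr_nat -!(ler_nat R) -natr1 => H; apply/orP; lra.
Qed.

Lemma grid_cell_measure z : (((b * (delta / 2)) ^+ d)%:E <= mu (grid_cell z))%E.
Proof.
apply: (small_box_probability indep dens dD (ltW b0)); first by rewrite divr_ge0// ltW.
move=> i id; rewrite /corner insubT /= -[Sub i id]/(Ordinal id).
have z1 : ((z (Ordinal id)).+1%:R <= n%:R :> R) by rewrite ler_nat.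
rewrite -natr1 in z1; have := ler_wpM2r (ltW delta0) z1.
have : 0 <= (z (Ordinal id))%:R * delta by rewrite mulr_ge0// ltW.
by rewrite mulrDl mul1r => ? ?; split; move: n_le delta0; lra.
Qed.

Variables (alpha B ck : R).
Hypothesis a0 : 0 < alpha.
Hypothesis a1 : alpha <= 1.
Hypothesis B0 : 0 < B.
Hypothesis delta1 : delta <= 1.
Hypothesis d0 : (0 < d)%N.
Hypothesis lam1 : lam 0%N <= 1.
Let M := plateau_bound R k.+1.
Hypothesis ckE : ck = 4 * M.
Let L := Lambda lam k alpha d.
Local Notation s := (k%:R + alpha).
Let h := B / (ck ^+ d * L) * delta `^ s.

Let lam_gt0 i : (i < d)%N -> 0 < lam i.
Proof. by case: eig => _ H _ _ _ id; apply: H; exact: dD. Qed.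

Let lam_le1 i : (i < d)%N -> lam i <= 1.
Proof.
by case: eig => _ _ H _ _ id; rewrite (le_trans _ lam1)// H//; apply: dD.
Qed.

Let sum_ge1 (f : nat -> R) : (forall i, (i < d)%N -> 1 <= f i) -> 1 <= \sum_(i < d) f i.
Proof.
move=> f1; case: d d0 f1 => // d' _ f1; rewrite big_ord_recl (le_trans (f1 0%N _))// lerDl.
by apply: sumr_ge0 => i _; rewrite (le_trans ler01)// f1.
Qed.

Let G := \sum_(j < d) (lam j)^-1.
Let H := (\sum_(i < d) lam i `^ (- (alpha / (2 - alpha)))) `^ (1 - alpha / 2).

(** Eigenvalues at most 1 make [G] and [H] at least 1, so that derivatives of order below [k] obey
    the bound for the highest ones. *)
Let G1 : 1 <= G.
Proof. by apply: (@sum_ge1 (fun i => (lam i)^-1)) => i id; rewrite invf_ge1 ?lam_le1 ?lam_gt0. Qed.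

Let H1 : 1 <= H.
Proof.
have one_powR (r : R) : 1 `^ r = 1 by rewrite powR1.
have K : 1 <= \sum_(i < d) lam i `^ (- (alpha / (2 - alpha))).
  apply: (@sum_ge1 (fun i => lam i `^ (- (alpha / (2 - alpha))))) => i id.
  rewrite powRN invf_ge1 ?powR_gt0 ?lam_gt0//.
  rewrite -[X in _ <= X](one_powR (alpha / (2 - alpha))); apply: ge0_ler_powR; rewrite ?nnegrE ?(ltW (lam_gt0 id))//.
    by rewrite divr_ge0 ?(ltW a0)// subr_ge0 (le_trans a1)// ler1n.
  exact: lam_le1.
rewrite -[X in X <= _](one_powR (1 - alpha / 2)); apply: ge0_ler_powR; rewrite ?nnegrE ?(le_trans ler01 K)//.
by rewrite subr_ge0 ler_pdivrMr// mul1r (le_trans a1)// ler1n.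
Qed.

Let LE : L = k.+2%:R * H * G `^ (k%:R / 2).
Proof. by rewrite /L /Lambda addn2. Qed.

Lemma Lambda_gt0 : 0 < L.
Proof.
have [Hp Gp] : 0 < H /\ 0 < G by split; [exact: lt_le_trans ltr01 H1|exact: lt_le_trans ltr01 G1].
by rewrite LE; apply: mulr_gt0; [apply: mulr_gt0 => //; rewrite ltr0n|exact: powR_gt0].
Qed.

Let K := delta^-1 * G `^ (2^-1).

Let basis1 i : (i < d)%N -> `|phi i| = 1.
Proof. by case: eig => _ _ _ [H0 _ _] _ id; apply: H0; exact: dD. Qed.

Let basis_orth i j : (i < d)%N -> (j < d)%N -> i <> j -> inner (phi i) (phi j) = 0.
Proof. by case: eig => _ _ _ [_ H0 _] _ id jd; apply: H0; exact: dD. Qed.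

Lemma sum_scaled_form_le (v : X) : `|v| <= 1 -> \sum_i `|scaled_form i v| <= K.
Proof.
move=> v1; have := sum_coordinate_powR v ltr01 (lexx 1) basis1 basis_orth lam_gt0.
rewrite (eq_bigr (fun i : 'I_d => `|coordinate lam phi i v|)); last by move=> i _; rewrite powRr1.
rewrite powRr1// [X in X `^ _](_ : _ = G); last first.
  apply: eq_bigr => i _; rewrite (_ : 2 - 1 = 1); last by lra.
  by rewrite divr1 powR_inv1// ltW// lam_gt0.
rewrite (_ : 1 - 1 / 2 = 2^-1); last by lra.
move=> HG; rewrite (eq_bigr (fun i : 'I_d => delta^-1 * `|coordinate lam phi i v|)); last first.
  by move=> i _; rewrite scaled_formE normrM normfV (gtr0_norm delta0) mulrC.
rewrite -mulr_sumr ler_wpM2l ?invr_ge0 ?(ltW delta0)// (le_trans HG)//.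
by rewrite ler_piMl ?powR_ge0.
Qed.

Lemma sum_scaled_form_powR_le (v : X) :
  \sum_i `|scaled_form i v| `^ alpha <= (delta `^ (- alpha) * H) * `|v| `^ alpha.
Proof.
have HH := sum_coordinate_powR v a0 a1 basis1 basis_orth lam_gt0.
rewrite (eq_bigr (fun i : 'I_d => delta `^ (- alpha) * `|coordinate lam phi i v| `^ alpha)); last first.
  move=> i _; rewrite scaled_formE normrM normfV (gtr0_norm delta0) mulrC.
  by rewrite powRM ?invr_ge0 ?(ltW delta0)// -powR_inv1 ?(ltW delta0)// -powRrM mulN1r.
by rewrite -mulr_sumr -mulrA ler_wpM2l ?powR_ge0// mulrC.
Qed.

(** The [k]-th derivative costs [K ^+ k] and its Hölder seminorm a further factor [H] over the power
    [alpha] of [delta]. In [h], the power [k + alpha] of [delta] compensates the negative ones,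
    [ck ^+ d] absorbs [M ^+ d * 4], and [Lambda] supplies the remaining factors. *)
Lemma grid_bump_holder_ball (Y : normedModType R) (w : Y) (tau : {ffun Z -> bool}) :
  `|w| = 1 ->
  holder_ball k alpha B (fun x => (\sum_z h * (-1) ^+ tau z * grid_bump z x) *: w).
Proof.
move=> w1.
have M1 : 1 <= M := plateau_bound_ge1 R k.+1.
have Mp : 0 < M by lra.
have L0 := Lambda_gt0.
have de0 := ltW delta0.
have ds : 0 < delta `^ s by rewrite powR_gt0.
have ck0 : 0 < ck by rewrite ckE; lra.
have h0 : 0 <= h by rewrite /h mulr_ge0 ?divr_ge0 ?mulr_ge0 ?exprn_ge0 ?powR_ge0// ltW.
(* As [d >= 1], a single factor 4 is at most [4 ^+ d]. *)
have Mck : M ^+ d * 4 <= ck ^+ d.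
  rewrite ckE (_ : (4 * M) ^+ d = M ^+ d * 4 ^+ d); last by rewrite mulrC; exact: exprMn.
  apply: ler_wpM2l; first by rewrite exprn_ge0 ?(ltW Mp).
  have := @ler_weXn2l R 4 _ 1%N d d0; rewrite expr1; apply; by rewrite ler1n.
have hM : h * (M ^+ d * 4) <= B / L * delta `^ s.
  rewrite /h mulrAC ler_wpM2r ?(ltW ds)// invfM -!mulrA ler_wpM2l ?(ltW B0)//.
  rewrite mulrCA ler_piMr ?invr_ge0 ?(ltW L0)// ler_pdivrMl ?exprn_gt0//.
  by rewrite mulr1.
have K0 : 0 <= K by rewrite /K mulr_ge0 ?invr_ge0 ?powR_ge0.
have KE j : K ^+ j = delta `^ (- j%:R) * G `^ (j%:R / 2).
  by rewrite /K exprMn exprVn -powR_mulrn// -powRN -powR_mulrn ?powR_ge0// -powRrM (mulrC 2^-1).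
have dpow r t : delta `^ r * delta `^ t = delta `^ (r + t).
  by rewrite powRD// (gt_eqF delta0) implybT.
have G0 : 0 < G by rewrite (lt_le_trans ltr01 G1).
have Gk j : (j <= k)%N -> G `^ (j%:R / 2) <= G `^ (k%:R / 2).
  by move=> jk; apply: ler_powR => //; rewrite ler_wpM2r ?ler_nat// invr_ge0.
have BL : B / L * (G `^ (k%:R / 2) * H) = B / k.+2%:R.
  have gk : G `^ (k%:R / 2) != 0 by rewrite gt_eqF// powR_gt0.
  have hh : H != 0 by rewrite gt_eqF// (lt_le_trans ltr01 H1).
  have F (x y z : R) : x != 0 -> y != 0 -> z != 0 -> B / (x * z * y) * (y * z) = B / x.
    by move=> x0 y0 z0; field; rewrite x0 y0 z0.
  by rewrite LE F// pnatr_eq0.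
have BL0 : 0 < B / L by rewrite divr_gt0.
apply: (@bump_grid_holder_ball R X d n k scaled_form (fun=> a / delta)
  (fun z => h * (-1) ^+ tau z) h continuous_scaled_form h0 _ Y w alpha B K
  (delta `^ (- alpha) * H) a0 a1 w1 K0 sum_scaled_form_le sum_scaled_form_powR_le).
- by move=> z; rewrite normrM normr_sign mulr1 ger0_norm.
- move=> j jk; rewrite -BL.
  apply: (@le_trans _ _ (K ^+ j * (B / L * delta `^ s))).
    rewrite ler_wpM2l ?exprn_ge0// (le_trans _ hM)// ler_wpM2l// ler_peMr ?exprn_ge0 ?(ltW Mp)//.
    by rewrite ler1n.
  rewrite KE mulrCA ler_wpM2l ?(ltW BL0)// mulrAC dpow mulrC.
  apply: ler_pM; rewrite ?powR_ge0 ?Gk//.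
  (* The remaining exponent of [delta] is nonnegative and [delta <= 1], so the left side is at most
     1. *)
  apply: le_trans H1; rewrite -[X in _ <= X](powRr0 delta).
  apply: ger_powR; rewrite ?delta0//.
  have : j%:R <= k%:R :> R by rewrite ler_nat.
  by move=> jk'; rewrite addrA addr_ge0 ?(ltW a0)// addrC subr_ge0.
- rewrite -BL KE.
  have -> : delta `^ (- k%:R) * G `^ (k%:R / 2) * (h * (M ^+ d * (4 * (delta `^ (- alpha) * H)))) =
    (h * (M ^+ d * 4)) * (delta `^ (- k%:R) * delta `^ (- alpha)) * (G `^ (k%:R / 2) * H) by ring.
  apply: ler_wpM2r; first by rewrite mulr_ge0 ?powR_ge0.
  rewrite dpow (le_trans (ler_wpM2r _ hM)) ?powR_ge0//.
  rewrite -(mulrA (B / L)) (dpow s).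
  by rewrite -opprD subrr powRr0 mulr1.
Qed.

End bump_family.

(** Supplies a direction in which the noise is not degenerate. *)
Lemma has_trace_neq0 (R : realType) (Y : hilbertType R) (Ups : Y -> Y) (t : \bar R) :
  has_trace Ups t -> t != 0%E -> exists e, inner (Ups e) e != 0.
Proof.
move=> [S _ St] t0; apply: contrapT => H; move/eqP: t0; apply; rewrite -St.
apply: esum1 => e _; congr EFin; apply/eqP; apply: contrapT => /negP e0.
by apply: H; exists e.
Qed.

(** * From the hypercube to the minimax risks *)

Section lower_bound.
Context (R : realType) (X Y : hilbertType R).
Variables (gam : probability (borel Y) R) (Ups : Y -> Y) (e : Y).
Hypothesis sepY : separable Y.
Hypothesis gaussian_gam : is_gaussian gam.
Hypothesis mean_gam : mean_zero gam.
Hypothesis cov_gam : is_covariance gam Ups.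
Hypothesis s2_gt0 : 0 < inner (Ups e) e.
Hypothesis w1 : `|Ups e| = 1.
Variables (p B sigma : R) (m : nat).
Hypotheses (p1 : 1 <= p) (B0 : 0 < B) (sigma0 : 0 < sigma) (m0 : (0 < m)%N).
Variables (mu : probability (borel X) R) (D : set nat) (lam : nat -> R)
  (phi : nat -> X) (a b : R).
Hypothesis eig : covariance_eigenbasis mu D lam phi.
Hypothesis indep : independent_family mu D (coordinate lam phi).
Hypotheses (a0 : 0 < a) (b0 : 0 < b).
Hypothesis dens : densities_bounded_below mu D (coordinate lam phi) a b.
Hypothesis lam1 : lam 0%N <= 1.
Variables (k : nat) (alpha : R) (d : nat).
Hypotheses (alpha0 : 0 < alpha) (alpha1 : alpha <= 1) (d0 : (0 < d)%N) (dD : `I_d `<=` D).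

Let s2 := inner (Ups e) e.
Let ck := 4 * plateau_bound R k.+1.
Let L := Lambda lam k alpha d.
Let s := k%:R + alpha.
Let delta := bump_width a B sigma s2 L ck s d m.
Let n := grid_size a B sigma s2 L ck s d m.
Let h := B / (ck ^+ d * L) * delta `^ s.
(** A lower bound for the total mass of the [n ^ d] cells. *)
Let W := (n ^ d)%:R * (b * (delta / 2)) ^+ d.
Let rate := lower_rate ck 4^-1 (16 * s2)^-1 lam k alpha p B sigma a b m d.
Local Notation Z := {ffun 'I_d -> 'I_n}.

Let L0 : 0 < L.
Proof. by have := @Lambda_gt0 R X mu D lam phi d k eig dD alpha alpha0 alpha1 d0 lam1. Qed.

Let ck0 : 0 < ck.
Proof. by rewrite mulr_gt0// (lt_le_trans ltr01)// plateau_bound_ge1. Qed.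

Let s0 : 0 < s. Proof. by rewrite ltr_wpDl. Qed.

Let delta0 : 0 < delta.
Proof. exact: bump_width_gt0. Qed.

Let n_bounds : a <= n%:R * delta <= 2 * a.
Proof. exact: grid_size_bounds. Qed.

Let cardZ : #|Z| = (n ^ d)%N. Proof. by rewrite card_ffun !card_ord. Qed.

Let n0 : (0 < n)%N.
Proof.
rewrite lt0n; apply/negP => /eqP n0; move: n_bounds; rewrite n0 mul0r => /andP[a' _].
by have := lt_le_trans a0 a'; rewrite ltxx.
Qed.

Let h0 : 0 < h.
Proof. by rewrite /h mulr_gt0 ?powR_gt0// divr_gt0// mulr_gt0// exprn_gt0. Qed.

Let rate_le : 8^-1 * rate <= h * W `^ p^-1 / 8.
Proof.
rewrite mulrC ler_wpM2r// /rate /lower_rate -/L -/s -/delta.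
have p0 : 0 < p by exact: lt_le_trans p1.
rewrite mulrAC ler_wpM2l ?(ltW h0)//.
by apply: grid_mass => //; exact: ltW.
Qed.

Let psi := @grid_bump R X lam phi a delta d n k.
Let Q := @grid_cell R X lam phi a delta d n.
Let F := hypercube_fun Ups e psi h.

Let F_holder_ball tau : holder_ball k alpha B (F tau).
Proof.
have de1 : delta <= 1 by exact: bump_width_le1.
exact: (grid_bump_holder_ball a eig dD delta0 alpha0 alpha1 B0 de1 d0 lam1 (erefl ck)).
Qed.

Let Z_gt0 : (0 < #|Z|)%N.
Proof. by rewrite cardZ expn_gt0 n0. Qed.

Let muQ z : ((W / #|Z|%:R)%:E <= mu (Q z))%E.
Proof.
have /andP[_ n_le] := n_bounds.
apply: le_trans (grid_cell_measure indep dens dD b0 delta0 n_le z).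
rewrite cardZ /W mulrAC divff ?mul1r// pnatr_eq0 expn_eq0 negb_and -lt0n n0.
by [].
Qed.

Let W_ge0 : 0 <= W.
Proof. by rewrite mulr_ge0// exprn_ge0// mulr_ge0 ?(ltW b0)// divr_ge0// ltW. Qed.

Let h_small : 16 * s2 * m%:R * h ^+ 2 <= sigma ^+ 2 * #|Z|%:R.
Proof. by rewrite cardZ; exact: bump_height_small. Qed.

Let psiQ z z' x : Q z x -> psi z' x = (z' == z)%:R.
Proof. exact: grid_cell_bump. Qed.

Let mQ z : measurable (Q z : set (borel X)).
Proof. exact: measurable_grid_cell. Qed.

Lemma minimax_fixed_ge :
  ((8^-1 * rate)%:E <= minimax_fixed mu p gam sigma m (holder_ball k alpha B))%E.
Proof.
apply: le_ereal_inf_tmp => _ [xs _ <-]; apply: le_ereal_inf_tmp => _ [Fhat est <-].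
have [tau Htau] := assouad_fixed p1 sepY gaussian_gam mean_gam cov_gam s2_gt0 w1 sigma0
  Z_gt0 (measurable_grid_bump lam phi a delta k) (norm_grid_bump lam phi a delta k)
  (sum_grid_bump_sqr lam phi a delta d n k) mQ
  psiQ muQ h0 W_ge0 h_small xs est.
apply: (@le_trans _ _ (h * W `^ p^-1 / 8)%:E); first by rewrite lee_fin; exact: rate_le.
apply: (le_trans Htau); apply: ereal_sup_ubound.
by exists (F tau).
Qed.

Lemma minimax_random_ge :
  ((8^-1 * rate)%:E <= minimax_random mu p gam sigma m (holder_ball k alpha B))%E.
Proof.
apply: le_ereal_inf_tmp => _ [nu _ <-]; apply: le_ereal_inf_tmp => _ [Fhat est <-].
have [tau Htau] := assouad_random p1 sepY gaussian_gam mean_gam cov_gam s2_gt0 w1 sigma0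
  Z_gt0 (measurable_grid_bump lam phi a delta k) (norm_grid_bump lam phi a delta k)
  (sum_grid_bump_sqr lam phi a delta d n k) mQ
  psiQ muQ h0 W_ge0 h_small nu est.
apply: (@le_trans _ _ (h * W `^ p^-1 / 8)%:E); first by rewrite lee_fin; exact: rate_le.
apply: (le_trans Htau); apply: ereal_sup_ubound.
by exists (F tau).
Qed.

End lower_bound.

Theorem theorem6p3 (R : realType) :
  exists (C : R) (ck : nat -> R -> R) (cp : R -> R),
  [/\ 0 < C,
      forall (k : nat) (alpha : R), 0 < ck k alpha,
      forall p : R, 0 < cp p &
      forall (Y : hilbertType R) (Upsilon : Y -> Y),
      separable Y -> has_trace Upsilon 1%E ->
      exists2 c : R, 0 < c &
      forall (gam : probability (borel Y) R),
      is_gaussian gam -> mean_zero gam -> is_covariance gam Upsilon ->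
      forall (X : hilbertType R), separable X ->
      forall (p B sigma : R) (m : nat),
      1 <= p -> 0 < B -> 0 < sigma -> (0 < m)%N ->
      forall (mu : probability (borel X) R) (D : set nat) (lam : nat -> R)
        (phi : nat -> X) (a b : R),
      mean_zero mu -> finite_second_moment mu ->
      covariance_eigenbasis mu D lam phi ->
      independent_family mu D (coordinate lam phi) ->
      0 < a -> 0 < b ->
      densities_bounded_below mu D (coordinate lam phi) a b ->
      moments_bounded mu D (coordinate lam phi) (Num.max p 2) ->
      lam 0%N <= 1 ->
      forall (k : nat) (alpha : R), 0 < alpha -> alpha <= 1 ->
      forall d : nat, (0 < d)%N -> `I_d `<=` D ->
      let rate := lower_rate (ck k alpha) (cp p) c lam k alpha p B sigma a b m d in
      ((C * rate)%:E <= minimax_fixed mu p gam sigma m (holder_ball k alpha B))%E /\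
      ((C * rate)%:E <= minimax_random mu p gam sigma m (holder_ball k alpha B))%E].
Proof.
exists 8^-1, (fun k _ => 4 * plateau_bound R k.+1), (fun=> 4^-1); split => //.
  by move=> k _; rewrite mulr_gt0// (lt_le_trans ltr01)// plateau_bound_ge1.
move=> Y Ups sepY trY; have [e0 e0P] := has_trace_neq0 trY (oner_neq0 _).
have w0 : 0 < `|Ups e0|.
  by rewrite normr_gt0; apply: contraNneq e0P => ->; rewrite inner0l.
(* This is [(16 * s2)^-1] for the normalised [e] chosen below. It has to be stated in terms of [Ups]
   alone, before a Gaussian law makes [Ups] homogeneous and positive; hence the unnormalised [e0]
   and the absolute value. *)
exists ((16 * (`|inner (Ups e0) e0| / `|Ups e0| ^+ 2))^-1).
  by rewrite invr_gt0 mulr_gt0// divr_gt0 ?exprn_gt0// normr_gt0.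
move=> gam gau mean_gam cov_gam X sepX p B sigma m p1 B0 sigma0 m0 mu D lam phi a b.
move=> _ _ eig indep a0 b0 dens _ lam1 k alpha alpha0 alpha1 d d0 dD rate.
(* It is nonzero by choice, and nonnegative as a variance of [gam]. *)
have pos : 0 < inner (Ups e0) e0.
  rewrite lt_def e0P /= -lee_fin -cov_gam; apply: integral_ge0 => y _.
  by rewrite lee_fin -expr2 sqr_ge0.
pose e := `|Ups e0|^-1 *: e0.
have Ue : Ups e = `|Ups e0|^-1 *: Ups e0 by exact: (covarianceZ cov_gam).
have w1 : `|Ups e| = 1.
  by rewrite Ue normrZ ger0_norm ?invr_ge0// mulVf// gt_eqF.
have s2E : inner (Ups e) e = `|inner (Ups e0) e0| / `|Ups e0| ^+ 2.
  by rewrite Ue innerZl innerZr (gtr0_norm pos); field; rewrite gt_eqF.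
have s2_gt0 : 0 < inner (Ups e) e by rewrite s2E divr_gt0 ?exprn_gt0// gtr0_norm.
rewrite /rate -s2E; split.
- exact: (minimax_fixed_ge sepY gau mean_gam cov_gam s2_gt0 w1 p1 B0 sigma0 m0 eig indep a0 b0 dens
    lam1 k alpha0 alpha1 d0 dD).
- exact: (minimax_random_ge sepY gau mean_gam cov_gam s2_gt0 w1 p1 B0 sigma0 m0 eig indep a0 b0 dens
    lam1 k alpha0 alpha1 d0 dD).
Qed.
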